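(* Let $\Bbbk$ be a field of characteristic zero, let $d,n\geq 1$ be integers, and let $\ell_1,\ldots,\ell_{n+1}\in \Bbbk[x_1,\ldots,x_n]$ be general linear forms. Then the algebra $$R_{n,n+1,d}=\Bbbk[x_1,x_2,\ldots,x_n]/\langle \ell_1^d,\ell_2^d,\ldots,\ell_{n+1}^d \rangle$$ fails the Weak Lefschetz property except when $n\le 3$, or $d=1$, or $(n,d) \in \{ (4,2), (5,2), (5,3), (7,2) \}$; and in these exceptional cases, the Weak Lefschetz property holds.
   Context: A standard graded algebra $A=\bigoplus_{i\ge 0}A_i$ over $\Bbbk$ satisfies the Weak Lefschetz property (WLP) if there exists a linear form $\ell$ such that the multiplication map $\times \ell:A_i \to A_{i+1}$ has maximal rank (i.e. is injective or surjective) for every degree $i$; otherwise it fails the WLP. A statement about ''general linear forms'' $\ell_1,\ldots,\ell_m$ means that it holds for all tuples $(\ell_1,\ldots,\ell_m)$ in some nonempty Zariski-open subset of the space of $m$-tuples of linear forms in $\Bbbk[x_1,\ldots,x_n]$. *)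

(* Defs.v *)
From HB Require Import structures.
From mathcomp Require Import all_boot all_algebra.
From mathcomp Require Import ring_quotient boolp.
From mathcomp Require Import mpoly.

Set Implicit Arguments.
Unset Strict Implicit.
Unset Printing Implicit Defensive.

Import GRing.Theory.
Local Open Scope ring_scope.
Local Open Scope quotient_scope.

(* [gr i] is the set of homogeneous elements of degree [i] of the graded
   algebra [A]; the linear forms of [A] are the elements of [gr 1]. *)
Definition weak_lefschetz (k : fieldType) (A : comAlgType k)
    (gr : nat -> A -> Prop) : Prop :=
  exists2 l : A, gr 1%N l &
    forall i : nat,
      (forall x y : A, gr i x -> gr i y -> l * x = l * y -> x = y) \/
      (forall z : A, gr i.+1 z -> exists2 x : A, gr i x & l * x = z).

Arguments weak_lefschetz {k} A gr.

Section PowersOfLinearForms.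

Variables (k : fieldType) (m n : nat).

(* An m-tuple of linear forms in k[x_1, .., x_n] is given by the m x n matrix
   of its coefficients. *)
Definition linear_form (a : 'M[k]_(m, n)) (i : 'I_m) : {mpoly k[n]} :=
  \sum_(j < n) a i j *: 'X_j.

(* The ideal generated by the d-th powers. The argument [d_gt0] is only there
   to make the ideal proper, as required by [idealr]. *)
Definition pow_ideal (a : 'M[k]_(m, n)) (d : nat) (d_gt0 : (0 < d)%N)
    : pred {mpoly k[n]} :=
  fun p => `[< exists c : 'I_m -> {mpoly k[n]},
                 p = \sum_(i < m) c i * linear_form a i ^+ d >].

Variables (a : 'M[k]_(m, n)) (d : nat) (d_gt0 : (0 < d)%N).

Lemma pow_idealP p :
  reflect (exists c : 'I_m -> {mpoly k[n]},
             p = \sum_(i < m) c i * linear_form a i ^+ d)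
          (p \in pow_ideal a d_gt0).
Proof. exact: asboolP. Qed.

Lemma pow_ideal_closed : idealr_closed (pow_ideal a d_gt0).
Proof.
split.
- apply/pow_idealP; exists (fun=> 0).
  by rewrite big1 // => i _; rewrite mul0r.
- apply/pow_idealP => -[c /(congr1 (fun p => p.@[fun=> 0]))].
  rewrite meval1 raddf_sum big1 => [/eqP|i _]; first by rewrite oner_eq0.
  rewrite /= mevalM rmorphXn /= /linear_form raddf_sum big1 => [|j _].
    by rewrite expr0n gtn_eqF // mulr0.
  by rewrite /= mevalZ mevalXU mulr0.
- move=> u p q /pow_idealP[b ->] /pow_idealP[c ->]; apply/pow_idealP.
  exists (fun i => u * b i + c i); rewrite mulr_sumr -big_split /=.
  by apply: eq_bigr => i _; rewrite mulrDl mulrA.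
Qed.

HB.instance Definition _ :=
  isIdealr.Build {mpoly k[n]} (pow_ideal a d_gt0) pow_ideal_closed.

Definition pow_idealr : idealr {mpoly k[n]} := pow_ideal a d_gt0.

Definition pow_quot : Type := {ideal_quot pow_idealr}.

HB.instance Definition _ := GRing.ComNzRing.on pow_quot.

Definition pow_proj (p : {mpoly k[n]}) : pow_quot :=
  \pi_({ideal_quot pow_idealr}) p.

Lemma pow_proj_is_zmod_morphism : zmod_morphism pow_proj.
Proof. exact: raddfB. Qed.

Lemma pow_proj_is_monoid_morphism : monoid_morphism pow_proj.
Proof. by split; [exact: rmorph1 | exact: rmorphM]. Qed.

HB.instance Definition _ :=
  GRing.isZmodMorphism.Build {mpoly k[n]} pow_quot pow_proj
    pow_proj_is_zmod_morphism.
HB.instance Definition _ :=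
  GRing.isMonoidMorphism.Build {mpoly k[n]} pow_quot pow_proj
    pow_proj_is_monoid_morphism.

Definition pow_scale (c : k) (x : pow_quot) : pow_quot := pow_proj c%:MP * x.

Lemma pow_scaleA b c x : pow_scale b (pow_scale c x) = pow_scale (b * c) x.
Proof. by rewrite /pow_scale mulrA -rmorphM /= -mpolyCM. Qed.

Lemma pow_scale1 : left_id 1 pow_scale.
Proof. by move=> x; rewrite /pow_scale rmorph1 mul1r. Qed.

Lemma pow_scaleDr : right_distributive pow_scale +%R.
Proof. by move=> c x y; rewrite /pow_scale mulrDr. Qed.

Lemma pow_scaleDl x : {morph pow_scale^~ x : b c / b + c}.
Proof. by move=> b c; rewrite /pow_scale mpolyCD rmorphD mulrDl. Qed.

HB.instance Definition _ := GRing.Zmodule_isLmodule.Build k pow_quot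
  pow_scaleA pow_scale1 pow_scaleDr pow_scaleDl.

Lemma pow_scaleAl (c : k) (x y : pow_quot) : c *: (x * y) = c *: x * y.
Proof. exact: mulrA. Qed.

HB.instance Definition _ :=
  GRing.Lmodule_isLalgebra.Build k pow_quot pow_scaleAl.
HB.instance Definition _ := GRing.Lalgebra_isComAlgebra.Build k pow_quot.

Definition pow_quot_gr (i : nat) (x : pow_quot) : Prop :=
  exists2 p : {mpoly k[n]}, p \is i.-homog & x = pow_proj p.

End PowersOfLinearForms.

Arguments pow_quot {k m n} a {d} d_gt0.
Arguments pow_quot_gr {k m n} a {d} d_gt0 i x.

(* The complement of the common zero locus of an arbitrary set of polynomials
   in the m * n matrix entries. *)
Definition zariski_open (k : fieldType) (m n : nat)
    (U : 'M[k]_(m, n) -> Prop) : Prop :=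
  exists F : {mpoly k[m * n]} -> Prop, forall a : 'M[k]_(m, n),
    U a <-> exists2 f, F f & f.@[fun t => mxvec a ord0 t] != 0.

Definition for_general_linear_forms (k : fieldType) (m n : nat)
    (P : 'M[k]_(m, n) -> Prop) : Prop :=
  exists U : 'M[k]_(m, n) -> Prop,
    [/\ zariski_open U, exists a, U a & forall a, U a -> P a].

Definition exceptional (n d : nat) : bool :=
  [|| (n <= 3)%N, d == 1%N |
      (n, d) \in [:: (4, 2); (5, 2); (5, 3); (7, 2)]%N].

(* Main.v *)
(* General forms are [x_1, .., x_n] and [L = x_1 + .. + x_n] up to a linear
   change of variables, which turns the algebra into the quotient [R] of
   [A = k[x] / (x_1^d, .., x_n^d)] by [L^d]. For a linear form
   [l = sum_i c_i x_i], let [coker_j(c)] be the dimension of the degree [j] part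
   of [R / l R]. Multiplication by [L^d] is injective on the low degrees of [A]
   (sl_2-theory), so that a multiplication by [l] of maximal rank in degree
   [j - 1 < n (d - 1) / 2] gives [coker_j(c) = max(0, e_j)], with [e_j] read off
   the Hilbert series of [A].

   By duality [coker_j(c)] counts the forms [G] of degree [j], of degree [< d]
   in each variable, that are killed by [D_c = sum_i c_i d/dx_i] and by
   [(sum_i d/dx_i)^d]. Take [lam + d - 1] sets of variables such that each
   variable lies in [d - 1] of them and [lam] of them have odd size. The product
   over these sets of the determinants with columns
   [.., c_i X_i, c_i, X_i, 1] has these properties for
   [2 j + lam = n (d - 1)]. For generic [c] such products with distinct leading
   monomials are independent, and semicontinuity of the rank extends the
   resulting lower bound on [coker_j(c)] to every [c]. Outside the exceptional
   list it beats [max(0, e_j)] for a suitable [lam].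

   Conversely, [coker_j(c) <= max(0, e_j)] up to the first vanishing cokernel is
   enough for the weak Lefschetz property. For [n = 3] a form in the dual space
   is a binary form divisible by powers of three distinct linear forms; the
   four sporadic cases are settled by Gaussian elimination over the integers. *)

Require Import Defs.
From Stdlib Require Import ZArith Lia.
From HB Require Import structures.
From mathcomp Require Import all_boot all_order all_algebra fingroup perm.
From mathcomp Require Import fraction generic_quotient ring_quotient.
From mathcomp Require Import mpoly zify ring ssrZ.

Set Implicit Arguments.
Unset Strict Implicit.
Unset Printing Implicit Defensive.

Import Order.TTheory GRing.Theory.
Local Open Scope ring_scope.

(** * Window sums and Hilbert functions *)

(** The parameter [lam] is subject to two opposite demands. For odd [n] the construction of a
    suitable set family needs [d - 1 <= n * lam], so [lam] cannot be small. But one product of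
    determinants refutes maximal rank only if [e_j <= 0], which is available close to the middle
    degree, that is, for small [lam]. The inequality [e_j <= 0] is therefore strengthened to a
    reflection property of [dcomps] that is inherited when a variable is added; in four variables it
    holds whenever [3 * (lam + 1) <= d]. Together with the parity of [lam] the two demands are
    compatible at [n = 5] for all large [d]. A finite list of [d] remains and is settled by
    evaluation, including pairs [(n, d)] with [e_j > 0], where several independent products must be
    counted. For this count a set family is encoded by the word of exponents of the [X_i] in its
    leading monomial. A word is a path in the number of sets met an odd number of times so far, so
    that existence and enumeration of families become elementary. *)

Ltac zcases := repeat (case: Z.eqb_spec => ?); repeat (case: Z.ltb_spec => ?).

Section Counting.

Local Open Scope Z_scope.

(** Multiplication of a generating series by [1 + q + .. + q ^ (d - 1)]. Arguments in [Z] make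
    shifts below degree zero harmless. *)
Fixpoint window_sum (d : nat) (f : Z -> Z) (j : Z) : Z :=
  if d is d'.+1 then window_sum d' f j + f (j - Z.of_nat d') else 0.

Lemma window_sumS d f j :
  window_sum d.+1 f j = f j + window_sum d f (j - 1).
Proof.
elim: d f j => [|d IH] f j; first by rewrite /= Z.sub_0_r; lia.
rewrite [LHS]/= -/(window_sum d.+1 f j) IH /=.
have -> : j - Z.pos (Pos.of_succ_nat d) = j - 1 - Z.of_nat d by lia.
lia.
Qed.

Lemma eq_window_sum d f g j : (forall y, f y = g y) ->
  window_sum d f j = window_sum d g j.
Proof. by move=> fg; elim: d => //= d ->; rewrite fg. Qed.

Lemma window_sumB d f g j :
  window_sum d (fun y => f y - g y) j = window_sum d f j - window_sum d g j.
Proof. by elim: d => //= d ->; lia. Qed.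

Lemma window_sum_shift d f j a :
  window_sum d (fun y => f (y - a)) j = window_sum d f (j - a).
Proof.
elim: d => //= d ->; congr (_ + f _); lia.
Qed.

Lemma window_sum_rev d f j :
  window_sum d f j = window_sum d (fun y => f (2 * j - Z.of_nat d + 1 - y)) j.
Proof.
elim: d j => // d IH j; rewrite [RHS]window_sumS [LHS]/= IH.
rewrite -[in RHS](window_sum_shift d _ j 1) Z.add_comm; congr (f _ + _); first lia.
by apply: eq_window_sum => y; congr f; lia.
Qed.

(** The Hilbert function of [k[x_1, .., x_n] / (x_1 ^ d, .., x_n ^ d)], extended by zero. *)
Fixpoint comps (n d : nat) : Z -> Z :=
  if n is n'.+1 then window_sum d (comps n' d)
  else fun j => if j =? 0 then 1 else 0.

(* Coefficients of [(1 - q) (1 + q + .. + q^(d - 1))^n]. *)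
Definition dcomps (n d : nat) (j : Z) : Z := comps n d j - comps n d (j - 1).

Lemma dcompsS n d j : dcomps n.+1 d j = window_sum d (dcomps n d) j.
Proof. by rewrite /dcomps window_sumB window_sum_shift. Qed.

Definition left_heavy (f : Z -> Z) (r : Z) : Prop :=
  forall j j', j <= j' -> j + j' = r -> f j' <= f j.

(* Terms symmetric about [r / 2] cancel, and what remains of the window lies
   to the left of [r / 2]. *)
Lemma window_sum_antisym_ge0 d g r j :
  (forall y, g (r - y) = - g y) -> (forall y, 2 * y <= r -> 0 <= g y) ->
  2 * j <= r + Z.of_nat d - 1 -> 0 <= window_sum d g j.
Proof.
move=> g_anti g_ge0; elim: d => [|d IH] le_j; first by [].
have [lt_j|] := Z_lt_le_dec (2 * j) (r + Z.of_nat d).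
  have IHd := IH ltac:(lia).
  have : 0 <= g (j - Z.of_nat d) by apply: g_ge0; lia.
  rewrite /=; lia.
move=> ge_j.
have revE : window_sum d.+1 g j = window_sum d.+1 (fun y => 0 - g y) j.
  rewrite [LHS]window_sum_rev; apply: eq_window_sum => y.
  have -> : 2 * j - Z.of_nat d.+1 + 1 - y = r - y by lia.
  rewrite g_anti; lia.
have zero : window_sum d.+1 (fun=> 0) j = 0 by elim: (d.+1) => //= e ->; lia.
move: revE; rewrite window_sumB zero; lia.
Qed.

(** The difference of the two window sums is the window sum of [f y - f (r - y)], which is
    antisymmetric about [r / 2] and nonnegative to its left. *)
Lemma left_heavy_window d f r : left_heavy f r ->
  left_heavy (window_sum d f) (r + Z.of_nat d - 1).
Proof.
move=> hf j j' le_jj' sum_jj'.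
suff : 0 <= window_sum d f j - window_sum d f j' by lia.
have -> : window_sum d f j' = window_sum d (fun y => f (r - y)) j.
  have -> : j = j' - (j' - j) by lia.
  rewrite -window_sum_shift [LHS]window_sum_rev; apply: eq_window_sum => y.
  congr f; lia.
rewrite -window_sumB.
apply: (window_sum_antisym_ge0 (r := r)) => [y|y le_y|]; last lia.
- have -> : r - (r - y) = y by lia.
  lia.
- suff : f (r - y) <= f y by lia.
  apply: hf; lia.
Qed.

Lemma left_heavy_dcompsS n d r : left_heavy (dcomps n d) r ->
  left_heavy (dcomps n.+1 d) (r + Z.of_nat d - 1).
Proof.
move=> /(@left_heavy_window d) h j j'; rewrite !dcompsS; exact: h.
Qed.

(* With this reflection centre, left-heaviness contains the inequality
   between the Hilbert functions that rules out injectivity. *)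
Definition heavy (n d : nat) (lam : Z) : Prop :=
  left_heavy (dcomps n d) ((Z.of_nat n - 1) * (Z.of_nat d - 1) - 1 - lam).

(** The reflection constant in [heavy] grows by [d - 1] with each variable, exactly as in
    [left_heavy_window], so one base case serves all larger [n]. *)
Lemma heavy_leq m n d lam : (m <= n)%N -> heavy m d lam -> heavy n d lam.
Proof.
move=> /subnKC <-; elim: (n - m)%N => [|e IH] h; first by rewrite addn0.
rewrite addnS; have := left_heavy_dcompsS (IH h).
rewrite /heavy; congr left_heavy; lia.
Qed.

(** The degrees [j - d] and [j] add up to the reflection constant; the conclusion is [e_j <= 0]. *)
Lemma heavy_dcomps_le n d lam j : heavy n d lam ->
  2 * j = Z.of_nat n * (Z.of_nat d - 1) - lam ->
  dcomps n d j <= dcomps n d (j - Z.of_nat d).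
Proof. by move=> h jE; apply: h; lia. Qed.

Lemma window_sum_unique d f g :
  (forall j, j < 0 -> f j = 0) -> (forall j, j < 0 -> g j = 0) ->
  (forall j, g j - g (j - 1) = f j - f (j - Z.of_nat d)) ->
  forall j, window_sum d f j = g j.
Proof.
move=> f0 g0 fg j.
have step i : window_sum d f i - window_sum d f (i - 1) = f i - f (i - Z.of_nat d).
  have := window_sumS d f i; rewrite /=; lia.
have neg i : i < 0 -> window_sum d f i = 0.
  move=> i0; elim: (d) => //= e ->; rewrite f0; lia.
have [j0|j0] := Z_lt_le_dec j 0; first by rewrite neg // g0.
pattern j; apply: natlike_ind => // [|i i0 IH].
  have := step 0; have := fg 0; rewrite !(neg (0 - 1)) // !(g0 (0 - 1)) //; lia.
have := step (Z.succ i); have := fg (Z.succ i).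
have -> : Z.succ i - 1 = i by lia.
lia.
Qed.

(** In terms of series: if [v = u / (1 - q)], then [u * (1 - q ^ d) / (1 - q) = (1 - q ^ d) * v]. *)
Lemma window_sum_prim d u v :
  (forall j, j < 0 -> u j = 0) -> (forall j, j < 0 -> v j = 0) ->
  (forall j, v j - v (j - 1) = u j) ->
  forall j, window_sum d u j = v j - v (j - Z.of_nat d).
Proof.
move=> u0 v0 uv; apply: (window_sum_unique (g := fun j => v j - v (j - Z.of_nat d))) => // j.
  by move=> j0; rewrite !v0 //; lia.
rewrite -!uv; have -> : j - 1 - Z.of_nat d = j - Z.of_nat d - 1 by lia.
lia.
Qed.

(** Five shifts hold the expansion of [(1 - q ^ d) ^ n] for [n <= 4]; the uniform shape lets each
    closed form feed the next. *)
Lemma window_sum_comb d u D a b c e f j :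
  window_sum d (fun y => a * u y + b * u (y - D) + c * u (y - 2 * D)
                         + e * u (y - 3 * D) + f * u (y - 4 * D)) j =
  a * window_sum d u j + b * window_sum d u (j - D)
  + c * window_sum d u (j - 2 * D) + e * window_sum d u (j - 3 * D)
  + f * window_sum d u (j - 4 * D).
Proof.
rewrite -(window_sum_shift d u j D) -(window_sum_shift d u j (2 * D)).
rewrite -(window_sum_shift d u j (3 * D)) -(window_sum_shift d u j (4 * D)).
elim: d => [|d IH]; cbn [window_sum]; nia.
Qed.

(** The coefficients of [1 / (1 - q)], [1 / (1 - q) ^ 2] and [2 / (1 - q) ^ 3], matching the series
    [(1 - q ^ d) ^ n / (1 - q) ^ (n - 1)] of [dcomps n d]. The factor 2 avoids a division. *)
Let u0 (j : Z) : Z := if j <? 0 then 0 else 1.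
Let u1 (j : Z) : Z := if j <? 0 then 0 else j + 1.
Let u2 (j : Z) : Z := if j <? 0 then 0 else (j + 1) * (j + 2).

Section ClosedForms.

Variables (d : nat) (D : Z).
Hypothesis DE : D = Z.of_nat d.

Let window_u0 i : window_sum d u0 i = u1 i - u1 (i - D).
Proof. by rewrite DE; apply: window_sum_prim => {}i; rewrite /u0 /u1; zcases; lia. Qed.

Let shiftE i : i - D - D = i - 2 * D /\ i - 2 * D - D = i - 3 * D /\ i - 3 * D - D = i - 4 * D.
Proof. lia. Qed.

Lemma dcomps2E i : dcomps 2 d i = 1 * u0 i + (-2) * u0 (i - D) + 1 * u0 (i - 2 * D)
    + 0 * u0 (i - 3 * D) + 0 * u0 (i - 4 * D).
Proof.
pose delta j := if j =? 0 then 1 else 0.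
have W0 j : window_sum d delta j = u0 j - u0 (j - D).
  by rewrite DE; apply: window_sum_prim => {}j; rewrite /delta /u0; zcases; lia.
have W j : window_sum d (fun y => delta y - delta (y - 1)) j = delta j - delta (j - D).
  by rewrite DE; apply: window_sum_prim => {}j; rewrite /delta; zcases; lia.
have E1 j : dcomps 1 d j = 1 * delta j + (-1) * delta (j - D) + 0 * delta (j - 2 * D)
    + 0 * delta (j - 3 * D) + 0 * delta (j - 4 * D).
  rewrite dcompsS (@eq_window_sum _ _ (fun y => delta y - delta (y - 1))) // W; lia.
rewrite dcompsS (eq_window_sum _ _ E1) window_sum_comb !W0.
have [-> [-> ->]] := shiftE i; lia.
Qed.

Lemma dcomps3E i : dcomps 3 d i = 1 * u1 i + (-3) * u1 (i - D) + 3 * u1 (i - 2 * D)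
    + (-1) * u1 (i - 3 * D) + 0 * u1 (i - 4 * D).
Proof.
rewrite dcompsS (eq_window_sum _ _ dcomps2E) window_sum_comb !window_u0.
have [-> [-> ->]] := shiftE i; lia.
Qed.

Lemma dcomps4E j : 2 * dcomps 4 d j =
  u2 j - 4 * u2 (j - D) + 6 * u2 (j - 2 * D) - 4 * u2 (j - 3 * D) + u2 (j - 4 * D).
Proof.
have W2 i : 2 * window_sum d u1 i = u2 i - u2 (i - D).
  have -> : 2 * window_sum d u1 i = window_sum d (fun y => 2 * u1 y) i.
    by elim: (d) => [//|e IH]; cbn [window_sum]; lia.
  by rewrite DE; apply: window_sum_prim => {}i; rewrite /u1 /u2; zcases; nia.
rewrite dcompsS (eq_window_sum _ _ dcomps3E) window_sum_comb.
have := W2 j; have := W2 (j - D); have := W2 (j - 2 * D); have := W2 (j - 3 * D).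
have [-> [-> ->]] := shiftE j; lia.
Qed.

End ClosedForms.

(** The numbers [e_j] have the series [(1 - q ^ d) ^ (n + 1) / (1 - q) ^ (n - 1)]; in low degrees
    only the first terms of the numerator contribute. *)
Lemma hilb2 d j : 0 <= j -> j < Z.of_nat d ->
  dcomps 2 d j - dcomps 2 d (j - Z.of_nat d) = 1.
Proof. by move=> j0 jd; rewrite !(dcomps2E (erefl (Z.of_nat d))) /u0; zcases; lia. Qed.

Lemma hilb3 d j : 0 <= j -> j < 2 * Z.of_nat d ->
  dcomps 3 d j - dcomps 3 d (j - Z.of_nat d) = j + 1 - 4 * Z.max 0 (j - Z.of_nat d + 1).
Proof.
move=> j0 jd; rewrite !(dcomps3E (erefl (Z.of_nat d))) /u1.
by repeat (case: Z.ltb_spec => ?; try lia).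
Qed.

(** Twice [dcomps 4 d] is piecewise quadratic, nonnegative left of the middle and nonpositive right
    of it. Only the piece on [[D, 2 D)], the parabola [q], needs a true comparison, and there the
    bound on [lam] decides. *)
Lemma heavy4 d lam : 0 <= lam -> 3 * (lam + 1) <= Z.of_nat d -> heavy 4 d lam.
Proof.
move=> lam0 lam3 j j' le_jj' sum_jj'.
have d_gt0 : (0 < d)%N by lia.
suff : 2 * dcomps 4 d j' <= 2 * dcomps 4 d j by lia.
rewrite !(dcomps4E (erefl (Z.of_nat d))).
have D_gt0 : 0 < Z.of_nat d by lia.
move: (Z.of_nat d) D_gt0 lam3 sum_jj' => {d d_gt0} D D_gt0 lam3 sum_jj'.
pose p i := (i + 1) * (i + 2); pose q i := p i - 4 * p (i - D).
have p_ge0 i : 0 <= p i by rewrite /p; case: (Z_lt_le_dec i (-1)) => ?; nia.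
have u2E i : 0 <= i -> u2 i = p i by rewrite /u2; case: Z.ltb_spec => //; lia.
have u2N i : i < 0 -> u2 i = 0 by rewrite /u2; case: Z.ltb_spec => //; lia.
have q_ge0 i : D <= i -> i <= 2 * D - 2 -> 0 <= q i.
  move=> le_i ge_i; have : 0 <= (2 * D - 1 - i) * (i + 2) by nia.
  have : 0 <= (i - D + 1) * (2 * D - 2 - i) by nia.
  rewrite /q /p; lia.
have le0 i : 2 * D <= i ->
    u2 i - 4 * u2 (i - D) + 6 * u2 (i - 2 * D) - 4 * u2 (i - 3 * D) + u2 (i - 4 * D) <= 0.
  move=> le_i; rewrite (u2E i) ?(u2E (i - D)) ?(u2E (i - 2 * D)); try lia.
  have [lt3|ge3] := Z_lt_le_dec i (3 * D).
    rewrite !u2N; try lia.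
    (* The coefficient at [i] is minus the one at [4 * D - 3 - i], so its sign follows from the left
       half. *)
    have [le1|gt1] := Z_le_gt_dec D (4 * D - 3 - i).
      have := q_ge0 (4 * D - 3 - i) ltac:(lia) ltac:(lia); rewrite /q /p; lia.
    have : 0 <= (4 * D - 3 - i + 1) * (4 * D - 3 - i + 2) by apply: p_ge0.
    have : (i - 3 * D + 1) * (i - 3 * D + 2) = 0 by nia.
    rewrite /p; lia.
  rewrite (u2E (i - 3 * D)); last lia.
  have [lt4|ge4] := Z_lt_le_dec i (4 * D).
    rewrite u2N; last lia.
    have := p_ge0 (4 * D - 3 - i); rewrite /p; lia.
  rewrite u2E; last lia.
  rewrite /p; lia.
(* This is the hypothesis [3 * (lam + 1) <= D]: the vertex [(8 * D - 9) / 6] of the concave parabola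
   [q] does not exceed the midpoint of [j] and [j']. *)
have ge_sum : 8 * D - 9 <= 3 * (j + j') by lia.
have [j0|j0] := Z_lt_le_dec j 0.
  rewrite [X in _ <= X](_ : _ = 0); first by apply: le0; lia.
  rewrite !u2N; lia.
have ge_q : q j <= u2 j - 4 * u2 (j - D) + 6 * u2 (j - 2 * D) - 4 * u2 (j - 3 * D) + u2 (j - 4 * D)
   /\ 0 <= u2 j - 4 * u2 (j - D) + 6 * u2 (j - 2 * D) - 4 * u2 (j - 3 * D) + u2 (j - 4 * D).
  rewrite (u2N (j - 2 * D)) ?(u2N (j - 3 * D)) ?(u2N (j - 4 * D)) ?(u2E j); try lia.
  have := p_ge0 j; have := p_ge0 (j - D).
  have [ltD|geD] := Z_lt_le_dec j D; first by rewrite u2N /q; lia.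
  by rewrite u2E; last lia; have := q_ge0 j geD ltac:(lia); rewrite /q; lia.
have [ge2|lt2] := Z_le_gt_dec (2 * D) j'.
  have := le0 j' ge2; lia.
have geD : D <= j' by lia.
rewrite (u2N (j' - 2 * D)) ?(u2N (j' - 3 * D)) ?(u2N (j' - 4 * D)); try lia.
rewrite (u2E j') ?(u2E (j' - D)); try lia.
suff : q j' <= q j by rewrite {1}/q; lia.
have : 0 <= (j' - j) * (3 * (j + j') - 8 * D + 9) by nia.
rewrite /q /p; lia.
Qed.

Definition row_coef (s : seq Z) (j : Z) : Z :=
  if j <? 0 then 0 else nth 0 s (Z.to_nat j).

(** Tabulation for evaluation: each row is computed once, whereas unfolding [comps] branches [d]
    times at every level. *)
Fixpoint comps_row (n d : nat) : seq Z :=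
  if n is n'.+1 then
    let s := comps_row n' d in
    mkseq (fun i => window_sum d (row_coef s) (Z.of_nat i)) (size s + d)
  else [:: 1].

Lemma comps_rowE n d j : comps n d j = row_coef (comps_row n d) j.
Proof.
elim: n j => [|n IH] j /=.
  rewrite /row_coef; case: Z.eqb_spec => [-> //|j0]; case: Z.ltb_spec => // ?.
  by case E: (Z.to_nat j) => [|[|m]] //=; lia.
rewrite (eq_window_sum _ _ IH); set s := comps_row n d.
rewrite {2}/row_coef; case: Z.ltb_spec => j0.
  elim: (d) => //= e ->; rewrite /row_coef; case: Z.ltb_spec => //; lia.
have [lt_j|ge_j] := ltnP (Z.to_nat j) (size s + d).
  by rewrite nth_mkseq // Z2Nat.id.
rewrite nth_default ?size_mkseq //.
elim: {-2}d (leqnn d) => //= e IHe le_ed; rewrite IHe; last exact: ltnW.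
rewrite /row_coef; case: Z.ltb_spec => // ?.
rewrite nth_default //; lia.
Qed.

Lemma size_comps_row n d : size (comps_row n d) = (n * d).+1.
Proof. by elim: n => //= n IH; rewrite size_mkseq IH mulSn; lia. Qed.

Definition dcomps_row (s : seq Z) (j : Z) : Z := row_coef s j - row_coef s (j - 1).

Lemma dcomps_rowE n d j : dcomps n d j = dcomps_row (comps_row n d) j.
Proof. by rewrite /dcomps /dcomps_row !comps_rowE. Qed.

(** For [j] outside [[r - N, N]] both values of [dcomps] vanish, so finitely many comparisons
    decide. *)
Definition heavyb (n d : nat) (lam : Z) : bool :=
  let s := comps_row n d in
  let r := (Z.of_nat n - 1) * (Z.of_nat d - 1) - 1 - lam in
  let N := Z.of_nat (n * d) + 1 in
  (r <=? N) &&
  all (fun i => let j := r - N + Z.of_nat i in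
                (r <? 2 * j) || (dcomps_row s (r - j) <=? dcomps_row s j))
      (iota 0 (Z.to_nat (2 * N - r + 1))).

Lemma heavybP n d lam : heavyb n d lam -> heavy n d lam.
Proof.
rewrite /heavyb; set r := _ - _ - lam; set N := (Z.of_nat _ + 1).
case/andP => /Z.leb_le rN /allP h j j' le_jj' sum_jj'.
have zero i : i < 0 \/ N < i -> dcomps n d i = 0.
  rewrite dcomps_rowE /dcomps_row /row_coef; set a := Z.to_nat _; set b := Z.to_nat _.
  case: Z.ltb_spec => ? [?|?]; case: Z.ltb_spec => ?; try lia.
  rewrite !nth_default // size_comps_row; lia.
have [ltj|gej] := Z_lt_le_dec j (r - N); first by rewrite !zero //; lia.
have [ltN|geN] := Z_lt_le_dec N j; first by rewrite !zero //; lia.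
have := h (Z.to_nat (j - (r - N))).
rewrite mem_iota Z2Nat.id; last lia.
have -> : r - N + (j - (r - N)) = j by lia.
have -> : r - j = j' by rewrite /r; lia.
rewrite -!dcomps_rowE => /(_ ltac:(lia)) /orP[/Z.ltb_lt|/Z.leb_le //].
rewrite /r; lia.
Qed.

(** Base cases with [d < 3 * (lam + 1)], beyond the reach of [heavy4]; [heavy_leq] carries them to
    larger [n]. *)
Lemma heavy_6_2 : heavy 6 2 0.
Proof. by apply: heavybP; vm_compute. Qed.

Lemma heavy_13_2 : heavy 13 2 1.
Proof. by apply: heavybP; vm_compute. Qed.

Lemma heavy_13_3 : heavy 13 3 2.
Proof. by apply: heavybP; vm_compute. Qed.

Lemma heavy_6_4 : heavy 6 4 1.
Proof. by apply: heavybP; vm_compute. Qed.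

Lemma heavy_7_5 : heavy 7 5 2.
Proof. by apply: heavybP; vm_compute. Qed.

Lemma heavy_6_7 : heavy 6 7 2.
Proof. by apply: heavybP; vm_compute. Qed.

Lemma heavy_6_10 : heavy 6 10 3.
Proof. by apply: heavybP; vm_compute. Qed.

End Counting.

(** * Monomial matrices of the truncated polynomial ring *)

Lemma mpoly_rmorph_eq (R A : comNzRingType) n (f g : {rmorphism {mpoly R[n]} -> A}) :
  (forall c, f c%:MP = g c%:MP) -> (forall i, f 'X_i = g 'X_i) -> f =1 g.
Proof.
move=> fgC fgX p; rewrite [p]mpolyE !rmorph_sum /=; apply: eq_bigr => m _.
rewrite -mul_mpolyC !rmorphM fgC mpolyXE_id !rmorph_prod /=; congr (_ * _).
by apply: eq_bigr => i _; rewrite !rmorphXn fgX.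
Qed.

Section Monomials.

Variables n d : nat.

Definition bounded (m : 'X_{1..n}) : bool := [forall i, (m i < d)%N].

Notation N := #|{ffun 'I_n -> 'I_d}|.

Definition emon (k : 'I_N) : 'X_{1..n} :=
  [multinom (enum_val k i : nat) | i < n].

Lemma emonE k i : emon k i = enum_val k i :> nat.
Proof. by rewrite mnmE. Qed.

Lemma emon_inj : injective emon.
Proof.
move=> k l /mnmP kl; apply/enum_val_inj/ffunP => i.
by apply/val_inj; rewrite /= -!emonE kl.
Qed.

Lemma emon_bounded k : bounded (emon k).
Proof. by apply/forallP => i; rewrite emonE. Qed.

Lemma emon_surj m : bounded m -> exists k, emon k = m.
Proof.
move/forallP => bm; exists (enum_rank [ffun i => Ordinal (bm i)]).
by apply/mnmP => i; rewrite emonE enum_rankK ffunE.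
Qed.

(** The factor [(bounded d m)%:R] is where the relations [x_i ^ d = 0] enter every matrix
    computation. *)
Lemma sum_emon (R : pzSemiRingType) m (G : 'X_{1..n} -> R) :
  \sum_(k < N) (emon k == m)%:R * G (emon k) = (bounded m)%:R * G m.
Proof.
have [/emon_surj[k <-]|nb] := boolP (bounded m).
  rewrite (bigD1 k) //= eqxx big1 ?addr0 // => l lk.
  by rewrite (inj_eq emon_inj) (negbTE lk) mul0r.
rewrite mul0r big1 // => k _; case: eqP => [E|_]; last by rewrite mul0r.
by rewrite -E emon_bounded in nb.
Qed.

End Monomials.

Section TruncatedAlgebra.

Variables (R : comNzRingType) (n d : nat).

Notation N := #|{ffun 'I_n -> 'I_d}|.
Notation emon := (@emon n d).

Definition linform (c : 'I_n -> R) : {mpoly R[n]} := \sum_(i < n) c i *: 'X_i.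

(** Elements of the truncated algebra are row vectors, so multiplication acts on the right and
    images are row spaces. *)
Definition mulX (c : 'I_n -> R) : 'M[R]_N :=
  \matrix_(s, t) \sum_(i < n) c i * (emon t == (emon s + U_(i))%MM)%:R.

Definition degmx (j : nat) : 'M[R]_N :=
  \matrix_(s, t) ((s == t) && (mdeg (emon s) == j))%:R.

Definition trunc (p : {mpoly R[n]}) : 'rV[R]_N := \row_t p@_(emon t).

Definition untrunc (v : 'rV[R]_N) : {mpoly R[n]} := \sum_t v 0 t *: 'X_[emon t].

Lemma trunc_is_linear : linear trunc.
Proof. by move=> a p q; apply/rowP => t; rewrite !mxE mcoeffD mcoeffZ. Qed.
HB.instance Definition _ := GRing.isLinear.Build R _ _ _ trunc trunc_is_linear.

Lemma untrunc_is_linear : linear untrunc.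
Proof.
move=> a p q; rewrite /untrunc scaler_sumr -big_split /=.
by apply: eq_bigr => t _; rewrite !mxE scalerDl scalerA.
Qed.
HB.instance Definition _ := GRing.isLinear.Build R _ _ _ untrunc untrunc_is_linear.

Lemma untruncK v : trunc (untrunc v) = v.
Proof.
apply/rowP => t; rewrite mxE /untrunc raddf_sum (bigD1 t) //= mcoeffZ mcoeffX eqxx.
rewrite mulr1 big1 ?addr0 // => s st.
by rewrite mcoeffZ mcoeffX (inj_eq (@emon_inj _ _)) (negbTE st) mulr0.
Qed.

Lemma bounded_addU (m : 'X_{1..n}) i : bounded d (m + U_(i))%MM -> bounded d m.
Proof.
by move/forallP=> h; apply/forallP => l; apply: leq_ltn_trans (h l); rewrite mnmDE leq_addr.
Qed.

Lemma trunc_linform_mul c p : trunc (linform c * p) = trunc p *m mulX c.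
Proof.
rewrite [p]mpolyE mulr_sumr !linear_sum /= mulmx_suml; apply: eq_bigr => m _.
rewrite -scalerAr !linearZ -scalemxAl /=; congr (_ *: _).
apply/rowP => t; rewrite !mxE.
under eq_bigr => s _ do rewrite !mxE mcoeffX eq_sym.
rewrite (sum_emon _ m (fun m' => \sum_(i < n) c i * (emon t == (m' + U_(i))%MM)%:R)).
rewrite /linform mulr_suml raddf_sum /= mulr_sumr; apply: eq_bigr => i _.
rewrite -scalerAl mcoeffZ -mpolyXD mcoeffX addmC eq_sym mulrCA.
case: eqP => [E|_]; last by rewrite !mulr0.
by rewrite (@bounded_addU m i) ?mul1r // -E emon_bounded.
Qed.

Lemma degmx_diag j : degmx j = diag_mx (\row_s (mdeg (emon s) == j)%:R).
Proof. by apply/matrixP => s t; rewrite !mxE -mulrnA mulnb andbC. Qed.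

Lemma degmxE (v : 'rV[R]_N) j t : (v *m degmx j) 0 t = v 0 t * (mdeg (emon t) == j)%:R.
Proof. by rewrite degmx_diag mul_mx_diag !mxE. Qed.

Lemma degmx_idem j : degmx j *m degmx j = degmx j.
Proof.
rewrite !degmx_diag mulmx_diag; congr diag_mx; apply/rowP => s; rewrite !mxE.
by case: eqP; rewrite ?mulr0 ?mulr1.
Qed.

Lemma mulX_degmx c j : mulX c *m degmx j.+1 = degmx j *m mulX c.
Proof.
rewrite !degmx_diag mul_mx_diag mul_diag_mx; apply/matrixP => s t; rewrite !mxE.
rewrite mulr_suml mulr_sumr; apply: eq_bigr => i _.
case: (emon t =P _) => [->|_]; last by rewrite !(mulr0, mul0r).
by rewrite mdegD mdeg1 addn1 eqSS mulrC.
Qed.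

Lemma mulX_degmx0 c : mulX c *m degmx 0 = 0.
Proof.
rewrite degmx_diag mul_mx_diag; apply/matrixP => s t; rewrite !mxE mulr_suml big1 // => i _.
case: (emon t =P _) => [->|_]; last by rewrite !(mulr0, mul0r).
by rewrite mdegD mdeg1 addn1 mulr0.
Qed.

Lemma mulX_comm c c' : mulX c *m mulX c' = mulX c' *m mulX c.
Proof.
apply/row_matrixP => k; rewrite !rowE !mulmxA -[delta_mx _ _]untruncK.
by rewrite -!trunc_linform_mul mulrCA.
Qed.

Definition mulL : 'M[R]_N := mulX (fun=> 1) ^+ d.

Lemma trunc_linform_exp_mul c e p : trunc (linform c ^+ e * p) = trunc p *m mulX c ^+ e.
Proof.
elim: e p => [|e IH] p; first by rewrite !expr0 mul1r mulmx1.
by rewrite exprS -mulrA trunc_linform_mul IH exprSr -mulmxA.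
Qed.

Lemma mulL_comm c : mulL *m mulX c = mulX c *m mulL.
Proof.
suff H e : mulX (fun=> 1) ^+ e *m mulX c = mulX c *m mulX (fun=> 1) ^+ e by exact: H.
elim: e => [|e IH]; first by rewrite expr0 mul1mx mulmx1.
by rewrite exprS -[_ * _]/(_ *m _) -mulmxA IH !mulmxA mulX_comm.
Qed.

Lemma mulXexp_degmx c e j :
  mulX c ^+ e *m degmx j = if (e <= j)%N then degmx (j - e) *m mulX c ^+ e else 0.
Proof.
elim: e j => [|e IH] j; first by rewrite expr0 mul1mx subn0 mulmx1.
rewrite exprSr -[_ * _]/(_ *m _) -mulmxA; case: j => [|j]; first by rewrite mulX_degmx0 mulmx0.
rewrite mulX_degmx mulmxA IH ltnS subSS; case: ifP => _; last by rewrite mul0mx.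
by rewrite -mulmxA.
Qed.

Lemma mulL_degmx j : mulL *m degmx j = if (d <= j)%N then degmx (j - d) *m mulL else 0.
Proof. exact: mulXexp_degmx. Qed.

Lemma trunc_homog j p : p \is j.-homog -> trunc p *m degmx j = trunc p.
Proof.
move=> hp; apply/rowP => t; rewrite degmxE !mxE.
case: eqP => [_|/eqP ne]; first by rewrite mulr1.
by rewrite (dhomog_nemf_coeff hp ne) mul0r.
Qed.

Lemma untrunc_homog j (v : 'rV[R]_N) : v *m degmx j = v -> untrunc v \is j.-homog.
Proof.
move=> vj; rewrite /untrunc rpred_sum // => t _.
have := congr1 (fun u : 'rV_N => u 0 t) vj; rewrite /= degmxE.
case: eqP => [<- _|_]; last by rewrite mulr0 => <-; rewrite scale0r rpred0.
by rewrite rpredZ // dhomogX.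
Qed.

End TruncatedAlgebra.

Section NormalIdeal.

Variables (k : fieldType) (n d : nat).

Notation N := #|{ffun 'I_n -> 'I_d}|.
Notation emon := (@emon n d).

Definition nideal (p : {mpoly k[n]}) : Prop :=
  exists (q : 'I_n -> {mpoly k[n]}) (q' : {mpoly k[n]}),
    p = \sum_(i < n) q i * 'X_i ^+ d + q' * linform (fun=> 1) ^+ d.

Lemma trunc_mulXn q i : trunc d (q * 'X_i ^+ d : {mpoly k[n]}) = 0.
Proof.
rewrite [q]mpolyE mulr_suml linear_sum big1 // => m _.
apply/rowP => t; rewrite !mxE -scalerAl mcoeffZ mpolyXn -mpolyXD mcoeffX.
case: eqP => [E|_]; last by rewrite mulr0.
have := emon_bounded t; rewrite -E => /forallP/(_ i).
by rewrite mnmDE mulmnE mnm1E eqxx mul1n ltnNge leq_addl.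
Qed.

Lemma trunc_eq0 p : trunc d p = 0 ->
  exists q : 'I_n -> {mpoly k[n]}, p = \sum_(i < n) q i * 'X_i ^+ d.
Proof.
move=> p0; rewrite [p]mpolyE big_seq.
pose J p := exists q : 'I_n -> {mpoly k[n]}, p = \sum_(i < n) q i * 'X_i ^+ d.
apply: (big_ind J) => [|_ _ [q ->] [q' ->]|m m_p].
- by exists (fun=> 0); rewrite big1 // => i _; rewrite mul0r.
- exists (fun i => q i + q' i); rewrite -big_split /=.
  by apply: eq_bigr => i _; rewrite mulrDl.
- have [/emon_surj[t tm]|] := boolP (bounded d m).
    move/rowP/(_ t): p0; rewrite !mxE tm => p0.
    by move: m_p; rewrite mcoeff_msupp p0 eqxx.
  rewrite negb_forall => /existsP[i]; rewrite -leqNgt => le_d.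
  exists (fun l => if l == i then p@_m *: 'X_[m - U_(i) *+ d] else 0).
  rewrite (bigD1 i) //= eqxx big1 ?addr0 => [|l /negbTE ->]; last by rewrite mul0r.
  rewrite -scalerAl mpolyXn -mpolyXD submK //; apply/mnm_lepP => l.
  by rewrite mulmnE mnm1E; case: eqP => [<-|]; rewrite ?mul1n.
Qed.

(** The kernel of [trunc] is the ideal of the [X_i ^ d], and [trunc] turns multiplication by the
    remaining generator into [mulL]. *)
Lemma nidealP p : nideal p <-> (trunc d p <= mulL k n d)%MS.
Proof.
split=> [[q [q' ->]]|/submxP[v pv]].
  rewrite linearD linear_sum big1 => [|i _]; last exact: trunc_mulXn.
  by rewrite add0r [q' * _]mulrC /= trunc_linform_exp_mul submxMl.
have [|q pE] := @trunc_eq0 (p - linform (fun=> 1) ^+ d * untrunc v).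
  by rewrite linearB /= trunc_linform_exp_mul untruncK pv subrr.
by exists q, (untrunc v); rewrite -pE [untrunc v * _]mulrC subrK.
Qed.

End NormalIdeal.

(** * Injectivity below the middle degree by sl_2-theory *)

Section Lefschetz.

Variables (k : fieldType) (n d : nat).
Hypothesis char_k : [pchar k] =i pred0.

Notation N := #|{ffun 'I_n -> 'I_d}|.
Notation emon := (@emon n d).

(* [mulX d (fun=> 1)], [lowering] and the degree form an sl_2-triple on the
   monomial basis of [k[x_1, .., x_n] / (x_1^d, .., x_n^d)]. *)
Definition lowering : 'M[k]_N :=
  \matrix_(t, s) \sum_(i < n)
     (emon t i * (d - emon t i))%:R * (emon t == (emon s + U_(i))%MM)%:R.

Lemma natr_char0_eq0 m : (m%:R == 0 :> k) = (m == 0)%N.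
Proof. by move/pcharf0P: char_k. Qed.

Lemma lowering_degmx j : degmx k n d j.+1 *m lowering = lowering *m degmx k n d j.
Proof.
rewrite !degmx_diag mul_mx_diag mul_diag_mx; apply/matrixP => s t; rewrite !mxE.
rewrite mulr_suml mulr_sumr; apply: eq_bigr => i _.
case: (emon s =P _) => [->|_]; last by rewrite !(mulr0, mul0r).
by rewrite mdegD mdeg1 addn1 eqSS mulrC.
Qed.

Lemma lowering_degmx0 : degmx k n d 0 *m lowering = 0.
Proof.
rewrite degmx_diag mul_diag_mx; apply/matrixP => s t; rewrite !mxE mulr_sumr big1 // => i _.
case: (emon s =P _) => [->|_]; last by rewrite !(mulr0, mul0r).
by rewrite mdegD mdeg1 addn1 mul0r.
Qed.

(** Raising one variable commutes with lowering another one. For the same variable with exponent [a]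
    the weights give [(a + 1) * (d - a - 1) - a * (d - a) = d - 1 - 2 * a]. *)
Lemma commutator_lowering :
  mulX d (fun=> 1) *m lowering - lowering *m mulX d (fun=> 1) =
  diag_mx (\row_s ((n * d.-1)%:R - (mdeg (emon s)).*2%:R)).
Proof.
pose w (m : 'X_{1..n}) i : k := (m i * (d - m i))%:R.
apply/matrixP => s t; rewrite !mxE.
have -> : \sum_r (mulX d (fun=> 1) : 'M[k]_N) s r * lowering r t =
    \sum_(i < n) \sum_(l < n)
      (bounded d (emon s + U_(i))%MM)%:R *
      (w (emon s + U_(i))%MM l * ((emon s + U_(i))%MM == (emon t + U_(l))%MM)%:R).
  under eq_bigr => r _ do rewrite !mxE mulr_suml.
  rewrite exchange_big; apply: eq_bigr => i _ /=.
  under eq_bigr => r _ do rewrite mul1r.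
  rewrite (sum_emon _ _ (fun m => \sum_(l < n) w m l * (m == (emon t + U_(l))%MM)%:R)).
  by rewrite mulr_sumr.
have -> : \sum_r lowering s r * mulX d (fun=> 1) r t =
    \sum_(i < n) \sum_(l < n) w (emon s) l *
     (\sum_r (emon s == (emon r + U_(l))%MM)%:R * (emon t == (emon r + U_(i))%MM)%:R).
  transitivity (\sum_r \sum_(l < n) \sum_(i < n) w (emon s) l *
     ((emon s == (emon r + U_(l))%MM)%:R * (emon t == (emon r + U_(i))%MM)%:R)).
    apply: eq_bigr => r _; rewrite !mxE mulr_suml; apply: eq_bigr => l _.
    by rewrite mulr_sumr; apply: eq_bigr => i _; rewrite mul1r -mulrA.
  rewrite exchange_big [RHS]exchange_big; apply: eq_bigr => l _ /=.
  by rewrite exchange_big; apply: eq_bigr => i _; rewrite mulr_sumr.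
have inner i l : \sum_r (emon s == (emon r + U_(l))%MM)%:R * (emon t == (emon r + U_(i))%MM)%:R
    = ((0 < emon s l)%N && (emon t == (emon s - U_(l) + U_(i))%MM))%:R :> k.
  case: ltnP => [sl|]; last first.
    rewrite leqn0 => /eqP sl; rewrite big1 // => r _; case: eqP => [E|_]; last by rewrite mul0r.
    by move: sl; rewrite E mnmDE mnm1E eqxx addn1.
  have le_l : (U_(l) <= emon s)%MM by rewrite lep1mP -lt0n.
  transitivity (\sum_r (emon r == (emon s - U_(l))%MM)%:R * (emon t == (emon r + U_(i))%MM)%:R : k).
    apply: eq_bigr => r _; congr ((nat_of_bool _)%:R * _); apply/eqP/eqP => [->|->]; first by rewrite addmK.
    by rewrite submK.
  rewrite (sum_emon _ _ (fun m => (emon t == (m + U_(i))%MM)%:R)) (_ : bounded _ _) ?mul1r //.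
  by apply: (@bounded_addU _ _ _ l); rewrite submK ?emon_bounded.
rewrite -sumrB.
transitivity (\sum_(i < n) ((d.-1%:R - (emon s i).*2%:R) *+ (s == t)) : k); last first.
  rewrite sumrMnl sumrB sumr_const card_ord -mulrnA mdegE mulnC; congr ((_ - _) *+ _).
  by rewrite -muln2 big_distrl natr_sum /=; apply: eq_bigr => i _; rewrite -muln2.
apply: eq_bigr => i _; rewrite -sumrB (bigD1 i) //= [X in _ + X]big1 ?addr0 => [|l li]; last first.
  rewrite inner {1}/w mnmDE mnm1E eq_sym (negbTE li) addn0 -/(w (emon s) l).
  case: (posnP (emon s l)) => [sl|sl]; first by rewrite /w sl mul0n !(mul0r, mulr0) subrr.
  have le_l : (U_(l) <= emon s)%MM by rewrite lep1mP -lt0n.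
  rewrite andTb; case: (emon t =P _) => [tE|ne].
    have E : (emon s + U_(i))%MM = (emon t + U_(l))%MM.
      by rewrite tE -addmA [(U_(i) + _)%MM]addmC addmA submK.
    rewrite E eqxx (_ : bounded _ _) ?mul1r ?subrr //.
    apply/forallP => x; have /forallP/(_ x) := emon_bounded s; have /forallP/(_ x) := emon_bounded t.
    move/mnmP/(_ x): E; rewrite !mnmDE !mnm1E; case: (l =P x) => [<-|_] E; last by rewrite addn0.
    by move: E; rewrite eq_sym (negbTE li); lia.
  case: eqP => [E|_]; last by rewrite !mulr0 subrr.
  case: ne; apply: (@addIm _ U_(l)%MM); rewrite -E -addmA [(U_(i) + _)%MM]addmC addmA submK //.
rewrite inner (inj_eq (@addIm _ _)) (inj_eq (@emon_inj _ _)).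
have -> : ((0 < emon s i)%N && (emon t == (emon s - U_(i) + U_(i))%MM)) = ((0 < emon s i)%N && (s == t)).
  case: (posnP (emon s i)) => // si; rewrite submK ?lep1mP -?lt0n // eq_sym.
  by rewrite (inj_eq (@emon_inj _ _)).
have := emon_bounded s => /forallP/(_ i) si.
case: (s =P t) => _; last by rewrite andbF !mulr0 subrr.
rewrite andbT mulr1 mulr1n /w mnmDE mnm1E eqxx addn1.
(* If raising leaves the box, then [a + 1 = d] and the weight vanishes as well. *)
have -> : (bounded d (emon s + U_(i))%MM)%:R * ((emon s i).+1 * (d - (emon s i).+1))%:R =
    ((emon s i).+1 * (d - (emon s i).+1))%:R :> k.
  have [|nb] := boolP (bounded _ _); first by rewrite mul1r.
  have [lt|ge] := ltnP (emon s i).+1 d; last first.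
    by rewrite (_ : d - _ = 0)%N ?muln0 ?mulr0 //; apply/eqP; rewrite subn_eq0.
  case/negP: nb; apply/forallP => x; rewrite mnmDE mnm1E; case: eqP => [<-|_]; first by rewrite addn1.
  by rewrite addn0; have /forallP := emon_bounded s; apply.
have -> : (emon s i * (d - emon s i))%:R * (0 < emon s i)%N%:R = (emon s i * (d - emon s i))%:R :> k.
  by case: (posnP (emon s i)) => [->|_]; rewrite ?mul0n ?mul0r ?mulr1.
apply/eqP; rewrite subr_eq addrAC eq_sym subr_eq -!natrD; apply/eqP; congr (_%:R).
move: (emon s i) si => a; case: (d) => // e; rewrite ltnS => si; rewrite subSS subSn //=; nia.
Qed.

Lemma lowering_nilp (v : 'rV[k]_N) i : v *m degmx k n d i = v -> v *m lowering ^+ i.+1 = 0.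
Proof.
elim: i v => [|i IH] v vi.
  by rewrite expr1 -vi -mulmxA lowering_degmx0 mulmx0.
rewrite exprS -[_ * _]/(_ *m _) mulmxA; apply: IH.
by rewrite -mulmxA -lowering_degmx mulmxA vi.
Qed.

(** If raising kills [v], then raising [v *m lowering ^+ r.+1] gives [-(r + 1) * (h + r)] times
    [v *m lowering ^+ r], where [h = n (d - 1) - 2 i] is positive. Since a high power of [lowering]
    kills [v], descending along this chain yields [v = 0]. *)
Lemma mulX1_inj i (v : 'rV[k]_N) : (i.*2 < n * d.-1)%N ->
  v *m degmx k n d i = v -> v *m mulX d (fun=> 1) = 0 -> v = 0.
Proof.
move=> lt_i vi vX.
have comm j (u : 'rV_N) : u *m degmx k n d j = u ->
    u *m lowering *m mulX d (fun=> 1) =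
    u *m mulX d (fun=> 1) *m lowering - ((n * d.-1)%:R - j.*2%:R) *: u.
  move=> uj; have <- : u *m (mulX d (fun=> 1) *m lowering - lowering *m mulX d (fun=> 1)) =
      ((n * d.-1)%:R - j.*2%:R) *: u.
    rewrite commutator_lowering mul_mx_diag; apply/rowP => t; rewrite !mxE.
    have := degmxE u j t; rewrite uj; case: eqP => [<- _|_ ->]; first by rewrite mulrC.
    by rewrite !mulr0 mul0r.
  by rewrite mulmxBr !mulmxA opprB addrCA subrr addr0.
pose h := (n * d.-1 - i.*2)%N.
have step r : (r <= i)%N ->
    v *m lowering ^+ r.+1 *m mulX d (fun=> 1) = - (r.+1 * (h + r))%:R *: (v *m lowering ^+ r).
  elim: r => [|r IH] le_r.
    rewrite expr1 (comm i) // vX mul0mx sub0r expr0 mulmx1 -scaleNr; congr (- _ *: _).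
    by rewrite mul1n addn0 /h natrB // ltnW.
  have deg e : (e <= i)%N -> v *m lowering ^+ e *m degmx k n d (i - e) = v *m lowering ^+ e.
    elim: e => [|e IHe] le_e; first by rewrite subn0 expr0 mulmx1.
    rewrite exprSr -[_ * _]/(_ *m _) mulmxA -[in LHS]mulmxA -lowering_degmx mulmxA.
    by rewrite -subSn ?subSS ?IHe // ltnW.
  rewrite exprSr -[_ * _]/(_ *m _) mulmxA (comm (i - r.+1)%N); last exact: deg.
  rewrite IH; last exact: ltnW.
  rewrite -scalemxAl -mulmxA -[lowering ^+ r *m _]/(_ * _) -exprSr -scalerBl; congr (_ *: _).
  have E : ((n * d.-1) = h + i.*2)%N by rewrite subnK // ltnW.
  have E2 : i = (i - r.+1 + r.+1)%N by rewrite subnK.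
  rewrite E -!mul2n {1}E2; move: (i - r.+1)%N => q; ring.
have zero r : (r <= i.+1)%N -> v *m lowering ^+ (i.+1 - r) = 0.
  elim: r => [|r IH] le_r; first by rewrite subn0 lowering_nilp.
  have := IH (ltnW le_r); rewrite subSS subSn // => E.
  have := step (i - r)%N (leq_subr _ _); rewrite E mul0mx => /esym/eqP.
  rewrite scalemx_eq0 oppr_eq0 natr_char0_eq0 muln_eq0 /= addn_eq0 => /orP[/andP[]|/eqP //].
  by rewrite /h subn_eq0 leqNgt lt_i.
by have := zero i.+1 (leqnn _); rewrite subnn expr0 mulmx1.
Qed.

End Lefschetz.

Lemma natrZE m : m%:R = Z.of_nat m :> Z.
Proof. by elim: m => // m IH; rewrite -natr1 IH Nat2Z.inj_succ. Qed.

Lemma comps_neg n d j : Z.lt j Z0 -> comps n d j = Z0.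
Proof. by move=> j0; rewrite comps_rowE /row_coef; case: Z.ltb_spec => //; lia. Qed.

Lemma comps0 n d : (0 < d)%N -> comps n d Z0 = 1.
Proof.
case: d => // e _; elim: n => // n IH.
rewrite -[LHS]/(window_sum e.+1 (comps n e.+1) Z0) window_sumS IH.
suff H m : window_sum m (comps n e.+1) (Z.sub Z0 1) = Z0 by rewrite H.
by elim: m => // m IHm; cbn [window_sum]; rewrite IHm comps_neg //; lia.
Qed.

Lemma hilb0 n d : (0 < d)%N -> Z.sub (dcomps n d Z0) (dcomps n d (Z.sub Z0 (Z.of_nat d))) = 1.
Proof.
move=> d_gt0; rewrite /dcomps comps0 // !(@comps_neg _ _ (Z.sub _ 1)); try lia.
by rewrite comps_neg //; lia.
Qed.

Lemma comps_coef n d j :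
  comps n d (Z.of_nat j) = ((\sum_(i < d) 'X^i) ^+ n : {poly Z})`_j.
Proof.
elim: n j => [|n IH] j.
  by rewrite expr0 coef1 /=; case: j.
rewrite exprS mulr_suml coef_sum /=.
have neg y : Z.lt y Z0 -> comps n d y = Z0 by exact: comps_neg.
move: (comps n d) neg IH => f neg; move: (_ ^+ n) => Q IH.
elim: d => [|e IHe]; first by rewrite big_ord0.
rewrite big_ord_recr /= -IHe coefXnM; congr (Z.add _ _); case: ltnP => [lt|le].
  by rewrite neg //; lia.
by rewrite -IH Nat2Z.inj_sub //; lia.
Qed.

(** * Ranks, kernels and cokernels of the multiplication maps *)

Section Ranks.

Variables (k : fieldType) (n d : nat).

Notation N := #|{ffun 'I_n -> 'I_d}|.
Notation emon := (@emon n d).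
Notation Pi := (degmx k n d).

Lemma rank_degmx_card j : \rank (Pi j) = #|[set s : 'I_N | mdeg (emon s) == j]|.
Proof.
set S := [set s | _]; pose P : 'M[k]_(#|S|, N) := rowsub (fun a => enum_val a) 1%:M.
have PS : P *m Pi j = P.
  rewrite mul_rowsub_mx mul1mx; apply/matrixP => a t; rewrite !mxE.
  by have := enum_valP a; rewrite inE => ->; rewrite andbT.
have PP : P *m P^T = 1%:M.
  apply/matrixP => a b; rewrite !mxE (bigD1 (enum_val a)) //= !mxE eqxx mul1r.
  rewrite big1 ?addr0 => [|t /negbTE ta]; last by rewrite !mxE eq_sym ta mul0r.
  by rewrite (inj_eq enum_val_inj) eq_sym.
have PtP : P^T *m P = Pi j.
  apply/matrixP => s t; rewrite !mxE.
  under eq_bigr => a _ do rewrite !mxE.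
  rewrite -(big_enum_val (A := mem S) (fun x => (x == s)%:R * (x == t)%:R)) /=.
  have [sS|sS] := boolP (s \in S); last first.
    rewrite big1 => [|x xS]; last by case: eqP xS sS => [-> ->|_] //; rewrite mul0r.
    by move: sS; rewrite inE => /negbTE ->; rewrite andbF.
  rewrite (bigD1 s) //= eqxx mul1r big1 ?addr0 => [|x /andP[_ /negbTE ->]]; last by rewrite mul0r.
  by move: sS; rewrite inE => ->; rewrite andbT.
apply/eqP; rewrite eqn_leq -{1}PtP; apply/andP; split.
  by apply: leq_trans (mxrankM_maxl _ _) _; apply: rank_leq_col.
have : row_free P by apply/row_freeP; exists P^T.
by rewrite /row_free => /eqP {1}<-; rewrite -PS; apply: mxrankM_maxr.
Qed.

Lemma rank_degmx j : Z.of_nat (\rank (Pi j)) = comps n d (Z.of_nat j).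
Proof.
rewrite comps_coef rank_degmx_card -natrZE -sum1_card natr_sum.
transitivity (\sum_(s < N) ((mdeg (emon s) == j)%:R : Z)).
  by rewrite big_mkcond /=; apply: eq_bigr => s _; rewrite inE; case: eqP.
have -> : (\sum_(i < d) 'X^i) ^+ n = \prod_(l < n) \sum_(i < d) 'X^i :> {poly Z}.
  by rewrite prodr_const card_ord.
rewrite bigA_distr_bigA coef_sum /=.
rewrite (reindex (fun s : 'I_N => enum_val s)) /=; last exact/onW_bij/enum_val_bij.
apply: eq_bigr => s _; rewrite prodrXr coefXn eq_sym mdegE; congr ((nat_of_bool (_ == _))%:R).
by apply: eq_bigr => i _; rewrite emonE.
Qed.

End Ranks.

Section Maximal.

Variables (k : fieldType) (n d : nat) (c : 'I_n -> k).

Notation N := #|{ffun 'I_n -> 'I_d}|.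
Notation emon := (@emon n d).
Notation Pi := (degmx k n d).
Notation Lmx j := (mulL k n d *m Pi j).

Definition inj_at i : Prop := forall v : 'rV[k]_N, v *m Pi i = v ->
  (v *m mulX d c <= mulL k n d)%MS -> (v <= mulL k n d)%MS.

Definition sur_at i : Prop := forall w : 'rV[k]_N, w *m Pi i.+1 = w ->
  exists2 v : 'rV[k]_N, v *m Pi i = v & (w - v *m mulX d c <= mulL k n d)%MS.

Definition image_mx j : 'M[k]_N := (mulX d c *m Pi j + Lmx j)%MS.

Definition coker j : nat := \rank (Pi j) - \rank (image_mx j).

(** The preimage of [Lmx i.+1] in degree [i]: it always contains [Lmx i], and equality means
    injectivity on the quotient. *)
Definition ker_mx i : 'M[k]_N := (Pi i :&: kermx (mulX d c *m cokermx (Lmx i.+1)))%MS.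

(** Rank-nullity for [C] on [A] followed by the projection modulo [B], which [cokermx B]
    represents. *)
Lemma rank_adds_mul (A C B : 'M[k]_N) :
  (\rank (A *m C + B)%MS + \rank (A :&: kermx (C *m cokermx B))%MS = \rank A + \rank B)%N.
Proof.
have kcE : (kermx (cokermx B) == B)%MS.
  apply/andP; split; first by rewrite submxE mulmx_ker.
  by apply/sub_kermxP; rewrite mulmx_coker.
have E1 := mxrank_mul_ker (A *m C + B)%MS (cokermx B).
have E2 := mxrank_mul_ker A (C *m cokermx B).
have E3 : (\rank ((A *m C + B)%MS *m cokermx B) = \rank (A *m (C *m cokermx B)))%N.
  rewrite mulmxA; apply/eqmx_rank/eqmxP.
  by apply: eqmx_trans (addsmxMr _ _ _) _; rewrite mulmx_coker; apply: addsmx0.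
have E4 : (\rank ((A *m C + B) :&: kermx (cokermx B))%MS = \rank B)%N.
  apply/eqmx_rank/eqmxP; apply: eqmx_trans (cap_eqmx (eqmx_refl _) (eqmxP kcE)) _.
  by apply/capmx_idPr; apply: addsmxSr.
lia.
Qed.

Lemma sub_degmxP i (v : 'rV[k]_N) : reflect (v *m Pi i = v) (v <= Pi i)%MS.
Proof.
apply: (iffP idP) => [/submxP[u ->]|<-]; last exact: submxMl.
by rewrite -mulmxA degmx_idem.
Qed.

Lemma sub_mulL_deg i (w : 'rV[k]_N) : w *m Pi i = w ->
  (w <= Lmx i)%MS = (w <= mulL k n d)%MS.
Proof.
move=> wi; apply/idP/idP => [|/submxP[u wE]].
  rewrite mulL_degmx; case: ifP => _ /submx_trans; apply; [exact: submxMl|exact: sub0mx].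
by rewrite -wi wE -mulmxA submxMl.
Qed.

Lemma rank_image_mx i :
  (\rank (image_mx i.+1) + \rank (ker_mx i) = \rank (Pi i) + \rank (Lmx i.+1))%N.
Proof. by rewrite /image_mx mulX_degmx rank_adds_mul. Qed.

Lemma rank_image_mx0 : \rank (image_mx 0) = \rank (Lmx 0).
Proof. by rewrite /image_mx mulX_degmx0; apply/eqmx_rank/eqmxP; apply: adds0mx. Qed.

Lemma sub_mulX i : (Lmx i *m mulX d c <= Lmx i.+1)%MS.
Proof. by rewrite -mulmxA -mulX_degmx mulmxA mulL_comm -mulmxA submxMl. Qed.

Lemma Lmx_degmx i : (Lmx i <= Pi i)%MS.
Proof. exact: submxMl. Qed.

Lemma image_mx_degmx i : (image_mx i <= Pi i)%MS.
Proof. by rewrite addsmx_sub !submxMl. Qed.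

Lemma Lmx_ker i : (Lmx i <= ker_mx i)%MS.
Proof.
rewrite sub_capmx Lmx_degmx; apply/sub_kermxP.
by rewrite mulmxA; apply/eqP; rewrite -submxE sub_mulX.
Qed.

Lemma inj_atP i : inj_at i <-> (\rank (ker_mx i) <= \rank (Lmx i))%N.
Proof.
rewrite (geq_leqif (mxrank_leqif_sup (Lmx_ker i))); split=> [inj|/row_subP sub v vi vc].
  apply/row_subP => s; set v := row s _.
  have : (v <= ker_mx i)%MS by apply: row_sub.
  rewrite sub_capmx => /andP[/sub_degmxP vi /sub_kermxP].
  rewrite mulmxA => /eqP; rewrite -submxE => vc.
  rewrite sub_mulL_deg //; apply: inj => //.
  by rewrite -(@sub_mulL_deg i.+1) // -mulmxA mulX_degmx mulmxA vi.
rewrite -(@sub_mulL_deg i) //; apply: submx_trans (_ : (ker_mx i <= _)%MS); last exact/row_subP.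
rewrite sub_capmx; apply/andP; split; first exact/sub_degmxP.
apply/sub_kermxP; rewrite mulmxA; apply/eqP; rewrite -submxE sub_mulL_deg //.
by rewrite -mulmxA mulX_degmx mulmxA vi.
Qed.

Lemma sur_atP i : sur_at i <-> (Pi i.+1 <= image_mx i.+1)%MS.
Proof.
rewrite /image_mx mulX_degmx; split=> [sur|sub w wi].
  apply/row_subP => s; set w := row s _.
  have wi : w *m Pi i.+1 = w by apply/sub_degmxP; apply: row_sub.
  have [v vi vw] := sur w wi.
  rewrite -(subrK (v *m mulX d c) w) addmx_sub //; last first.
    by rewrite -vi -mulmxA; apply: submx_trans (addsmxSl _ _); apply: submxMl.
  apply: submx_trans (addsmxSr _ _); rewrite sub_mulL_deg // mulmxBl wi.
  by rewrite -[v *m _ *m _]mulmxA mulX_degmx mulmxA vi.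
have : (w <= Pi i *m mulX d c + Lmx i.+1)%MS by apply: submx_trans sub; apply/sub_degmxP.
case/sub_addsmxP => [[u1 u2]] /= wE; exists (u1 *m Pi i); first by rewrite -mulmxA degmx_idem.
rewrite wE !mulmxA addrAC subrr add0r.
by rewrite -mulmxA mulL_degmx; case: ifP => _; rewrite ?mulmxA ?submxMl // mulmx0 sub0mx.
Qed.

End Maximal.

(** A nonzero maximal minor of the specialised matrix is the image of a minor over [R], which is
    then nonzero too. *)
Lemma mxrank_specialize (R : idomainType) (k : fieldType) (f : {rmorphism R -> k})
    m n (A : 'M[R]_(m, n)) :
  (\rank (map_mx f A) <= \rank (map_mx (@tofrac R) A))%N.
Proof.
set B := map_mx f A; set C := map_mx _ A.
have rf := maxrowsub_free B; set g := maxrankfun B in rf.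
have rfT : row_full (rowsub g B)^T by rewrite /row_full mxrank_tr; exact: rf.
pose h := fullrankfun rfT.
have := fullrowsub_unit rfT; rewrite -/h => u.
have sub : rowsub h (rowsub g B)^T = (mxsub g h B)^T by apply/matrixP => i j; rewrite !mxE.
have dB : \det (mxsub g h B) != 0.
  by move: u; rewrite sub unitmx_tr unitmxE unitfE.
have dC : \det (mxsub g h C) != 0.
  rewrite /C -map_mxsub det_map_mx tofrac_eq0; apply: contra dB => /eqP d0.
  by rewrite /B -map_mxsub det_map_mx d0 rmorph0.
have : row_free (mxsub g h C) by rewrite row_free_unit unitmxE unitfE.
rewrite /row_free => /eqP {1}<-.
have -> : mxsub g h C = rowsub g C *m colsub h 1%:M.
  by apply/matrixP => i j; rewrite -[in LHS](mulmx1 C) -mxsub_mul !mxE.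
apply: leq_trans (mxrankM_maxl _ _) _; apply: mxrankS; exact: rowsub_sub.
Qed.

Section Coker.

Variables (k : fieldType) (n d : nat).

Notation N := #|{ffun 'I_n -> 'I_d}|.
Notation Pi := (degmx k n d).
Notation Lmx j := (mulL k n d *m Pi j).

Lemma rank_compl_degmx j : \rank (1%:M - Pi j) = (N - \rank (Pi j))%N.
Proof.
have le1 : (\rank (1%:M - Pi j)%R + \rank (Pi j) <= N)%N.
  by apply: mulmx0_rank_max; rewrite mulmxBl mul1mx degmx_idem subrr.
have le2 : (N <= \rank (1%:M - Pi j)%R + \rank (Pi j))%N.
  rewrite -{1}(mxrank1 k N) -{1}(subrK (Pi j) 1%:M).
  by apply: leq_trans (mxrank_add _ _).
lia.
Qed.

Lemma rank_degmx_le j : (\rank (Pi j) <= N)%N.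
Proof. exact: rank_leq_row. Qed.

(** By duality: the columns [F] are the functionals on the degree [j] cokernel, and the coordinates
    in [S] determine them. *)
Lemma coker_le (c : 'I_n -> k) j (S : seq 'I_N) :
  (forall F : 'cV[k]_N, mulX d c *m F = 0 -> mulL k n d *m F = 0 -> Pi j *m F = F ->
     (forall s : 'I_N, s \in S -> F s 0 = 0) -> F = 0) ->
  (coker d c j <= size S)%N.
Proof.
move=> inj; set M := image_mx d c j.
pose D : 'M[k]_(size S, N) := \matrix_(a, t) ((tnth (in_tuple S) a == t)%:R : k).
(* The hypothesis says that the image, the other degrees and the coordinates in [S] have no common
   nonzero annihilator, hence span everything. *)
pose M' := (M + (1%:M - Pi j)%R + D)%MS.
have kill m (A : 'M[k]_(m, N)) F : (A <= M')%MS -> M' *m F = 0 -> A *m F = 0 :> 'cV_m.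
  by case/submxP=> u -> M0; rewrite -mulmxA M0 mulmx0.
have full : \rank M' = N.
  suff : cokermx M' = 0.
    move/(congr1 mxrank); rewrite mxrank0 mxrank_coker => /eqP; rewrite subn_eq0 => le.
    by apply/eqP; rewrite eqn_leq rank_leq_row.
  suff F0 b : col b (cokermx M') = 0.
    by apply/matrixP => a b; have /matrixP/(_ a 0) := F0 b; rewrite !mxE.
  set F := col b _.
  have M'F : M' *m F = 0 by rewrite /F colE mulmxA mulmx_coker mul0mx.
  clearbody F.
  have PF : Pi j *m F = F.
    apply/eqP; rewrite eq_sym -subr_eq0 -{1}[F]mul1mx -mulmxBl; apply/eqP/kill => //.
    by apply: submx_trans (addsmxSl _ _); apply: addsmxSr.
  have MS m (A : 'M[k]_(m, N)) : (A <= M)%MS -> (A <= M')%MS.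
    by move=> AM; apply: submx_trans AM _; apply: submx_trans (addsmxSl _ _); apply: addsmxSl.
  apply: inj => //.
  - by rewrite -PF mulmxA; apply: kill M'F; apply: MS; apply: addsmxSl.
  - by rewrite -PF mulmxA; apply: kill M'F; apply: MS; apply: addsmxSr.
  - move=> s sS; have DF : D *m F = 0 by apply: kill M'F; apply: addsmxSr.
    have lt_s : (index s S < size S)%N by rewrite index_mem.
    move/matrixP/(_ (Ordinal lt_s) 0): DF; rewrite !mxE (bigD1 s) //=.
    rewrite mxE (tnth_nth s) /= nth_index // eqxx mul1r big1 ?addr0 // => t /negbTE ts.
    by rewrite mxE (tnth_nth s) /= nth_index // eq_sym ts mul0r.
have le : (\rank M' <= \rank M + (N - \rank (Pi j)) + size S)%N.
  apply: leq_trans (mxrank_adds_leqif _ _) _; apply: leq_add; last exact: rank_leq_row.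
  apply: leq_trans (mxrank_adds_leqif _ _) _; by rewrite rank_compl_degmx.
have := rank_degmx_le j; rewrite full in le; rewrite /coker -/M; lia.
Qed.

Lemma le_coker (c : 'I_n -> k) j f (F : 'M[k]_(N, f)) :
  mulX d c *m F = 0 -> mulL k n d *m F = 0 -> Pi j *m F = F -> \rank F = f ->
  (f <= coker d c j)%N.
Proof.
move=> XF LF PF rF; set M := image_mx d c j.
have MP : (M <= Pi j)%MS by apply: image_mx_degmx.
have cap : (M :&: (1%:M - Pi j)%R = 0)%MS.
  apply/eqP; rewrite -submx0; apply/row_subP => s; set v := row s _.
  have : (v <= M :&: (1%:M - Pi j)%R)%MS by apply: row_sub.
  rewrite sub_capmx => /andP[vM /submxP[u vE]].
  have /sub_degmxP <- : (v <= Pi j)%MS by apply: submx_trans vM MP.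
  by rewrite vE -mulmxA mulmxBl mul1mx degmx_idem subrr mulmx0 sub0mx.
have sum : (\rank (M + (1%:M - Pi j)%R)%MS = \rank M + (N - \rank (Pi j)))%N.
  by have := mxrank_sum_cap M (1%:M - Pi j); rewrite cap mxrank0 addn0 rank_compl_degmx.
have : (\rank (M + (1%:M - Pi j)%R)%MS + \rank F <= N)%N.
  apply: mulmx0_rank_max; apply/eqP.
  have : ((M + (1%:M - Pi j)%R)%MS <= kermx F)%MS.
    rewrite !addsmx_sub; apply/andP; split; last first.
      by apply/sub_kermxP; rewrite mulmxBl mul1mx PF subrr.
    by apply/andP; split; apply/sub_kermxP; rewrite -mulmxA PF ?XF ?LF.
  by move/sub_kermxP/eqP.
have := rank_degmx_le j; rewrite sum rF /coker -/M; lia.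
Qed.

Lemma rank_Lmx_le j :
  Z.le (Z.of_nat (\rank (Lmx j))) (comps n d (Z.sub (Z.of_nat j) (Z.of_nat d))).
Proof.
rewrite mulL_degmx; case: leqP => [le|lt].
  rewrite -Nat2Z.inj_sub; last by lia.
  rewrite -(rank_degmx k); apply/inj_le/ssrnat.leP; exact: mxrankM_maxl.
by rewrite mxrank0 comps_neg /=; lia.
Qed.

Hypothesis char_k : [pchar k] =i pred0.

Lemma mulX1exp_inj e i (v : 'rV[k]_N) : (0 < e -> (i + e.-1).*2 < n * d.-1)%N ->
  v *m Pi i = v -> v *m mulX d (fun=> 1) ^+ e = 0 -> v = 0.
Proof.
elim: e i v => [|e IH] i v; first by rewrite expr0 mulmx1.
move=> /(_ isT) le vi; rewrite exprS -[_ * _]/(_ *m _) mulmxA => ve.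
apply: (@mulX1_inj _ _ _ char_k i) => //; first by apply: leq_ltn_trans le; rewrite leq_double leq_addr.
apply: (IH i.+1) => //; last by rewrite -mulmxA mulX_degmx mulmxA vi.
by case: e {IH ve} le => // e; rewrite addSnnS.
Qed.

(** Of the [d] successive multiplications by the sum of the variables the last starts in degree
    [j - 1]; it is below the middle exactly under the stated bound. *)
Lemma rank_Lmx j : (j.*2 <= n * d.-1 + 1)%N ->
  Z.of_nat (\rank (Lmx j)) = comps n d (Z.sub (Z.of_nat j) (Z.of_nat d)).
Proof.
move=> le_j; rewrite mulL_degmx; case: leqP => [le|lt]; last first.
  by rewrite mxrank0 comps_neg //=; lia.
rewrite -Nat2Z.inj_sub; last by lia.
rewrite -(rank_degmx k); congr Z.of_nat.
have := mxrank_mul_ker (Pi (j - d)) (mulL k n d).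
rewrite (_ : (_ :&: _)%MS = 0) ?mxrank0 ?addn0 //.
apply/eqP; rewrite -submx0; apply/row_subP => s; set v := row s _.
have : (v <= Pi (j - d) :&: kermx (mulL k n d))%MS by apply: row_sub.
rewrite sub_capmx => /andP[/sub_degmxP vP /sub_kermxP vL].
rewrite submx0; apply/eqP; apply: (mulX1exp_inj _ vP vL) => d0.
by move: (subnK le) le_j d0; move: (j - d)%N => q; case: (d) => //= e; lia.
Qed.

(** A nonzero cokernel excludes surjectivity. Injectivity would force the cokernel to be at most
    [e_j]: the exact rank of [Lmx j] and an upper bound for that of [Lmx i] enter the count. *)
Lemma coker_not_max (c : 'I_n -> k) i j : j = i.+1 -> (j.*2 <= n * d.-1 + 1)%N ->
  (0 < coker d c j)%N ->
  Z.lt (Z.sub (dcomps n d (Z.of_nat j)) (dcomps n d (Z.sub (Z.of_nat j) (Z.of_nat d))))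
       (Z.of_nat (coker d c j)) ->
  ~ inj_at d c i /\ ~ sur_at d c i.
Proof.
move=> jE le_j cok0 lt_e.
have im_le : (\rank (image_mx d c j) <= \rank (Pi j))%N by apply/mxrankS/image_mx_degmx.
split=> [/inj_atP|/sur_atP/mxrankS]; last by rewrite -jE; move: cok0; rewrite /coker; lia.
have := rank_image_mx d c i; rewrite -jE.
have := rank_Lmx le_j; have := @rank_Lmx_le i.
have := rank_degmx k n d i; have := rank_degmx k n d j.
move: lt_e im_le; rewrite /coker /dcomps.
have -> : Z.sub (Z.of_nat j) 1 = Z.of_nat i by lia.
have -> : Z.sub (Z.sub (Z.of_nat j) (Z.of_nat d)) 1 = Z.sub (Z.of_nat i) (Z.of_nat d) by lia.
lia.
Qed.

End Coker.

Section Positive.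

Variables (k : fieldType) (n d : nat) (c : 'I_n -> k).

Notation N := #|{ffun 'I_n -> 'I_d}|.
Notation Pi := (degmx k n d).
Notation Lmx j := (mulL k n d *m Pi j).

(** A monomial of degree [j + 1] is a variable times one of degree [j], and multiplication by that
    variable preserves both parts of the image. *)
Lemma image_mx_full_succ j : (Pi j <= image_mx d c j)%MS ->
  (Pi j.+1 <= image_mx d c j.+1)%MS.
Proof.
move=> full; apply/row_subP => s; rewrite rowE.
have [deg|/negbTE deg] := boolP (mdeg (emon s) == j.+1); last first.
  rewrite (_ : _ *m _ = 0) ?sub0mx //; apply/rowP => t; rewrite degmxE !mxE eqxx /=.
  by case: eqP => [->|_]; rewrite ?deg ?mulr0 ?mul0r.
have [l sl] : exists l, (0 < emon s l)%N.
  apply/existsP; move: deg; apply: contraLR; rewrite negb_exists => /forallP z.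
  by rewrite mdegE big1 // => i _; apply/eqP; have := z i; rewrite lt0n negbK.
have le_l : (U_(l) <= emon s)%MM by rewrite lep1mP -lt0n.
have [s' s'E] : exists s' : 'I_N, emon s' = (emon s - U_(l))%MM.
  by apply: emon_surj; apply: (@bounded_addU _ _ _ l); rewrite submK // emon_bounded.
have deg' : mdeg (emon s') = j.
  by apply/eqP; rewrite -eqSS -(eqP deg) s'E -addn1 -(mdeg1 l) -mdegD submK.
have -> : delta_mx 0 s *m Pi j.+1 = (delta_mx 0 s' : 'rV[k]_N) *m Pi j *m (mulX d (fun i => (i == l)%:R) : 'M[k]_N).
  rewrite -mulmxA -mulX_degmx mulmxA. congr (_ *m _).
  apply/rowP => t; rewrite !mxE (bigD1 s') //= big1 ?addr0 => [|u /negbTE us]; last first.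
    by rewrite mxE us andbF mul0r.
  rewrite !mxE !eqxx mul1r (bigD1 l) //= eqxx mul1r big1 ?addr0 => [|i /negbTE ->]; last by rewrite mul0r.
  by rewrite s'E submK // (inj_eq (@emon_inj _ _)).
have : ((delta_mx 0 s' : 'rV[k]_N) *m Pi j <= image_mx d c j)%MS by apply: submx_trans full; apply: submxMl.
move/(submxMr (mulX d (fun i => (i == l)%:R))) => /submx_trans; apply.
rewrite /image_mx addsmxMr; apply: addsmxS; last exact: sub_mulX.
by rewrite -mulmxA -mulX_degmx mulmxA mulX_comm -mulmxA submxMl.
Qed.

(** Summed up, the cokernel bounds limit the dimension of the quotient in degree [i] by
    [comps i - comps (i - d)]. Since [Lmx i] has rank at most [comps (i - d)], the same number is a
    lower bound. Equality leaves no room for a kernel up to degree [p]; from there on the maps are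
    surjective. *)
Lemma lefschetz_of_coker p :
  (forall j, (j <= p)%N -> Z.le (Z.of_nat (coker d c j))
     (Z.sub (dcomps n d (Z.of_nat j)) (dcomps n d (Z.sub (Z.of_nat j) (Z.of_nat d))))) ->
  coker d c p.+1 = 0 ->
  forall i, inj_at d c i \/ sur_at d c i.
Proof.
move=> cok_le cok0.
have im_le j : (\rank (image_mx d c j) <= \rank (Pi j))%N by apply/mxrankS/image_mx_degmx.
have rP j := rank_degmx k n d j.
have rL j := @rank_Lmx_le k n d j.
have kerL i : (\rank (Lmx i) <= \rank (ker_mx d c i))%N by apply/mxrankS/Lmx_ker.
have h i : (i <= p)%N -> Z.le (Z.sub (Z.of_nat (\rank (Pi i))) (Z.of_nat (\rank (Lmx i))))
    (Z.sub (comps n d (Z.of_nat i)) (comps n d (Z.sub (Z.of_nat i) (Z.of_nat d)))).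
  elim: i => [|i IH] le_i.
    have := cok_le 0%N isT; have := rank_image_mx0 d c; have := im_le 0%N; rewrite /coker /dcomps.
    rewrite !(@comps_neg _ _ (Z.sub _ 1)) /=; lia.
  have := cok_le _ le_i; have := IH (ltnW le_i); have := im_le i.+1.
  have := rank_image_mx d c i; have := kerL i; rewrite /coker /dcomps.
  have -> : Z.sub (Z.of_nat i.+1) 1 = Z.of_nat i by lia.
  have -> : Z.sub (Z.sub (Z.of_nat i.+1) (Z.of_nat d)) 1 = Z.sub (Z.of_nat i) (Z.of_nat d) by lia.
  lia.
move=> i; have [lt|ge] := ltnP i p.
  left; apply/inj_atP.
  have := cok_le _ lt; have := h i (ltnW lt); have := h i.+1 lt; have := im_le i.+1.
  have := rank_image_mx d c i; have := kerL i; have := rL i.+1; have := rP i.+1.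
  rewrite /coker /dcomps.
  have -> : Z.sub (Z.of_nat i.+1) 1 = Z.of_nat i by lia.
  have -> : Z.sub (Z.sub (Z.of_nat i.+1) (Z.of_nat d)) 1 = Z.sub (Z.of_nat i) (Z.of_nat d) by lia.
  lia.
right; apply/sur_atP; rewrite -(subnKC ge); elim: (i - p)%N => [|e IH].
  rewrite addn0 -(geq_leqif (mxrank_leqif_sup (image_mx_degmx d c p.+1))).
  by move: cok0; rewrite /coker; lia.
by rewrite addnS; apply: image_mx_full_succ.
Qed.

End Positive.

(** * Reduction to the normal form *)

Section IdealWLP.

Variables (k : fieldType) (n : nat).
Implicit Types (I J : {mpoly k[n]} -> Prop) (p q l : {mpoly k[n]}).

(** Stated on polynomials modulo a predicate, so that a change of variables never has to be
    transported between quotient types. *)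
Definition ideal_wlp I : Prop :=
  exists2 l, l \is 1.-homog & forall i : nat,
    (forall p, p \is i.-homog -> I (l * p) -> I p) \/
    (forall q, q \is i.+1.-homog -> exists2 p, p \is i.-homog & I (l * p - q)).

Lemma ideal_wlp_transfer I J (f g : {rmorphism {mpoly k[n]} -> {mpoly k[n]}}) :
  cancel f g -> cancel g f ->
  (forall i p, p \is i.-homog -> f p \is i.-homog) ->
  (forall i p, p \is i.-homog -> g p \is i.-homog) ->
  (forall p, I p <-> J (f p)) ->
  ideal_wlp I -> ideal_wlp J.
Proof.
move=> fK gK f_hom g_hom IJ [l l_hom max]; exists (f l); first exact: f_hom.
move=> i; have [inj|sur] := max i; [left=> p p_hom | right=> q q_hom].
  rewrite -[p]gK -rmorphM => /IJ Il; apply/IJ; apply: inj Il; exact: g_hom.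
have [p p_hom Ip] := sur _ (g_hom _ _ q_hom).
exists (f p); first exact: f_hom.
by rewrite -[q]gK -rmorphM -rmorphB; apply/IJ.
Qed.

Lemma weak_lefschetzE m (a : 'M[k]_(m, n)) d (d_gt0 : (0 < d)%N) :
  weak_lefschetz (pow_quot a d_gt0) (pow_quot_gr a d_gt0) <->
  ideal_wlp (fun p => p \in pow_ideal a d_gt0).
Proof.
pose pr := pow_proj a d_gt0.
have prE p q : (pr p = pr q) <-> (p - q \in pow_ideal a d_gt0).
  split=> [/eqP|h]; first by rewrite -Quotient.idealrBE.
  by apply/eqP; rewrite -Quotient.idealrBE.
split=> [[_ [l l_hom ->]] max|[l l_hom max]].
  exists l => // i; have [inj|sur] := max i; [left=> p p_hom Ip|right=> q q_hom].
    rewrite -[p]subr0; apply/prE; apply: inj; [by exists p| |].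
      by exists 0; rewrite ?rpred0.
    by rewrite -!rmorphM; apply/prE; rewrite mulr0 subr0.
  have [|_ [p p_hom ->]] := sur (pr q); first by exists q.
  by rewrite -rmorphM => /prE h; exists p.
exists (pr l); first by exists l.
move=> i; have [inj|sur] := max i; [left|right].
  move=> _ _ [p p_hom ->] [q q_hom ->]; rewrite -!rmorphM => /prE h.
  by apply/prE; apply: inj; rewrite ?rpredB // mulrBr.
move=> _ [q q_hom ->]; have [p p_hom /prE h] := sur q q_hom.
by exists (pr p); [exists p | rewrite -rmorphM].
Qed.

Definition lin_subst (h : 'M[k]_n) : {mpoly k[n]} -> {mpoly k[n]} :=
  comp_mpoly [tuple linform (h i) | i < n].

HB.instance Definition _ h := GRing.RMorphism.on (lin_subst h).

Lemma lin_subst_linform h c :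
  lin_subst h (linform c) = linform (fun j => \sum_i c i * h i j).
Proof.
rewrite /linform rmorph_sum /=; under eq_bigr => i _.
  rewrite /lin_subst comp_mpolyZ comp_mpolyXU -tnth_nth tnth_mktuple /linform scaler_sumr.
  over.
rewrite exchange_big /=; apply: eq_bigr => j _; rewrite scaler_suml.
by apply: eq_bigr => i _; rewrite scalerA.
Qed.

Lemma linform_homog (c : 'I_n -> k) : linform c \is 1.-homog.
Proof. by rewrite rpred_sum // => i _; rewrite rpredZ // dhomogX /= mdeg1. Qed.

Lemma homog1_linform l : l \is 1.-homog -> l = linform (fun i => l@_U_(i)).
Proof.
move=> l_hom; apply/mpolyP => m; rewrite /linform raddf_sum /=.
under eq_bigr => i _ do rewrite mcoeffZ mcoeffX.
have [/eqP m1|m1] := boolP (mdeg m == 1%N); last first.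
  rewrite (dhomog_nemf_coeff l_hom m1) big1 // => i _.
  by case: eqP => [E|_]; [move: m1; rewrite -E /= mdeg1 | rewrite mulr0].
have /mdeg1P[i /eqP ->] : mdeg m == 1%N by apply/eqP.
rewrite (bigD1 i) //= eqxx mulr1 big1 ?addr0 // => j /negbTE ji.
rewrite [_ == _](_ : _ = false) ?mulr0 //; apply/negbTE/eqP => /mnmP/(_ i).
by rewrite !mnm1E eqxx ji.
Qed.

Lemma lin_subst_comp h h' : lin_subst h \o lin_subst h' =1 lin_subst (h' *m h).
Proof.
apply: mpoly_rmorph_eq => [c|i] /=; first by rewrite /lin_subst !comp_mpolyC.
rewrite {2 3}/lin_subst !comp_mpolyXU -!tnth_nth !tnth_mktuple lin_subst_linform.
by rewrite /linform; apply: eq_bigr => j _; rewrite mxE.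
Qed.

Lemma lin_subst1 : lin_subst 1%:M =1 id.
Proof.
move=> p; rewrite /lin_subst -[RHS]comp_mpoly_id; congr comp_mpoly.
apply/eq_from_tnth => i; rewrite !tnth_mktuple /linform (bigD1 i) //= mxE eqxx scale1r.
by rewrite big1 ?addr0 // => j /negbTE ji; rewrite mxE eq_sym ji scale0r.
Qed.

Lemma lin_substK h h' : h *m h' = 1%:M -> cancel (lin_subst h) (lin_subst h').
Proof. by move=> hh' p; rewrite -[LHS]/((lin_subst h' \o lin_subst h) p) lin_subst_comp hh' lin_subst1. Qed.

Lemma lin_subst_homog h i p : p \is i.-homog -> lin_subst h p \is i.-homog.
Proof.
move=> /dhomogP p_hom; rewrite /lin_subst comp_mpolyEX big_seq rpred_sum // => m m_p.
rewrite rpredZ // comp_mpolyX.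
have <- : mdeg m = i by exact: p_hom.
rewrite mdegE; elim/big_rec2: _ => [|j e q _ hq]; first exact: dhomog1.
apply: dhomogM => //; rewrite tnth_mktuple -[X in X.-homog]mul1n.
apply: dhomogMn; exact: linform_homog.
Qed.

End IdealWLP.

Section NormalForm.

Variables (k : fieldType) (n d : nat) (d_gt0 : (0 < d)%N).
Implicit Types (a : 'M[k]_(n.+1, n)) (p : {mpoly k[n]}).

Definition top_rows (R : pzRingType) (a : 'M[R]_(n.+1, n)) : 'M[R]_n :=
  \matrix_(i, j) a (widen_ord (leqnSn n) i) j.

Definition last_coords (R : comNzRingType) (a : 'M[R]_(n.+1, n)) : 'rV[R]_n :=
  row ord_max a *m \adj (top_rows a).

(* Up to the nonzero factor [\det (top_rows a)], the entries of [last_coords a]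
   are the coordinates of the last form in the basis of the first [n] ones. *)
Definition genericity (R : comNzRingType) (a : 'M[R]_(n.+1, n)) : R :=
  \det (top_rows a) * \prod_i last_coords a 0 i.

(** The substitution sends [X_i] to [s i] times the i-th form, hence the sum of the variables to the
    last form. As the [s i] are nonzero, the rescaled powers generate the same ideal. *)
Lemma generic_wlp a : genericity a != 0 ->
  ideal_wlp (fun p => p \in pow_ideal a d_gt0) <-> ideal_wlp (@nideal k n d).
Proof.
rewrite /genericity mulf_eq0 negb_or => /andP[det0 /prodf_neq0 coord0].
pose s i := last_coords a 0 i / \det (top_rows a).
have s0 i : s i != 0 by rewrite mulf_neq0 ?invr_eq0 // coord0.
have lastE j : a ord_max j = \sum_i s i * a (widen_ord (leqnSn n) i) j.
  have : last_coords a *m top_rows a = \det (top_rows a) *: row ord_max a.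
    by rewrite /last_coords -mulmxA mul_adj_mx mul_mx_scalar.
  move/rowP/(_ j); rewrite mxE [in RHS]mxE [in RHS]mxE => E.
  apply: (mulfI det0); rewrite -E mulr_sumr.
  by apply: eq_bigr => i _; rewrite mulrA [_ * s i]mulrC divfK // [top_rows _ _ _]mxE.
pose h : 'M[k]_n := \matrix_(i, j) (s i * a (widen_ord (leqnSn n) i) j).
have hU : h \in unitmx.
  have -> : h = diag_mx (\row_i s i) *m top_rows a.
    by rewrite mul_diag_mx; apply/matrixP => i j; rewrite !mxE.
  rewrite unitmx_mul !unitmxE det_diag !unitfE det0 andbT.
  by apply/prodf_neq0 => i _; rewrite mxE.
have fK := lin_substK (mulmxV hU); have gK := lin_substK (mulVmx hU).
have IJ p : nideal d p <-> lin_subst h p \in pow_ideal a d_gt0.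
  have fX i : lin_subst h 'X_i = s i *: linear_form a (widen_ord (leqnSn n) i).
    rewrite /lin_subst comp_mpolyXU -tnth_nth tnth_mktuple /linform /linear_form scaler_sumr.
    by apply: eq_bigr => j _; rewrite scalerA mxE.
  have fL : lin_subst h (linform (fun=> 1)) = linear_form a ord_max.
    rewrite lin_subst_linform /linform /linear_form; apply: eq_bigr => j _; congr (_ *: _).
    by rewrite lastE; apply: eq_bigr => i _; rewrite mul1r mxE.
  split=> [[q [q' ->]]|/pow_idealP[c]].
    apply/pow_idealP.
    exists (fun i => if unlift ord_max i is Some j then s j ^+ d *: lin_subst h (q j) else lin_subst h q').
    rewrite big_ord_recr /= unlift_none rmorphD rmorphM rmorphXn /= fL; congr (_ + _).
    rewrite rmorph_sum; apply: eq_bigr => i _ /=.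
    have -> : widen_ord (leqnSn n) i = lift ord_max i by apply/val_inj; rewrite /= /bump leqNgt ltn_ord.
    rewrite liftK rmorphM rmorphXn /= fX exprZn -scalerAr -scalerAl.
    congr (_ *: (_ * linear_form a _ ^+ d)).
    by apply/val_inj; rewrite /= /bump leqNgt ltn_ord.
  rewrite big_ord_recr /= => pE.
  exists (fun i => (s i)^-1 ^+ d *: lin_subst (invmx h) (c (widen_ord (leqnSn n) i))).
  exists (lin_subst (invmx h) (c ord_max)).
  apply: (can_inj fK); rewrite pE rmorphD rmorph_sum /= rmorphM rmorphXn /= fL gK; congr (_ + _).
  apply: eq_bigr => i _; rewrite rmorphM rmorphXn /= fX {1}/lin_subst comp_mpolyZ.
  rewrite -/(lin_subst h _) gK exprZn -scalerAl -scalerAr scalerA -exprMn mulVf //.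
  by rewrite expr1n scale1r.
split.
  apply: (ideal_wlp_transfer (f := lin_subst (invmx h)) (g := lin_subst h)) => //.
  - by move=> i p; apply: lin_subst_homog.
  - by move=> i p; apply: lin_subst_homog.
  - by move=> p; rewrite IJ gK.
apply: (ideal_wlp_transfer (f := lin_subst h) (g := lin_subst (invmx h))) => //.
- by move=> i p; apply: lin_subst_homog.
- by move=> i p; apply: lin_subst_homog.
Qed.

(** The defining polynomial is [genericity] of the matrix of indeterminates; [genericity] is defined
    over every commutative ring for this purpose. *)
Lemma genericity_open : zariski_open (fun a => genericity a != 0).
Proof.
pose G : 'M[{mpoly k[n.+1 * n]}]_(n.+1, n) := \matrix_(i, j) 'X_(mxvec_index i j).
exists (fun f => f = genericity G) => a.
suff -> : genericity a = (genericity G).@[fun t => mxvec a ord0 t].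
  by split=> [h|[f -> //]]; exists (genericity G).
pose ev : {rmorphism {mpoly k[n.+1 * n]} -> k} := meval (fun t => mxvec a ord0 t).
have GE : map_mx ev G = a.
  by apply/matrixP => i j; rewrite !mxE /ev /= mevalXU mxvecE.
have topE : map_mx ev (top_rows G) = top_rows a.
  by apply/matrixP => i j; rewrite -GE !mxE.
rewrite /genericity -[LHS]/(_ * _) -[RHS]/(ev _) rmorphM rmorph_prod /= -det_map_mx topE.
congr (_ * _); apply: eq_bigr => i _.
have -> : last_coords a = map_mx ev (last_coords G).
  by rewrite /last_coords map_mxM map_mx_adj topE map_row GE.
by rewrite mxE.
Qed.

Lemma genericity_nonempty : exists a, genericity a != 0.
Proof.
(* The variables together with their sum. *)
pose a : 'M[k]_(n.+1, n) := \matrix_(i, j) (if i == ord_max then 1 else (i == j :> nat)%:R).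
exists a; have topE : top_rows a = 1%:M.
  apply/matrixP => i j; rewrite !mxE ifF //.
  by apply/negbTE/eqP => /(congr1 val) /=; apply/eqP; rewrite neq_ltn ltn_ord.
rewrite /genericity /last_coords topE det1 mul1r adj1 mulmx1.
by apply/prodf_neq0 => i _; rewrite !mxE eqxx oner_neq0.
Qed.

Lemma nideal_wlpP : ideal_wlp (@nideal k n d) <->
  exists c : 'I_n -> k, forall i, inj_at d c i \/ sur_at d c i.
Proof.
split=> [[l l_hom max]|[c max]].
  exists (fun i => l@_U_(i)); move: l_hom max => /homog1_linform lE max i.
  have [inj|sur] := max i; [left=> v vi vc|right=> w wi].
    have := inj _ (untrunc_homog vi); rewrite !nidealP untruncK; apply.
    by rewrite lE trunc_linform_mul untruncK.
  have [p p_hom /nidealP] := sur _ (untrunc_homog wi).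
  rewrite linearB /= untruncK {1}lE trunc_linform_mul => h.
  exists (trunc d p); first exact: trunc_homog.
  by rewrite -opprB eqmx_opp.
exists (linform c); first exact: linform_homog.
move=> i; have [inj|sur] := max i; [left=> p p_hom|right=> q q_hom].
  rewrite !nidealP trunc_linform_mul; apply: inj; exact: trunc_homog.
have [v vi vq] := sur _ (trunc_homog d q_hom).
exists (untrunc v); first exact: untrunc_homog.
apply/nidealP; rewrite linearB /= trunc_linform_mul untruncK -opprB eqmx_opp //.
Qed.

End NormalForm.

(** * Secant determinants *)

Section Derivations.

Variables (R : comNzRingType) (n : nat).
Implicit Types (F G : {mpoly R[n]}) (c : 'I_n -> R).

Definition dlin c F : {mpoly R[n]} := \sum_(i < n) c i *: F^`M(i).

Lemma dlin_is_linear c : linear (dlin c).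
Proof.
move=> a F G; rewrite /dlin scaler_sumr -big_split /=; apply: eq_bigr => i _.
by rewrite linearP scalerDr !scalerA mulrC.
Qed.
HB.instance Definition _ c := GRing.isLinear.Build R _ _ _ (dlin c) (dlin_is_linear c).

Lemma dlinM c F G : dlin c (F * G) = dlin c F * G + F * dlin c G.
Proof.
rewrite /dlin mulr_suml mulr_sumr -big_split /=; apply: eq_bigr => i _.
by rewrite mderivM scalerDr scalerAl scalerAr.
Qed.

Lemma dlinC c a : dlin c a%:MP = 0.
Proof. by rewrite /dlin big1 // => i _; rewrite mderivC scaler0. Qed.

Lemma dlinX c i : dlin c 'X_i = (c i)%:MP.
Proof.
rewrite /dlin (bigD1 i) //= big1 ?addr0 => [|l /negbTE li].
  rewrite mderivX mnm1E eqxx scale1r -{1}[U_(i)%MM]add0m addmK mpolyX0.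
  by rewrite -mul_mpolyC mulr1.
by rewrite mderivX mnm1E eq_sym li scale0r scaler0.
Qed.

Lemma dlin_prod c (I : finType) (f : I -> {mpoly R[n]}) :
  dlin c (\prod_i f i) = \sum_i \prod_l (if l == i then dlin c (f l) else f l).
Proof.
have H (r : seq I) : uniq r -> dlin c (\prod_(i <- r) f i) =
    \sum_(i <- r) \prod_(l <- r) (if l == i then dlin c (f l) else f l).
  elim: r => [_|x r IH /= /andP[xr ur]]; first by rewrite !big_nil -mpolyC1 dlinC.
  rewrite big_cons dlinM IH // big_cons big_cons eqxx; congr (_ * _ + _).
    apply: eq_big_seq => i ir; case: eqP => // ix; by rewrite -ix ir in xr.
  rewrite mulr_sumr; apply: eq_big_seq => i ir; rewrite big_cons.
  by case: eqP => // xi; rewrite xi ir in xr.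
exact: H (index_enum_uniq I).
Qed.

Lemma mpolyC_sign e : (-1) ^+ e = ((-1) ^+ e : R)%:MP :> {mpoly R[n]}.
Proof. by rewrite rmorphXn rmorphN rmorph1. Qed.

Lemma dlin_det c m (A : 'M[{mpoly R[n]}]_m) :
  dlin c (\det A) = \sum_r \det (\matrix_(r', i) if r' == r then dlin c (A r' i) else A r' i).
Proof.
rewrite /determinant linear_sum [RHS]exchange_big /=; apply: eq_bigr => s _.
rewrite mpolyC_sign.
rewrite mul_mpolyC linearZ /= dlin_prod scaler_sumr; apply: eq_bigr => r _.
by rewrite mul_mpolyC; congr (_ *: _); apply: eq_bigr => l _; rewrite mxE.
Qed.

Definition annulled c e F : Prop := iter e (dlin c) F = 0.

Lemma iter_dlin0 c e : iter e (dlin c) 0 = 0.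
Proof. by elim: e => //= e ->; rewrite linear0. Qed.

Lemma iter_dlinD c e F G : iter e (dlin c) (F + G) = iter e (dlin c) F + iter e (dlin c) G.
Proof. by elim: e => //= e ->; rewrite linearD. Qed.

Lemma annulled_leq c e e' F : (e <= e')%N -> annulled c e F -> annulled c e' F.
Proof. by move=> /subnK <- Fe; rewrite /annulled iterD Fe iter_dlin0. Qed.

Lemma annulledD c e F G : annulled c e F -> annulled c e G -> annulled c e (F + G).
Proof. by rewrite /annulled iter_dlinD => -> ->; rewrite addr0. Qed.

Lemma annulled_sum c e (I : Type) (r : seq I) (P : pred I) (f : I -> {mpoly R[n]}) :
  (forall i, P i -> annulled c e (f i)) -> annulled c e (\sum_(i <- r | P i) f i).
Proof.
by move=> h; elim/big_ind: _ => //; [exact: iter_dlin0 | exact: annulledD].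
Qed.

Lemma annulledZ c e a F : annulled c e F -> annulled c e (a *: F).
Proof.
have H : iter e (dlin c) (a *: F) = a *: iter e (dlin c) F.
  by elim: e => //= e ->; rewrite linearZ.
by rewrite /annulled H => ->; rewrite scaler0.
Qed.

Lemma annulled_dlin c e F : annulled c e.+1 F <-> annulled c e (dlin c F).
Proof. by rewrite /annulled iterSr. Qed.

(** By the Leibniz rule, among [e + e' + 1] derivations at least [e + 1] fall on [F] or at least
    [e' + 1] on [G]. *)
Lemma annulledM c e e' F G : annulled c e.+1 F -> annulled c e'.+1 G -> annulled c (e + e').+1 (F * G).
Proof.
have H N : forall a b F G, annulled c a F -> annulled c b G -> (a + b <= N.+1)%N -> annulled c N (F * G).
  elim: N => [|N IH] [|a] [|b] {}F {}G Fa Gb le.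
  - by rewrite (Fa : F = 0) mul0r.
  - by rewrite (Fa : F = 0) mul0r.
  - by rewrite (Gb : G = 0) mulr0.
  - by rewrite addnS in le.
  - by rewrite /annulled (Fa : F = 0) mul0r iter_dlin0.
  - by rewrite /annulled (Fa : F = 0) mul0r iter_dlin0.
  - by rewrite /annulled (Gb : G = 0) mulr0 iter_dlin0.
  - apply/annulled_dlin; rewrite dlinM; apply: annulledD.
      by apply: (IH a b.+1) => //; apply/annulled_dlin.
    by apply: (IH a.+1 b) => //; [apply/annulled_dlin | lia].
by move=> Fe Ge; apply: (H _ e.+1 e'.+1) => //; lia.
Qed.

Lemma annulled_prod c (I : Type) (r : seq I) (f : I -> {mpoly R[n]}) (e : I -> nat) :
  (forall i, annulled c (e i).+1 (f i)) -> annulled c (\sum_(i <- r) e i).+1 (\prod_(i <- r) f i).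
Proof.
move=> h; elim: r => [|x r IH]; last by rewrite !big_cons; apply: annulledM.
by rewrite !big_nil /annulled /= -mpolyC1 dlinC.
Qed.

End Derivations.

Section RowDet.

Variables (A : comNzRingType).

(* Rows are indexed by monomials [c ^ a * X ^ eps] in a pair of variables, and
   columns by pairs of variables. *)
Definition rowdet m (a : 'I_m -> nat) (eps : 'I_m -> bool) (c X : 'I_m -> A) : A :=
  \det (\matrix_(r, i) (c i ^+ a r * X i ^+ eps r)).

Lemma rowdet_alt m a eps c X (r r' : 'I_m) : r != r' -> a r = a r' -> eps r = eps r' ->
  rowdet a eps c X = 0.
Proof.
move=> rr' ar er; apply: (determinant_alternate rr') => i.
by rewrite !mxE ar er.
Qed.

Lemma eq_rowdet m a a' eps eps' c c' X X' : a =1 a' -> eps =1 eps' -> c =1 c' -> X =1 X' ->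
  @rowdet m a eps c X = rowdet a' eps' c' X'.
Proof.
move=> aE eE cE XE; congr (\det _); apply/matrixP => r i.
by rewrite !mxE aE eE cE XE.
Qed.

End RowDet.

Lemma rmorph_rowdet (A B : comNzRingType) (f : {rmorphism A -> B}) m a eps c X :
  f (@rowdet A m a eps c X) = rowdet a eps (f \o c) (f \o X).
Proof.
rewrite /rowdet -det_map_mx; congr (\det _); apply/matrixP => r i.
by rewrite !mxE rmorphM !rmorphXn.
Qed.

Section RowDetDeriv.

Variables (R : comNzRingType) (n m : nat) (c : 'I_n -> R) (e : 'I_m -> 'I_n).
Implicit Types (a : 'I_m -> nat) (eps : 'I_m -> bool).

Definition colvar (i : 'I_m) : {mpoly R[n]} := 'X_(e i).
Definition colcst (i : 'I_m) : {mpoly R[n]} := (c (e i))%:MP.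

Definition mdet a eps : {mpoly R[n]} := rowdet a eps colcst colvar.

Definition upd (T : Type) (f : 'I_m -> T) (r : 'I_m) (x : T) : 'I_m -> T :=
  fun r' => if r' == r then x else f r'.

Lemma dlin_entry g a eps r i :
  dlin g (colcst i ^+ a r * colvar i ^+ eps r) =
  if eps r then colcst i ^+ a r * (g (e i))%:MP else 0.
Proof.
rewrite dlinM /colcst -rmorphXn dlinC mul0r add0r.
by case: (eps r); rewrite ?expr1 ?dlinX // expr0 -mpolyC1 dlinC mulr0.
Qed.

Lemma dlin_c_mdet a eps :
  dlin c (mdet a eps) = \sum_(r | eps r) mdet (upd a r (a r).+1) (upd eps r false).
Proof.
rewrite /mdet /rowdet dlin_det [RHS]big_mkcond; apply: eq_bigr => r _.
case: ifP => er.
  congr (\det _); apply/matrixP => r' i; rewrite !mxE /upd; case: eqP => [->|//].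
  by rewrite dlin_entry er exprSr mulr1.
apply/eqP; rewrite -[_ == 0]/(\det _ == 0).
set B := \matrix_(_, _) _.
have B0 i : B r i = 0 by rewrite !mxE eqxx dlin_entry er.
rewrite (expand_det_row _ r) big1 // => i _; by rewrite B0 mul0r.
Qed.

Lemma dlin_1_mdet a eps :
  dlin (fun=> 1) (mdet a eps) = \sum_(r | eps r) mdet a (upd eps r false).
Proof.
rewrite /mdet /rowdet dlin_det [RHS]big_mkcond; apply: eq_bigr => r _.
case: ifP => er.
  congr (\det _); apply/matrixP => r' i; rewrite !mxE /upd; case: eqP => [->|//].
  by rewrite dlin_entry er mpolyC1 mulr1.
set B := \matrix_(_, _) _.
have B0 i : B r i = 0 by rewrite !mxE eqxx dlin_entry er.
rewrite (expand_det_row _ r) big1 // => i _; by rewrite B0 mul0r.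
Qed.

(** Every entry is of degree at most one in the variable of its column, and [dlin g] kills it at
    once if that variable lies outside [t]. So each term of the expansion survives at most one
    derivation per column in [t]. *)
Lemma annulled_mdet (g : 'I_n -> R) (t : 'I_n -> bool) a eps :
  (forall i, ~~ t i -> g i = 0) -> annulled g (\sum_i t (e i)).+1 (mdet a eps).
Proof.
move=> g0; rewrite /mdet /rowdet /determinant; apply: annulled_sum => s _.
rewrite mpolyC_sign mul_mpolyC; apply: annulledZ.
have -> : (\sum_i t (e i) = \sum_r t (e (s r)))%N by rewrite (reindex_perm s).
apply: annulled_prod => r; rewrite mxE; apply/annulled_dlin; rewrite dlin_entry.
case: (eps r); last exact: iter_dlin0.
case: (boolP (t (e (s r)))) => ti; last by rewrite /annulled /= g0 // mpolyC0 mulr0.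
by rewrite /annulled /= /colcst -rmorphXn -rmorphM dlinC.
Qed.

Lemma mdet_homog a eps : mdet a eps \is (\sum_r eps r)%N.-homog.
Proof.
rewrite /mdet /rowdet /determinant rpred_sum // => s _.
rewrite mpolyC_sign mul_mpolyC rpredZ //.
elim/big_rec2: _ => [|r d p _ hp]; first exact: dhomog1.
apply: dhomogM => //; rewrite mxE /colcst -rmorphXn mul_mpolyC rpredZ //.
by case: (eps r); rewrite ?expr0 ?dhomog1 // expr1 dhomogX /= mdeg1.
Qed.

End RowDetDeriv.

(* The rows are, in decreasing order, the monomials
   [c ^ s, c ^ (s - 1) X, c ^ (s - 1), c ^ (s - 2) X, ...], where [s = m./2]. *)
Definition sec_exp m (r : 'I_m) : nat := (m./2 - uphalf r)%N.
Definition sec_odd m (r : 'I_m) : bool := odd r.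

Definition secant (A : comNzRingType) m (c X : 'I_m -> A) : A :=
  rowdet (@sec_exp m) (@sec_odd m) c X.

Lemma sum_sec_odd m : (\sum_(r < m) sec_odd r = m./2)%N.
Proof.
elim: m => [|m IH]; first by rewrite big_ord0.
rewrite big_ord_recr /=; move: IH; rewrite /sec_odd /= => ->; lia.
Qed.

Section SecantDeriv.

Variables (R : comNzRingType) (n m : nat) (c : 'I_n -> R) (e : 'I_m -> 'I_n).

Notation G := (mdet c e (@sec_exp m) (@sec_odd m)).

(** Differentiation turns the row [c ^ a * X] into [c ^ (a + 1)], the row just above it. *)
Lemma dlin_c_secant : dlin c G = 0.
Proof.
rewrite dlin_c_mdet big1 // => r; rewrite /sec_odd => odd_r.
have lt_r : (r.-1 < m)%N by have := ltn_ord r; lia.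
apply: (@rowdet_alt _ _ _ _ _ _ r (Ordinal lt_r)).
- by rewrite -val_eqE /=; lia.
- rewrite /upd eqxx; have -> : (Ordinal lt_r == r) = false by rewrite -val_eqE /=; lia.
  by have := ltn_ord r; rewrite /sec_exp /=; lia.
- rewrite /upd eqxx; have -> : (Ordinal lt_r == r) = false by rewrite -val_eqE /=; lia.
  by rewrite /sec_odd /=; lia.
Qed.

(** An odd row that has lost its [X] coincides with the row just below it. *)
Lemma mdet_upd_eq0 (eps : 'I_m -> bool) (r : 'I_m) : odd r -> (r.+1 < m)%N ->
  ~~ eps r -> (forall r' : 'I_m, ~~ odd r' -> ~~ eps r') ->
  mdet c e (@sec_exp m) eps = 0.
Proof.
move=> odd_r lt_r er ev.
apply: (@rowdet_alt _ _ _ _ _ _ r (Ordinal lt_r)).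
- by rewrite -val_eqE /=; lia.
- by rewrite /sec_exp /=; lia.
- by rewrite (negbTE er); apply/esym/negbTE/ev => /=; rewrite odd_r.
Qed.

Lemma upd_even (eps : 'I_m -> bool) r : (forall r' : 'I_m, ~~ odd r' -> ~~ eps r') ->
  forall r' : 'I_m, ~~ odd r' -> ~~ upd eps r false r'.
Proof. by move=> ev r' r'e; rewrite /upd; case: eqP => // _; apply: ev. Qed.

(** In even size the last row has no row below it, so one derivation may survive there; a second one
    must strip another odd row, which does have a row below. *)
Lemma annulled_1_secant : annulled (fun=> 1) (~~ odd m).+1 G.
Proof.
have ev0 (r : 'I_m) : ~~ odd r -> ~~ sec_odd r by [].
case: (boolP (odd m)) => m_odd; rewrite /annulled /= dlin_1_mdet.
  rewrite big1 // => r r_odd; apply: (@mdet_upd_eq0 _ r) => //.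
  - by have := ltn_ord r; rewrite /sec_odd in r_odd; lia.
  - by rewrite /upd eqxx.
  - exact: upd_even.
rewrite linear_sum big1 // => r r_odd /=; rewrite dlin_1_mdet big1 // => r'.
rewrite {1}/upd; case: eqP => // /eqP rr' r'_odd.
have ev := upd_even r' (upd_even r ev0).
have [lt_r|ge_r] := ltnP r.+1 m.
  by apply: (@mdet_upd_eq0 _ r) => //; rewrite /upd eqxx; case: ifP.
apply: (@mdet_upd_eq0 _ r') => //; last by rewrite /upd eqxx.
have := ltn_ord r'; move: rr'; rewrite -val_eqE /=; have := ltn_ord r; lia.
Qed.

End SecantDeriv.

Section Leading.

Variables (k : idomainType) (N m : nat).
Variables (vc vX : 'I_m -> 'I_N).
Hypothesis vcX : forall i, (vc i < vX i)%N.
Hypothesis vXc : forall i j : 'I_m, (i < j)%N -> (vX i < vc j)%N.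

Definition sec_mon (s : {perm 'I_m}) : 'X_{1..N} :=
  (\sum_(r < m) (U_(vc (s r)) *+ sec_exp r + U_(vX (s r)) *+ sec_odd r))%MM.

Lemma vc_inj i j : (vc i == vc j) = (i == j).
Proof.
apply/eqP/eqP => [/(congr1 val) /= E|-> //]; move: (vcX i) (vcX j).
by have [/vXc|/vXc|/val_inj //] := ltngtP i j; lia.
Qed.

Lemma vX_inj i j : (vX i == vX j) = (i == j).
Proof.
apply/eqP/eqP => [/(congr1 val) /= E|-> //]; move: (vcX i) (vcX j).
by have [/vXc|/vXc|/val_inj //] := ltngtP i j; lia.
Qed.

Lemma vcX_neq i j : (vc i == vX j) = false.
Proof.
apply/eqP => /(congr1 val) /=; have := vcX i; have := vcX j.
have [/vXc|/vXc|/val_inj ->] := ltngtP i j; lia.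
Qed.

Lemma vXc_neq i j : (vX i == vc j) = false.
Proof. by rewrite eq_sym vcX_neq. Qed.

Lemma perm_neq (s : {perm 'I_m}) r i : r != (s^-1)%g i -> (s r == i) = false.
Proof. by move=> ri; rewrite (canF_eq (permK s)) (negbTE ri). Qed.

Lemma sec_mon_vc s i : sec_mon s (vc i) = sec_exp ((s^-1)%g i).
Proof.
rewrite /sec_mon mnm_sumE (bigD1 ((s^-1)%g i)) //= big1 => [|r /perm_neq ri].
  by rewrite addn0 mnmDE !mulmnE !mnm1E permKV eqxx vXc_neq mul1n mul0n addn0.
by rewrite mnmDE !mulmnE !mnm1E vc_inj vXc_neq ri.
Qed.

Lemma sec_mon_vX s i : sec_mon s (vX i) = sec_odd ((s^-1)%g i).
Proof.
rewrite /sec_mon mnm_sumE (bigD1 ((s^-1)%g i)) //= big1 => [|r /perm_neq ri].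
  by rewrite addn0 mnmDE !mulmnE !mnm1E permKV eqxx vcX_neq mul1n mul0n add0n.
by rewrite mnmDE !mulmnE !mnm1E vX_inj vcX_neq ri.
Qed.

Lemma sec_mon_out s (v : 'I_N) : (forall i, v != vc i) -> (forall i, v != vX i) ->
  sec_mon s v = 0%N.
Proof.
move=> vnc vnX; rewrite /sec_mon mnm_sumE big1 // => r _.
by rewrite mnmDE !mulmnE !mnm1E eq_sym (negbTE (vnc _)) eq_sym (negbTE (vnX _)).
Qed.

Lemma mdeg_sec_mon s : mdeg (sec_mon s) = (\sum_(r < m) (sec_exp r + sec_odd r))%N.
Proof.
rewrite /sec_mon mdeg_sum; apply: eq_bigr => r _.
by rewrite mdegD !mdegMn !mdeg1 !mul1n.
Qed.

(** The rows decrease and the pairs [(c_i, X_i)] come in order of significance. At the first column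
    moved by [s] a later row is used, which lowers the exponent of [c_i] or, if that is unchanged,
    the exponent of [X_i]. *)
Lemma sec_mon_lt s : s != 1%g -> (sec_mon s < sec_mon 1)%O.
Proof.
move=> s1; pose t := (s^-1)%g.
have [i0 ti0] : exists i, t i != i.
  apply/existsP; move: s1; apply: contraR; rewrite negb_exists => /forallP t1.
  rewrite -(inj_eq (@invg_inj _)) invg1; apply/eqP/permP => i.
  by rewrite perm1; apply/eqP; have := t1 i; rewrite negbK.
pose i := [arg min_(i < i0 | t i != i) (i : nat)].
have [ti imin] : t i != i /\ forall j : 'I_m, (j < i)%N -> t j = j.
  rewrite /i; case: arg_minnP => // i1 ti1 min1; split=> // j lt_j.
  by apply/eqP; apply: contraLR lt_j => /min1; rewrite leqNgt.
have lt_i : (i < t i)%N.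
  rewrite ltn_neqAle eq_sym [X in X && _]ti leqNgt /=; apply/negP => lt.
  by have /perm_inj E := imin _ lt; move: lt; rewrite E ltnn.
have eq_below (v : 'I_N) : (v < vc i)%N -> sec_mon s v = sec_mon 1 v.
  move=> lt_v.
  have [[j /eqP vj]|nc] := altP (existsP (P := fun j => v == vc j)).
    rewrite vj !sec_mon_vc invg1 perm1 -/t imin //.
    move: lt_v; rewrite vj; have [//|/vXc|/val_inj ->] := ltngtP j i; [|lia].
    have := vcX i; lia.
  have [[j /eqP vj]|nX] := altP (existsP (P := fun j => v == vX j)).
    rewrite vj !sec_mon_vX invg1 perm1 -/t imin //.
    move: lt_v; rewrite vj; have [//|/vXc|/val_inj ->] := ltngtP j i.
      by have := vcX i; have := vcX j; lia.
    by have := vcX i; lia.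
  rewrite negb_exists in nc; rewrite negb_exists in nX.
  by rewrite !sec_mon_out //; [exact/forallP|exact/forallP|exact/forallP|exact/forallP].
apply/ltmcP; first by rewrite !mdeg_sec_mon.
have := sec_mon_vc s i; have := sec_mon_vc 1 i.
have := sec_mon_vX s i; have := sec_mon_vX 1 i.
rewrite invg1 !perm1 -/t => X1 Xs c1 cs.
have [lt_e|ge_e] := ltnP (sec_exp (t i)) (sec_exp i).
  by exists (vc i) => //; rewrite cs c1.
have := ltn_ord (t i).
(* Equal exponents of [c_i] force [i] odd and [t i = i + 1], so the exponent of [X_i] drops from 1
   to 0. *)
exists (vX i); last by rewrite Xs X1; move: ge_e; rewrite /sec_exp /sec_odd; lia.
move=> v lt_v; have [/eq_below //|gt_v|/val_inj ->] := ltngtP v (vc i); last first.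
  by rewrite cs c1; move: ge_e; rewrite /sec_exp; lia.
rewrite !sec_mon_out // => j; apply/negP => /eqP vE.
all: move: lt_v gt_v; rewrite vE; have := vcX i; have := vcX j.
all: by have [/vXc|/vXc|/val_inj ->] := ltngtP i j; lia.
Qed.

Definition sec_poly : {mpoly k[N]} := secant (fun i => 'X_(vc i)) (fun i => 'X_(vX i)).

Lemma sec_polyE : sec_poly = \sum_(s : {perm 'I_m}) (-1) ^+ s *: 'X_[sec_mon s].
Proof.
rewrite /sec_poly /secant /rowdet /determinant; apply: eq_bigr => s _.
rewrite mpolyC_sign mul_mpolyC; congr (_ *: _).
rewrite /sec_mon -mprodXE; apply: eq_bigr => r _.
by rewrite mxE mpolyXD !mpolyXn.
Qed.

Lemma mlead_sec_poly : mlead sec_poly = sec_mon 1 /\ sec_poly != 0.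
Proof.
have coef1 : sec_poly@_(sec_mon 1) = 1.
  rewrite sec_polyE raddf_sum (bigD1 1%g) //= mcoeffZ mcoeffX eqxx odd_perm1 mulr1 expr0.
  rewrite big1 ?addr0 // => s /sec_mon_lt lt; rewrite mcoeffZ mcoeffX.
  by rewrite (lt_eqF lt) mulr0.
have nz : sec_poly != 0.
  by apply/eqP => E; move: coef1; rewrite E mcoeff0 => /esym/eqP; rewrite oner_eq0.
split=> //; apply/le_anti/andP; split; last first.
  by apply: msupp_le_mlead; rewrite mcoeff_msupp coef1 oner_neq0.
have := mlead_supp nz; rewrite mcoeff_msupp => lead_nz; rewrite leNgt; apply/negP => lt.
move: lead_nz lt; move: (mlead _) => M /eqP lead_nz lt.
case: lead_nz; rewrite sec_polyE raddf_sum big1 //= => s _; rewrite mcoeffZ mcoeffX.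
have le : (sec_mon s <= sec_mon 1)%O.
  by have [->|/sec_mon_lt/ltW] := eqVneq s 1%g.
by rewrite (lt_eqF (le_lt_trans le lt)) mulr0.
Qed.

End Leading.

(** * Lower bounds for cokernels *)

Section InverseSystem.

Variables (k : fieldType) (n d : nat).
Hypothesis char_k : [pchar k] =i pred0.

Notation N := #|{ffun 'I_n -> 'I_d}|.
Notation emon := (@emon n d).
Implicit Types (G : {mpoly k[n]}) (c : 'I_n -> k) (m : 'X_{1..n}).

Definition mfact m : nat := \prod_(i < n) (m i)`!.

Lemma mfactU m i : mfact (m + U_(i))%MM = (mfact m * (m i).+1)%N.
Proof.
rewrite /mfact (bigD1 i) //= [in RHS](bigD1 i) //= mnmDE mnm1E eqxx addn1 factS.
rewrite [((m i).+1 * _)%N]mulnC mulnAC; congr (_ * _)%N; congr (_ * _)%N.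
by apply: eq_bigr => l /negbTE li; rewrite mnmDE mnm1E eq_sym li addn0.
Qed.

(* The factorials turn contraction by a monomial into differentiation. *)
Definition invsys G : 'cV[k]_N := \col_s ((mfact (emon s))%:R * G@_(emon s)).

Definition supp_bounded G : Prop := forall m, ~~ bounded d m -> G@_m = 0.

Lemma mcoeff_dlin c G m : (dlin c G)@_m = \sum_(i < n) c i * (G@_(m + U_(i)) *+ (m i).+1).
Proof.
rewrite /dlin raddf_sum; apply: eq_bigr => i _ /=.
by rewrite mcoeffZ mcoeff_deriv.
Qed.

Lemma supp_bounded_dlin c G : supp_bounded G -> supp_bounded (dlin c G).
Proof.
move=> Gb m mb; rewrite mcoeff_dlin big1 // => i _; rewrite Gb ?mul0rn ?mulr0 //.
by apply: contra mb; apply: bounded_addU.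
Qed.

Lemma mulX_invsys c G : supp_bounded G -> mulX d c *m invsys G = invsys (dlin c G).
Proof.
move=> Gb; apply/colP => s; rewrite !mxE mcoeff_dlin mulr_sumr.
under eq_bigr => t _ do rewrite !mxE mulr_suml.
rewrite exchange_big; apply: eq_bigr => i _ /=.
under eq_bigr => t _ do rewrite -mulrA.
rewrite -mulr_sumr (sum_emon _ _ (fun m => (mfact m)%:R * G@_m)) /= [RHS]mulrCA; congr (_ * _).
have [b|/Gb ->] := boolP (bounded _ _); last by rewrite mul0rn !mulr0.
by rewrite mul1r mfactU natrM -mulrA [in LHS](mulr_natl G@__).
Qed.

Lemma invsys0 : invsys 0 = 0.
Proof. by apply/colP => s; rewrite !mxE mcoeff0 mulr0. Qed.

Lemma mulL_invsys G : supp_bounded G -> annulled (fun=> 1) d G -> mulL k n d *m invsys G = 0.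
Proof.
rewrite /annulled /mulL => Gb Gd.
suff H e G' : supp_bounded G' ->
    mulX d (fun=> 1) ^+ e *m invsys G' = invsys (iter e (dlin (fun=> 1)) G').
  by rewrite H // Gd invsys0.
elim: e G' => [|e IH] G' G'b; first by rewrite expr0 mul1mx.
rewrite exprSr -[_ * _]/(_ *m _) -mulmxA mulX_invsys // IH ?iterSr //.
exact: supp_bounded_dlin.
Qed.

Lemma degmx_invsys G j : G \is j.-homog -> degmx k n d j *m invsys G = invsys G.
Proof.
move=> Gj; apply/colP => s; rewrite degmx_diag mul_diag_mx !mxE.
case: eqP => [_|/eqP sj]; first by rewrite mul1r.
by rewrite (dhomog_nemf_coeff Gj sj) !mulr0.
Qed.

Lemma mcoeff_iter_dlin l e G m :
  (iter e (dlin (fun i => (i == l)%:R)) G)@_m = G@_(m + U_(l) *+ e) *+ ((m l + e) ^_ e).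
Proof.
elim: e m => [|e IH] m; first by rewrite mulm0n addm0 addn0 ffactn0.
rewrite iterS mcoeff_dlin (bigD1 l) //= eqxx mul1r big1 ?addr0 => [|i /negbTE ->]; last by rewrite mul0r.
rewrite IH -addmA -mulmS mnmDE mnm1E eqxx -mulrnA addn1 addSnnS; congr (_ *+ _).
by rewrite ffactnSr; congr (_ * _)%N; lia.
Qed.

(** In characteristic zero the falling factorial is nonzero, so the d-th derivative in one variable
    detects every exponent [>= d]. *)
Lemma annulled_supp_bounded G : (forall l, annulled (fun i => (i == l)%:R) d G) -> supp_bounded G.
Proof.
move=> Gn m; rewrite negb_forall => /existsP[l]; rewrite -leqNgt => le_d.
have := congr1 (mcoeff (m - U_(l) *+ d)) (Gn l); rewrite mcoeff_iter_dlin mcoeff0 submK.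
  move/eqP; rewrite -mulr_natr mulf_eq0 (natr_char0_eq0 char_k) => /orP[/eqP //|].
  by rewrite mnmBE mulmnE mnm1E eqxx mul1n subnK // -leqn0 leqNgt ffact_gt0 le_d.
by apply/mnm_lepP => i; rewrite mulmnE mnm1E; case: eqP => [<-|_]; rewrite ?mul1n.
Qed.

Lemma invsys_is_linear : linear invsys.
Proof.
by move=> a F G; apply/colP => s; rewrite !mxE mcoeffD mcoeffZ mulrDr mulrCA.
Qed.
HB.instance Definition _ := GRing.isLinear.Build k _ _ _ invsys invsys_is_linear.

Lemma mfact_neq0 m : (mfact m)%:R != 0 :> k.
Proof.
rewrite (natr_char0_eq0 char_k) -lt0n; apply: prodn_gt0 => i; exact: fact_gt0.
Qed.

Lemma invsys_eq0 G : supp_bounded G -> invsys G = 0 -> G = 0.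
Proof.
move=> Gb G0; apply/mpolyP => m; rewrite mcoeff0.
have [/emon_surj[s <-]|/Gb //] := boolP (bounded d m).
move/colP/(_ s): G0; rewrite !mxE => /eqP; rewrite mulf_eq0 (negbTE (mfact_neq0 _)) /=.
by move/eqP.
Qed.

Lemma le_coker_forms c j f (G : 'I_f -> {mpoly k[n]}) :
  (forall w, G w \is j.-homog) -> (forall w, dlin c (G w) = 0) ->
  (forall w, annulled (fun=> 1) d (G w)) -> (forall w, supp_bounded (G w)) ->
  (forall u : 'I_f -> k, \sum_w u w *: G w = 0 -> forall w, u w = 0) ->
  (f <= coker d c j)%N.
Proof.
move=> Gj Gc GL Gb Gfree.
pose F : 'M[k]_(N, f) := \matrix_(s, w) invsys (G w) s 0.
have mulF (A : 'M[k]_N) (H : 'I_f -> 'cV[k]_N) : (forall w, A *m invsys (G w) = H w) ->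
    A *m F = \matrix_(s, w) H w s 0.
  move=> AH; apply/matrixP => s w; rewrite [RHS]mxE -AH !mxE.
  by apply: eq_bigr => t _; rewrite !mxE.
apply: (@le_coker _ _ _ c j f F).
- rewrite (mulF _ (fun=> 0)) => [|w]; first by apply/matrixP => s w; rewrite !mxE.
  by rewrite mulX_invsys // Gc invsys0.
- rewrite (mulF _ (fun=> 0)) => [|w]; first by apply/matrixP => s w; rewrite !mxE.
  by rewrite mulL_invsys.
- by rewrite (mulF _ (fun w => invsys (G w))) // => w; apply: degmx_invsys.
- apply/eqP; rewrite -mxrank_tr -[_ == _]/(row_free _) -kermx_eq0.
  apply/rowV0P => u /sub_kermxP uF; apply/rowP => w; rewrite mxE.
  apply: (Gfree (fun w => u 0 w)); apply: invsys_eq0 => [m mb|].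
    by rewrite raddf_sum big1 // => v _; rewrite /= mcoeffZ Gb ?mulr0.
  rewrite linear_sum; apply/colP => s; rewrite summxE mxE.
  transitivity ((u *m F^T) 0 s); last by rewrite uF mxE.
  by rewrite mxE; apply: eq_bigr => v _; rewrite /= linearZ !mxE.
Qed.

End InverseSystem.

Lemma frac_denominator (R : idomainType) (x : {fraction R}) :
  exists2 a : R, a != 0 & exists b : R, tofrac a * x = tofrac b.
Proof.
elim/quotW: x => y; exists (frac y).2; first exact: denom_ratioP.
exists (frac y).1; apply/eqP.
rewrite -[X in X == _]/(FracField.mul (FracField.tofrac _) _) !piE.
by rewrite /FracField.equivf /FracField.mulf !numden_Ratio ?mulr1 ?mul1r ?oner_eq0 ?denom_ratioP.
Qed.

Lemma frac_common_denominator (R : idomainType) f (u : 'I_f -> {fraction R}) :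
  exists2 a : R, a != 0 & exists v : 'I_f -> R, forall w, tofrac a * u w = tofrac (v w).
Proof.
elim: f u => [|f IH] u.
  by exists 1; [exact: oner_neq0 | exists (fun=> 0) => -[]].
have [a a0 [v va]] := IH (fun w => u (lift ord0 w)).
have [b b0 [x xb]] := frac_denominator (u ord0).
exists (a * b); first by rewrite mulf_neq0.
exists (fun w => if unlift ord0 w is Some w' then b * v w' else a * x) => w.
case: (unliftP ord0 w) => [w' ->|->]; rewrite !tofracM; last by rewrite -mulrA xb.
by rewrite [tofrac a * _]mulrC -mulrA va.
Qed.

Lemma enum_val_lt n (C : {set 'I_n}) (i j : 'I_#|C|) : (i < j)%N -> (enum_val i < enum_val j)%N.
Proof.
move=> lt_ij; have srt : sorted ltn (map val (enum C)).
  apply: (subseq_sorted ltn_trans _ (iota_ltn_sorted 0 n)).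
  by rewrite -val_enum_ord map_subseq // enumT; exact: filter_subseq.
have szC : size (enum C) = #|C| by rewrite -cardE.
have x0 := enum_val i.
rewrite (enum_val_nth x0) (enum_val_nth x0 j).
have := sorted_ltn_nth ltn_trans 0%N srt i j; rewrite !inE size_map szC !ltn_ord => /(_ isT isT lt_ij).
by rewrite !(nth_map x0) ?szC.
Qed.

Lemma enum_val_rank n (C : {set 'I_n}) (r : 'I_#|C|) :
  (r : nat) = (\sum_(i in C) (i < enum_val r))%N.
Proof.
rewrite big_enum_val /=.
have -> : (\sum_(s < #|C|) (enum_val s < enum_val r) = \sum_(s < #|C|) (s < r))%N.
  apply: eq_bigr => s _; congr nat_of_bool.
  by have [/enum_val_lt -> //|/enum_val_lt|/val_inj ->] := ltngtP s r; rewrite ?ltnn // => lt; apply/negbTE; rewrite -leqNgt ltnW.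
have H m x : (\sum_(s < m) (s < x)%N = minn m x)%N.
  elim: m => [|m IH]; first by rewrite big_ord0 min0n.
  by rewrite big_ord_recr /= IH; case: ltnP => /=; lia.
by rewrite H; apply/esym/minn_idPr/ltnW.
Qed.

Section SetFamily.

Variables (n M : nat) (B : 'I_n -> {set 'I_M}).

(** The sets of indices are given through the transposed incidence [B], because a word chooses,
    index by index, the sets that contain it. *)
Definition memb (q : 'I_M) : {set 'I_n} := [set i | q \in B i].

Definition memb_enum q (r : 'I_#|memb q|) : 'I_n := enum_val r.

Definition secprod (A : comNzRingType) (c X : 'I_n -> A) : A :=
  \prod_(q < M) secant (c \o @memb_enum q) (X \o @memb_enum q).

Lemma rmorph_secprod (A A' : comNzRingType) (f : {rmorphism A -> A'}) c X :
  f (secprod c X) = secprod (f \o c) (f \o X).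
Proof. by rewrite rmorph_prod; apply: eq_bigr => q _; rewrite rmorph_rowdet. Qed.

Lemma eq_secprod (A : comNzRingType) (c c' X X' : 'I_n -> A) : c =1 c' -> X =1 X' ->
  secprod c X = secprod c' X'.
Proof.
by move=> cE XE; apply: eq_bigr => q _; apply: eq_rowdet => // i /=; rewrite ?cE ?XE.
Qed.

Lemma memb_rank q (r : 'I_#|memb q|) :
  (r : nat) = (\sum_(i < n | (i < memb_enum r)%N) (q \in B i))%N.
Proof.
rewrite {1}enum_val_rank big_mkcond [RHS]big_mkcond /=; apply: eq_bigr => i _.
by rewrite inE; case: ifP; case: ifP => //.
Qed.

(* The exponent of [X_i] in the leading monomial of [secprod]. *)
Definition word_of (i : 'I_n) : nat :=
  #|[set q in B i | odd (\sum_(i' < n | (i' < i)%N) (q \in B i'))]|.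

Section OverField.

Variables (R : comNzRingType) (c : 'I_n -> R).

Definition secform : {mpoly R[n]} := secprod (fun i => (c i)%:MP) (fun i => 'X_i).

Lemma dlin_secform : dlin c secform = 0.
Proof.
have := @annulled_prod _ _ c _ (index_enum 'I_M) (fun q => mdet c (@memb_enum q) (@sec_exp _) (@sec_odd _)) (fun=> 0%N).
rewrite big1_eq; apply=> q; exact: dlin_c_secant.
Qed.

Lemma annulled_1_secform : annulled (fun=> 1) (\sum_(q < M) ~~ odd #|memb q|).+1 secform.
Proof.
apply: (@annulled_prod _ _ _ _ _ (fun q => mdet c (@memb_enum q) (@sec_exp _) (@sec_odd _))) => q.
exact: annulled_1_secant.
Qed.

Lemma annulled_delta_secform l : annulled (fun i => (i == l)%:R) (#|B l|).+1 secform.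
Proof.
have -> : #|B l| = (\sum_(q < M) \sum_(r < #|memb q|) (memb_enum r == l))%N.
  rewrite -sum1_card big_mkcond; apply: eq_bigr => q _ /=.
  rewrite -(big_enum_val (A := mem (memb q)) (fun i => (i == l : nat))) /=.
  rewrite big_mkcond (bigD1 l) //= inE eqxx big1 ?addn0 => [|i /negbTE ->]; last by case: ifP.
  by case: ifP.
apply: (@annulled_prod _ _ _ _ _ (fun q => mdet c (@memb_enum q) (@sec_exp _) (@sec_odd _))) => q.
by apply: (@annulled_mdet _ _ _ _ _ _ (fun i => i == l)) => i /negbTE ->.
Qed.

Lemma secform_homog : secform \is (\sum_(q < M) (#|memb q|)./2)%N.-homog.
Proof.
rewrite /secform /secprod; elim/big_rec2: _ => [|q j p _ hp]; first exact: dhomog1.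
apply: dhomogM => //; rewrite -sum_sec_odd; exact: mdet_homog.
Qed.

End OverField.

End SetFamily.

(** Distinct leading monomials cannot cancel, so the largest one survives in the sum. *)
Lemma sum_neq0_mlead (R : idomainType) n (T : eqType) (F : T -> {mpoly R[n]}) (r : seq T) :
  r != [::] -> uniq [seq mlead (F x) | x <- r] -> (forall x, x \in r -> F x != 0) ->
  \sum_(x <- r) F x != 0 /\ mlead (\sum_(x <- r) F x) \in [seq mlead (F x) | x <- r].
Proof.
elim: r => // x [|y r] IH _.
  by move=> _ nz; rewrite big_seq1 mem_seq1 eqxx nz ?mem_head.
rewrite map_cons cons_uniq => /andP[xr ur] nz.
have [|nz' lead] := IH isT ur; first by move=> z zr; rewrite nz // in_cons zr orbT.
rewrite big_cons; set G := \sum_(_ <- _) _ in nz' lead *.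
have ne : mlead (F x) != mlead G by apply: contraNneq xr => ->.
split.
  apply: contraNneq ne => /eqP; rewrite addr_eq0 => /eqP ->; by rewrite mleadN.
rewrite mleadD //; case: (leP (mlead (F x)) (mlead G)) => _; last exact: mem_head.
by rewrite in_cons lead orbT.
Qed.

(** * Independence for indeterminate coefficients *)

Section Generic.

Variables (k : idomainType) (n : nat).

Lemma ord_c_subproof (i : 'I_n) : (i.*2 < n.*2)%N.
Proof. by rewrite ltn_double. Qed.
Lemma ord_X_subproof (i : 'I_n) : (i.*2.+1 < n.*2)%N.
Proof. by have := ltn_ord i; lia. Qed.

(** Interleaving puts [c_i] before [X_i] and both before all later pairs, as the leading term of a
    secant determinant requires. *)
Definition ord_c i : 'I_n.*2 := Ordinal (ord_c_subproof i).
Definition ord_X i : 'I_n.*2 := Ordinal (ord_X_subproof i).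

Notation R0 := {mpoly k[n]}.
Notation A0 := {mpoly k[n.*2]}.

Definition secprod_lead M (B : 'I_n -> {set 'I_M}) : A0 :=
  secprod B (fun i => 'X_(ord_c i)) (fun i => 'X_(ord_X i)).

Lemma mlead_secprod M (B : 'I_n -> {set 'I_M}) :
  secprod_lead B != 0 /\ forall i, mlead (secprod_lead B) (ord_X i) = word_of B i.
Proof.
pose vc q (r : 'I_#|memb B q|) := ord_c (memb_enum r).
pose vX q (r : 'I_#|memb B q|) := ord_X (memb_enum r).
have vcX q (r : 'I_#|memb B q|) : (vc q r < vX q r)%N by [].
have vXc q (r s : 'I_#|memb B q|) : (r < s)%N -> (vX q r < vc q s)%N.
  by move/enum_val_lt; rewrite /vX /vc /= -doubleS leq_double.
have lead q := mlead_sec_poly k (vcX q) (vXc q).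
have E : secprod_lead B = \prod_q sec_poly k (vc q) (vX q) by [].
have nz : secprod_lead B != 0 by rewrite E; apply/prodf_neq0 => q _; case: (lead q).
split=> // i; rewrite E mlead_prod_proper => [|q _ _]; last first.
  by apply/lregP; rewrite mleadc_eq0; case: (lead q).
rewrite mnm_sumE /word_of -sum1_card [RHS]big_mkcond; apply: eq_bigr => q _ /=.
have [-> _] := lead q; rewrite inE; case: (boolP (q \in B i)) => [qi|nqi] /=; last first.
  apply: sec_mon_out => r; apply/eqP => /(congr1 val) /= E'; first by lia.
  have : (memb_enum r) \in memb B q by apply: enum_valP.
  have -> : memb_enum r = i by apply/val_inj => /=; lia.
  by rewrite inE (negbTE nqi).
have iC : i \in memb B q by rewrite inE.
pose r := enum_rank_in iC i.
have ri : memb_enum r = i by rewrite /memb_enum enum_rankK_in.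
have -> : ord_X i = vX q r by rewrite /vX ri.
rewrite (sec_mon_vX (vcX q) (vXc q)) invg1 perm1 /sec_odd.
by rewrite {1}memb_rank ri; case: odd.
Qed.

Definition rename_c : {rmorphism R0 -> A0} := mmap (@mpolyC _ k) (fun i => 'X_(ord_c i)).

Lemma rename_cX i : rename_c 'X_i = 'X_(ord_c i).
Proof. by rewrite /rename_c /= mmapX mmap1U. Qed.

Lemma rename_cE p : rename_c p =
  \sum_(m <- msupp p) p@_m *: 'X_[\sum_(i < n) U_(ord_c i) *+ m i].
Proof.
rewrite /rename_c /= /mmap; apply: eq_bigr => m _; rewrite mul_mpolyC /mmap1.
by rewrite -mprodXnE.
Qed.

Definition unname_c : {rmorphism A0 -> R0} :=
  mmap (@mpolyC _ k) (fun t : 'I_n.*2 => if insub (t./2) is Some i then 'X_i else 0).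

Lemma rename_cK : cancel rename_c unname_c.
Proof.
move=> p; apply: (@mpoly_rmorph_eq _ _ _ (unname_c \o rename_c) idfun) => [c|i] /=.
  by rewrite /unname_c /= mmapC mmapC.
rewrite -[mmap _ _ 'X_i]/(rename_c 'X_i) rename_cX mmapX mmap1U /= doubleK.
by rewrite valK.
Qed.

Definition split_cX : {rmorphism {mpoly R0[n]} -> A0} :=
  mmap rename_c (fun i => 'X_(ord_X i)).

Lemma split_cX_secprod M (B : 'I_n -> {set 'I_M}) :
  split_cX (secform B (fun i => 'X_i)) = secprod_lead B.
Proof.
rewrite /secform rmorph_secprod; apply: eq_secprod => i /=.
  by rewrite mmapC -rename_cX.
by rewrite mmapX mmap1U.
Qed.

Lemma mlead_rename_c p i : mlead (rename_c p) (ord_X i) = 0%N.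
Proof.
have [->|nz] := eqVneq (rename_c p) 0; first by rewrite mlead0 mnm0E.
have := mlead_supp nz; move: (mlead _) => m; rewrite mcoeff_msupp rename_cE raddf_sum /=.
apply: contraNeq => mi; rewrite big1 // => m' _; rewrite mcoeffZ mcoeffX.
case: eqP => [E|_]; last by rewrite mulr0.
move: mi; rewrite -E mnm_sumE big1 // => l _; rewrite mulmnE mnm1E.
by case: eqP => // /(congr1 val) /=; lia.
Qed.

(* The leading monomials of [secform (B w)] stay distinct after multiplication
   by coefficients in [c], which only involve the other variables. *)
Lemma secform_free M f (B : 'I_f -> 'I_n -> {set 'I_M}) (v : 'I_f -> R0) :
  (forall w w', (forall i, word_of (B w) i = word_of (B w') i) -> w = w') ->
  \sum_w v w *: secform (B w) (fun i => 'X_i) = 0 -> forall w, v w = 0.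
Proof.
move=> B_inj /(congr1 split_cX); rewrite rmorph0 rmorph_sum /= => sum0.
have {}sum0 : \sum_w rename_c (v w) * secprod_lead (B w) = 0.
  rewrite -[RHS]sum0; apply: eq_bigr => w _.
  by rewrite mmapZ -split_cX_secprod.
pose S := [seq w <- index_enum 'I_f | v w != 0].
have nz w : v w != 0 -> rename_c (v w) * secprod_lead (B w) != 0.
  move=> vw; rewrite mulf_neq0 //; last by case: (mlead_secprod (B w)).
  by apply: contra vw => /eqP r0; rewrite -[v w]rename_cK r0 rmorph0.
have lead w i : v w != 0 -> mlead (rename_c (v w) * secprod_lead (B w)) (ord_X i) = word_of (B w) i.
  move=> vw; have := nz w vw; rewrite mulf_eq0 negb_or => /andP[r0 s0].
  rewrite mleadM_proper ?mulf_neq0 ?mleadc_eq0 // mnmDE mlead_rename_c.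
  by case: (mlead_secprod (B w)) => _ ->.
have := sum0; rewrite (bigID (fun w => v w != 0)) /= addrC big1 ?add0r => [|w]; last first.
  by rewrite negbK => /eqP ->; rewrite rmorph0 mul0r.
rewrite -big_filter -/S => sumS.
have uS : uniq [seq mlead (rename_c (v w) * secprod_lead (B w)) | w <- S].
  rewrite map_inj_in_uniq ?filter_uniq ?index_enum_uniq // => w w'.
  rewrite !mem_filter => /andP[vw _] /andP[vw' _] E; apply: B_inj => i.
  by rewrite -!lead // E.
have S0 : S = [::].
  apply/eqP; apply: contraT => Sn; have nzS w : w \in S -> rename_c (v w) * secprod_lead (B w) != 0.
    by rewrite mem_filter => /andP[/nz].
  by have [] := sum_neq0_mlead Sn uS nzS; rewrite sumS eqxx.
move=> w; apply/eqP; apply: contraT => vw.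
have : w \in S by rewrite mem_filter vw mem_index_enum.
by rewrite S0.
Qed.

End Generic.

Section BaseChange.

Variables (R S : comNzRingType) (f : {rmorphism R -> S}) (n d : nat).

Lemma map_mulX (c : 'I_n -> R) : map_mx f (mulX d c) = mulX d (f \o c).
Proof.
apply/matrixP => s t; rewrite !mxE rmorph_sum; apply: eq_bigr => i _ /=.
by rewrite rmorphM rmorph_nat.
Qed.

Lemma map_degmx j : map_mx f (degmx R n d j) = degmx S n d j.
Proof. by apply/matrixP => s t; rewrite !mxE rmorph_nat. Qed.

Lemma map_mulL : map_mx f (mulL R n d) = mulL S n d.
Proof.
have E : map_mx f (@mulX R n d (fun=> 1)) = @mulX S n d (fun=> 1).
  rewrite map_mulX; apply/matrixP => s t; rewrite !mxE.
  by apply: eq_bigr => i _ /=; rewrite rmorph1.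
suff H e : map_mx f (@mulX R n d (fun=> 1) ^+ e) = @mulX S n d (fun=> 1) ^+ e by exact: H.
elim: e => [|e IH]; first by rewrite !expr0 map_mx1.
by rewrite !exprS -![_ * _]/(_ *m _) map_mxM IH E.
Qed.

End BaseChange.

(** Specialising the indeterminates to [c] can only lower the rank of the image, while the graded
    pieces keep their dimension. *)
Lemma coker_specialize (k : fieldType) (n d j : nat) (c : 'I_n -> k) :
  (coker d (fun i => tofrac ('X_i : {mpoly k[n]})) j <= coker d c j)%N.
Proof.
pose R0 := {mpoly k[n]}.
have rP : \rank (degmx k n d j) = \rank (degmx {fraction R0} n d j).
  by rewrite !rank_degmx_card.
pose A := col_mx (mulX d (fun i => 'X_i : R0) *m degmx R0 n d j) (mulL R0 n d *m degmx R0 n d j).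
have := mxrank_specialize (meval c) A.
have imE (L : fieldType) (f : {rmorphism R0 -> L}) :
    \rank (image_mx d (fun i => f 'X_i) j) = \rank (map_mx f A).
  rewrite /image_mx addsmxE /A map_col_mx !map_mxM map_mulX map_mulL map_degmx.
  by [].
rewrite -!imE /coker rP => le.
have -> : image_mx d c j = image_mx d (fun i => meval c 'X_i) j.
  rewrite /image_mx; congr (_ *m _ + _)%MS; apply/matrixP => s t; rewrite !mxE.
  by apply: eq_bigr => i _; rewrite mevalXU.
exact: leq_sub2l.
Qed.

Section CokerBound.

Variables (k : fieldType) (n d : nat).
Hypothesis char_k : [pchar k] =i pred0.

Notation R0 := {mpoly k[n]}.
Notation K := {fraction R0}.

Lemma pchar_fraction : [pchar K] =i pred0.
Proof.
apply/pcharf0P => m.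
have -> : m%:R = tofrac (m%:R : R0) :> K by rewrite rmorph_nat.
rewrite tofrac_eq0 (_ : m%:R = (m%:R : k)%:MP) ?mpolyC_eq0 ?rmorph_nat //.
by move/pcharf0P: char_k => ->.
Qed.

Lemma map_secform M (B : 'I_n -> {set 'I_M}) :
  map_mpoly (@tofrac R0) (secform B (fun i => 'X_i)) = secform B (fun i => tofrac 'X_i).
Proof.
rewrite /secform rmorph_secprod; apply: eq_secprod => i /=.
  by rewrite map_mpolyC.
by rewrite map_mpolyX.
Qed.

Lemma coker_ge (c : 'I_n -> k) j lam M f (B : 'I_f -> 'I_n -> {set 'I_M}) :
  (0 < d)%N -> (M = lam + d.-1)%N -> (j.*2 + lam = n * d.-1)%N ->
  (forall w i, #|B w i| = d.-1) ->
  (forall w, \sum_(q < M) odd #|memb (B w) q| = lam)%N ->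
  (forall w w', (forall i, word_of (B w) i = word_of (B w') i) -> w = w') ->
  (f <= coker d c j)%N.
Proof.
move=> d_gt0 ME jE cardB oddB B_inj.
apply: leq_trans (coker_specialize _ _ _).
apply: (@le_coker_forms _ _ _ pchar_fraction _ _ _ (fun w => secform (B w) (fun i => tofrac 'X_i))).
- move=> w; have -> : j = (\sum_(q < M) (#|memb (B w) q|)./2)%N; last exact: secform_homog.
  have : (\sum_(q < M) #|memb (B w) q| = n * d.-1)%N.
    transitivity (\sum_(q < M) \sum_(i < n) (q \in B w i))%N.
      apply: eq_bigr => q _; rewrite -sum1_card big_mkcond; apply: eq_bigr => i _.
      by rewrite inE; case: ifP.
    rewrite exchange_big (eq_bigr (fun=> d.-1)) => [|i _] /=.
      by rewrite sum_nat_const card_ord.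
    by rewrite -(cardB w i) -sum1_card [RHS]big_mkcond; apply: eq_bigr => q _; case: ifP.
  have -> : (\sum_(q < M) #|memb (B w) q| = lam + (\sum_(q < M) (#|memb (B w) q|)./2).*2)%N.
    rewrite -(oddB w) -muln2 big_distrl -big_split /=; apply: eq_bigr => q _.
    by rewrite muln2 odd_double_half.
  lia.
- by move=> w; apply: dlin_secform.
(* Each even set adds one to the order of annihilation and each odd set adds nothing;
   [M - lam = d - 1] sets are even, so the order is [d]. *)
- move=> w; have := annulled_1_secform (B w) (fun i => tofrac ('X_i : R0)).
  apply: annulled_leq; have := oddB w.
  have : (\sum_(q < M) odd #|memb (B w) q| + \sum_(q < M) ~~ odd #|memb (B w) q| = M)%N.
    rewrite -big_split (eq_bigr (fun=> 1%N)) ?sum1_card ?card_ord //= => q _.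
    by case: odd.
  lia.
- move=> w; apply: (annulled_supp_bounded pchar_fraction) => l.
  have := annulled_delta_secform (B w) (fun i => tofrac ('X_i : R0)) l.
  by rewrite cardB prednK.
(* Clearing denominators turns the relation into one with polynomial coefficients in [c]. *)
- move=> u sum0 w; have [a a0 [v va]] := frac_common_denominator u.
  have v0 : forall w, v w = 0.
    apply: (secform_free B_inj); apply/mpolyP => m; rewrite mcoeff0.
    apply/eqP; rewrite -tofrac_eq0 -mcoeff_map_mpoly rmorph_sum; apply/eqP.
    transitivity ((tofrac a *: \sum_w u w *: secform (B w) (fun i => tofrac ('X_i : R0)))@_m).
      congr mcoeff; rewrite scaler_sumr; apply: eq_bigr => w' _ /=.
      by rewrite map_mpolyZ map_secform scalerA va.
    by rewrite sum0 scaler0 mcoeff0.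
  apply/eqP; have := va w; rewrite v0 rmorph0 => /eqP.
  by rewrite mulf_eq0 tofrac_eq0 (negbTE a0).
Qed.

End CokerBound.

Local Open Scope nat_scope.

(** * Words and the set families they encode *)

Section Words.

Variables (D M lam : nat).

(* A state [h] counts the sets that contain an odd number of the indices read
   so far; the next index belongs to [D] of the [M] sets, [x] of them odd. *)
Fixpoint valid_word (h : nat) (a : seq nat) : bool :=
  if a is x :: a' then
    [&& x <= h, x <= D, h + D <= M + x & valid_word (h - x + (D - x)) a']
  else h == lam.

Lemma subset_of_card (T : finType) (A : {set T}) m : m <= #|A| ->
  exists2 P : {set T}, P \subset A & #|P| = m.
Proof.
move=> le_m; exists [set x in take m (enum A)].
  by apply/subsetP => x; rewrite inE => /mem_take; rewrite mem_enum.
rewrite cardsE (card_uniqP _) ?take_uniq ?enum_uniq // size_take -cardE.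
by case: ltngtP le_m.
Qed.

(** Greedy choice: with [O] the sets met an odd number of times, the letter [x] picks [x] sets in
    [O] and [D - x] outside, as validity allows; then [O] changes by symmetric difference. *)
Lemma valid_word_sets a (O : {set 'I_M}) : valid_word #|O| a ->
  exists B : nat -> {set 'I_M},
    [/\ forall i, i < size a -> #|B i| = D,
        forall i, i < size a ->
          #|[set q in B i | (q \in O) (+) odd (\sum_(i' < i) (q \in B i'))]| = nth 0 a i
      & \sum_(q < M) ((q \in O) (+) odd (\sum_(i' < size a) (q \in B i'))) = lam].
Proof.
elim: a O => [|x a IH] O /=.
  move=> /eqP cardO; exists (fun=> set0); split=> //.
  rewrite -cardO -sum1_card [RHS]big_mkcond; apply: eq_bigr => q _.
  by rewrite big_ord0 addbF; case: ifP.
case/and4P => le_xh le_xD le_M val.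
have [P PO cardP] := subset_of_card le_xh.
have [Q QO cardQ] : exists2 Q : {set 'I_M}, Q \subset ~: O & #|Q| = D - x.
  by apply: subset_of_card; rewrite -(leq_add2l #|O|) cardsC card_ord; move: le_M le_xD; clear; move: #|O| => o; lia.
have inQ q : q \in Q -> q \notin O by move/(subsetP QO); rewrite inE.
have inP q : q \in P -> q \in O by exact/subsetP.
have PQ : P :&: Q = set0.
  by apply/setP => q; rewrite !inE; apply/andP => -[/inP qO /inQ]; rewrite qO.
pose O' := (O :\: P) :|: Q.
have O'E q : (q \in O') = (q \in O) (+) (q \in P :|: Q).
  rewrite !inE; have := inP q; have := inQ q.
  by case: (q \in P); case: (q \in Q); case: (q \in O) => //= h1 h2;
    first [by move: (h1 isT) | by move: (h2 isT)].
have cardO' : #|O'| = #|O| - x + (D - x).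
  rewrite cardsU cardQ (_ : _ :&: _ = set0) ?cards0 ?subn0.
    by rewrite cardsD (setIidPr PO) cardP.
  by apply/setP => q; rewrite !inE; apply/andP => -[/andP[_ qO] /inQ]; rewrite qO.
rewrite -cardO' in val; have [B [cardB wordB oddB]] := IH _ val.
pose B' i := if i is i'.+1 then B i' else P :|: Q.
have sumB' q m : \sum_(i' < m.+1) (q \in B' i') = (q \in P :|: Q) + \sum_(i' < m) (q \in B i').
  by rewrite big_ord_recl.
exists B'; split=> [[|i] lt_i|[|i] lt_i|].
- by rewrite /= cardsU PQ cards0 subn0 cardP cardQ; lia.
- exact: cardB.
- rewrite /= -cardP; apply: eq_card => q; rewrite !inE big_ord0 addbF.
  have := inP q; have := inQ q; case: (q \in P); case: (q \in Q); case: (q \in O) => //= h1 h2;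
    first [by move: (h1 isT) | by move: (h2 isT)].
- rewrite /= -wordB //; apply: eq_card => q; rewrite [LHS]inE [RHS]inE; congr (_ && _).
  by rewrite sumB' oddD addbA oddb -O'E.
- rewrite -oddB; apply: eq_bigr => q _.
  by rewrite sumB' oddD addbA oddb -O'E.
Qed.

End Words.

Section WordBound.

Variables (k : fieldType) (n d : nat).
Hypothesis char_k : [pchar k]%R =i pred0.

(** The letters are the exponents of the [X_i] in the leading monomial, so distinct words give
    independent forms. *)
Lemma coker_ge_words (c : 'I_n -> k) j lam (W : seq (seq nat)) : 0 < d ->
  j.*2 + lam = n * d.-1 -> uniq W ->
  all (fun a => (size a == n) && valid_word d.-1 (lam + d.-1) lam 0 a) W ->
  size W <= coker d c j.
Proof.
move=> d_gt0 jE uW /allP validW; set M := lam + d.-1.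
pose word (w : 'I_(size W)) := nth [::] W w.
have wordW w : word w \in W by exact: mem_nth.
have sizeW w : size (word w) = n by have /validW/andP[/eqP] := wordW w.
have ex w : exists B : 'I_n -> {set 'I_M},
    [/\ forall i, #|B i| = d.-1,
        forall i, word_of B i = nth 0 (word w) i
      & \sum_(q < M) odd #|memb B q| = lam].
  have /validW/andP[_ val] := wordW w.
  have [|B [cardB wordB oddB]] := @valid_word_sets d.-1 M lam (word w) set0.
    by rewrite cards0.
  exists (fun i => B i); split=> [i|i|].
  - by apply: cardB; rewrite sizeW.
  - rewrite -wordB ?sizeW // /word_of; apply: eq_card => q; rewrite !inE.
    by rewrite (big_ord_narrow (ltnW (ltn_ord i)))  /=.
  - rewrite -[RHS]oddB; apply: eq_bigr => q _; rewrite inE /= sizeW; congr (nat_of_bool (odd _)).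
    rewrite -sum1_card big_mkcond; apply: eq_bigr => i _.
    by rewrite inE; case: ifP.
have [B hB] := fin_all_exists ex.
apply: (@coker_ge _ _ _ char_k c j lam M _ B) => // [w i|w|w w' E].
- by case: (hB w).
- by case: (hB w).
- have [_ h _] := hB w; have [_ h' _] := hB w'.
  apply/val_inj/eqP; rewrite -(nth_uniq [::] (ltn_ord w) (ltn_ord w') uW); apply/eqP.
  apply: (@eq_from_nth _ 0); first by rewrite -/(word w) -/(word w') !sizeW.
  rewrite -/(word w) -/(word w') sizeW => i lt_i.
  by have := E (Ordinal lt_i); rewrite h h'.
Qed.

Lemma not_lefschetz j lam (W : seq (seq nat)) : 0 < d -> 0 < j ->
  j.*2 + lam = n * d.-1 -> uniq W ->
  all (fun a => (size a == n) && valid_word d.-1 (lam + d.-1) lam 0 a) W ->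
  0 < size W ->
  Z.lt (Z.sub (dcomps n d (Z.of_nat j)) (dcomps n d (Z.sub (Z.of_nat j) (Z.of_nat d))))
       (Z.of_nat (size W)) ->
  ~ exists c : 'I_n -> k, forall i, inj_at d c i \/ sur_at d c i.
Proof.
move=> d_gt0 j_gt0 jE uW vW W_gt0 ltW [c max].
have le := coker_ge_words c d_gt0 jE uW vW.
have [||||ninj nsur] := @coker_not_max k n d char_k c j.-1 j; try lia.
by case: (max j.-1).
Qed.

End WordBound.

(** Every index belongs to all [D] sets, which become odd and even in turn. *)
Lemma valid_word_even D q : exists2 a, size a = q.*2 & valid_word D D 0 0 a.
Proof.
elim: q => [|q [a sa va]]; first by exists [::].
exists [:: 0, D & a]; first by rewrite /= sa.
by rewrite /= !subn0 !add0n !addn0 !leqnn /= !subnn addn0 va.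
Qed.

(** Two letters can lower the state by at most [2 * lam], since [h + D <= M + x] with [M = lam + D];
    this step is repeated until [lam] is reached. *)
Lemma valid_word_odd D lam q y : lam <= y -> y <= D -> ~~ odd (y + lam) ->
  y <= lam + (q * lam).*2 ->
  exists2 a, size a = q.*2 & valid_word D (lam + D) lam y a.
Proof.
elim: q y => [|q IH] y le_ly le_yD ev le_y.
  by exists [::] => //=; apply/eqP; lia.
pose y' := maxn lam (y - lam.*2).
have ev' : ~~ odd (y' + lam) by rewrite /y'; lia.
have y1 : lam <= y' by rewrite /y'; lia.
have y2 : y' <= D by rewrite /y'; lia.
have y3 : y' <= lam + (q * lam).*2 by rewrite mulSn in le_y; rewrite /y'; lia.
have [a sa va] := IH y' y1 y2 ev' y3.
(* The first letter leads to the state [D - y']; the second takes all those sets and leads to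
   [y']. *)
exists [:: (y + y')./2, D - y' & a]; first by rewrite /= sa.
rewrite /=.
have e : (y + y')./2.*2 = y + y' by rewrite /y' in ev' *; lia.
have b : lam <= y' <= y by rewrite /y'; lia.
have h1 : y - (y + y')./2 + (D - (y + y')./2) = D - y' by lia.
rewrite h1 subnn add0n subKn; last by lia.
rewrite va !andbT leqnn; apply/and5P; split; rewrite /y' in e b *; lia.
Qed.

(** The first letter 0 makes [D] sets odd, and the [n./2] pairs that follow descend from [D] to
    [lam]; this is possible when [D <= n * lam]. *)
Lemma valid_word_exists n D lam : ~~ odd (D + lam) -> lam <= D -> D <= n * lam -> odd n ->
  exists2 a, size a = n & valid_word D (lam + D) lam 0 a.
Proof.
move=> ev le_lD le_D n_odd.
have [||||a sa va] := @valid_word_odd D lam n./2 D => //.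
  by rewrite -{1}(odd_double_half n) n_odd mulnDl mul1n -doubleMl in le_D.
exists (0 :: a); first by rewrite /= sa -{2}(odd_double_half n) n_odd.
by rewrite /= !subn0 add0n va andbT; lia.
Qed.

(** * Failure of the weak Lefschetz property *)

(** Follows the recursion of [valid_word]; validity and distinctness of the output are tested by
    evaluation in [words_check]. *)
Fixpoint words (D M lam n h : nat) : seq (seq nat) :=
  if n is n'.+1 then
    flatten [seq if [&& x <= h, x <= D & h + D <= M + x]
                 then [seq x :: a | a <- words D M lam n' (h - x + (D - x))] else [::]
            | x <- iota 0 D.+1]
  else if h == lam then [:: [::]] else [::].

Section Failure.

Variables (k : fieldType) (n d : nat).
Hypothesis char_k : [pchar k]%R =i pred0.

Notation lefschetz := (exists c : 'I_n -> k, forall i, inj_at d c i \/ sur_at d c i).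

Definition words_check (lam j : nat) : bool :=
  let W := words d.-1 (lam + d.-1) lam n 0 in
  let s := comps_row n d in
  [&& (j.*2 + lam == n * d.-1), uniq W,
      all (fun a => (size a == n) && valid_word d.-1 (lam + d.-1) lam 0 a) W, 0 < size W &
      Z.ltb (Z.sub (dcomps_row s (Z.of_nat j)) (dcomps_row s (Z.sub (Z.of_nat j) (Z.of_nat d))))
            (Z.of_nat (size W))].

Lemma not_lefschetz_words lam j : 0 < d -> 0 < j -> words_check lam j -> ~ lefschetz.
Proof.
move=> d_gt0 j_gt0 /and5P[/eqP jE uW vW W_gt0 /Z.ltb_lt lt].
apply: (not_lefschetz char_k d_gt0 j_gt0 jE uW vW W_gt0).
by rewrite !dcomps_rowE.
Qed.

Lemma not_lefschetz_word a lam j : 0 < d -> 0 < j -> j.*2 + lam = n * d.-1 ->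
  size a = n -> valid_word d.-1 (lam + d.-1) lam 0 a ->
  Z.le (dcomps n d (Z.of_nat j)) (dcomps n d (Z.sub (Z.of_nat j) (Z.of_nat d))) ->
  ~ lefschetz.
Proof.
move=> d_gt0 j_gt0 jE sa va le.
apply: (@not_lefschetz k n d char_k j lam [:: a]) => //; first by rewrite /= sa va eqxx.
by rewrite /=; lia.
Qed.

Lemma not_lefschetz_even : 1 < d -> 1 < n -> ~~ odd n -> heavy n d Z0 -> ~ lefschetz.
Proof.
move=> d_gt1 n_gt1 n_even h.
have [a sa va] := valid_word_even d.-1 n./2.
have nE : n = n./2.*2 by rewrite -{1}(odd_double_half n) (negbTE n_even).
apply: (@not_lefschetz_word a 0 (n./2 * d.-1)) => //; first by lia.
- by rewrite muln_gt0; lia.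
- by rewrite addn0 doubleMl -nE.
- by rewrite sa -nE.
- apply: (heavy_dcomps_le h); rewrite {2}nE; nia.
Qed.

(** For odd [n] the equation [2 * j + lam = n * (d - 1)] prescribes the parity of [lam]; the bounds
    on [lam] provide one word, which is enough when [e_j <= 0]. *)
Lemma not_lefschetz_odd_le lam : 1 < d -> 1 < n -> odd n -> ~~ odd (d.-1 + lam) ->
  lam <= d.-1 <= n * lam ->
  Z.le (dcomps n d (Z.of_nat (n * d.-1 - lam)./2))
       (dcomps n d (Z.sub (Z.of_nat (n * d.-1 - lam)./2) (Z.of_nat d))) ->
  ~ lefschetz.
Proof.
move=> d_gt1 n_gt1 n_odd ev /andP[le1 le2] le.
have [a sa va] := valid_word_exists ev le1 le2 n_odd.
have lt : lam + lam <= n * d.-1 by nia.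
have ev' : ~~ odd (n * d.-1 - lam).
  by rewrite oddB; [rewrite oddM n_odd /= -oddD | lia].
have jE : (n * d.-1 - lam)./2.*2 + lam = n * d.-1.
  by rewrite -{2}(subnK (leq_trans (leq_addr _ _) lt)) -{2}(odd_double_half (n * d.-1 - lam)) (negbTE ev').
apply: (not_lefschetz_word (a := a) _ _ jE) => //; first by lia.
nia.
Qed.

Lemma not_lefschetz_odd lam : 1 < d -> 1 < n -> odd n -> ~~ odd (d.-1 + lam) ->
  lam <= d.-1 <= n * lam -> heavy n d (Z.of_nat lam) -> ~ lefschetz.
Proof.
move=> d_gt1 n_gt1 n_odd ev le h; apply: (not_lefschetz_odd_le (lam := lam)) => //.
apply: (heavy_dcomps_le h).
have lt : lam <= n * d.-1 by nia.
have ev' : ~~ odd (n * d.-1 - lam).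
  by rewrite oddB; [rewrite oddM n_odd /= -oddD | lia].
have : (n * d.-1 - lam)./2.*2 + lam = n * d.-1.
  by rewrite -{2}(subnK lt) -{2}(odd_double_half (n * d.-1 - lam)) (negbTE ev').
nia.
Qed.

End Failure.

(** In these pairs [e_j] is positive in the chosen degree, so a single word does not suffice and all
    of them are counted. *)
Lemma words_check_5_5 : words_check 5 5 2 9.
Proof. by vm_compute. Qed.

Lemma words_check_7_3 : words_check 7 3 2 6.
Proof. by vm_compute. Qed.

Lemma words_check_9_2 : words_check 9 2 1 4.
Proof. by vm_compute. Qed.

Lemma words_check_9_3 : words_check 9 3 2 8.
Proof. by vm_compute. Qed.

Lemma words_check_11_2 : words_check 11 2 1 5.
Proof. by vm_compute. Qed.

Lemma words_check_11_3 : words_check 11 3 2 10.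
Proof. by vm_compute. Qed.

(** Tests one inequality at [n = 5] instead of a whole reflection property, since nothing is
    propagated to larger [n]. *)
Definition direct_check (d lam : nat) : bool :=
  let j := Z.of_nat (5 * d.-1 - lam)./2 in
  let s := comps_row 5 d in
  Z.leb (dcomps_row s j) (dcomps_row s (Z.sub j (Z.of_nat d))).

Lemma direct_check_4 : direct_check 4 1.
Proof. by vm_compute. Qed.

Lemma direct_check_7 : direct_check 7 2.
Proof. by vm_compute. Qed.

Lemma direct_check_8 : direct_check 8 3.
Proof. by vm_compute. Qed.

Lemma direct_check_10 : direct_check 10 3.
Proof. by vm_compute. Qed.

Lemma direct_check_13 : direct_check 13 4.
Proof. by vm_compute. Qed.

Lemma direct_checkP d lam (j := (5 * d.-1 - lam)./2) : direct_check d lam ->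
  Z.le (dcomps 5 d (Z.of_nat j)) (dcomps 5 d (Z.sub (Z.of_nat j) (Z.of_nat d))).
Proof. by rewrite !dcomps_rowE => /Z.leb_le. Qed.

(** [lam] has to lie between [(d - 1) / 5], for the existence of a word, and [d / 3 - 1], for
    [heavy4], with prescribed parity. *)
Lemma weight_exists d : 13 < d \/ d \in [:: 6; 9; 11; 12] ->
  exists lam, [/\ ~~ odd (d.-1 + lam), lam <= d.-1 <= 5 * lam & 3 * (lam + 1) <= d].
Proof.
case=> [d_gt|].
  have [d20|d20] := leqP 20 d; last first.
    have : d \in [:: 14; 15; 16; 17; 18; 19] by rewrite !inE; lia.
    by rewrite !inE => /or4P[/eqP->|/eqP->|/eqP->|/or3P[]/eqP->];
      [exists 3|exists 4|exists 3|exists 4|exists 5|exists 4].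
  (* [l0] is [(d - 1) / 5] rounded up. The parity correction costs at most one, which the upper
     bound affords from [d = 20] on. *)
  pose l0 := (d + 3) %/ 5.
  exists (l0 + odd (d.-1 + l0)).
  have : l0 * 5 <= d + 3 < (l0 + 1) * 5 by rewrite /l0; lia.
  move: l0 => l0 /andP[b1 b2].
  by split; case: (boolP (odd (d.-1 + l0))); lia.
by rewrite !inE => /or4P[]/eqP->; [exists 1|exists 2|exists 2|exists 3].
Qed.

Lemma not_lefschetz_exceptional (k : fieldType) (char_k : [pchar k]%R =i pred0) n d :
  0 < d -> ~~ exceptional n d ->
  ~ exists c : 'I_n -> k, forall i, inj_at d c i \/ sur_at d c i.
Proof.
move=> d_gt0; rewrite /exceptional !negb_or -ltnNge => /and3P[n_gt3 d1 exc].
have d_gt1 : 1 < d by rewrite ltn_neqAle eq_sym d1.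
have n_gt1 : 1 < n by lia.
have [n_odd|n_even] := boolP (odd n); last first.
  apply: not_lefschetz_even => //.
  have [d3|d2] := leqP 3 d; first by apply: (heavy_leq n_gt3); apply: heavy4; lia.
  have dE : d = 2 by lia.
  rewrite dE in exc *; apply: (@heavy_leq 6) heavy_6_2.
  by move: exc; rewrite !xpair_eqE /= !andbT !andbF; lia.
have n_ge5 : 5 <= n by lia.
have [wt|small] := boolP ((13 < d) || (d \in [:: 6; 9; 11; 12])).
  have [lam [ev le h]] := weight_exists (orP wt).
  apply: (not_lefschetz_odd char_k (lam := lam)) => //; first by nia.
  by apply: (heavy_leq n_gt3); apply: heavy4; lia.
(* The values of [d] left over at [n = 5]. For larger [n] a smaller [lam] or a computed base case of
   [heavy] becomes available. *)
have {small} : d \in [:: 2; 3; 4; 5; 7; 8; 10; 13].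
  by move: small; rewrite !inE; lia.
have n57 : n = 5 \/ 7 <= n by lia.
rewrite !inE => /orP[|/orP[|/orP[|/orP[|/or4P[]]]]] /eqP dE; move: exc; rewrite {}dE => exc.
- have : n = 9 \/ n = 11 \/ 13 <= n.
    by move: exc; rewrite !xpair_eqE /= !andbT !andbF; lia.
  case=> [->|[->|n13]]; [exact: (not_lefschetz_words char_k _ _ words_check_9_2)|
    exact: (not_lefschetz_words char_k _ _ words_check_11_2)|].
  by apply: (not_lefschetz_odd char_k (lam := 1)) => //; [lia | apply: heavy_leq heavy_13_2].
- have : n = 7 \/ n = 9 \/ n = 11 \/ 13 <= n.
    by move: exc; rewrite !xpair_eqE /= !andbT !andbF; lia.
  case=> [->|[->|[->|n13]]]; [exact: (not_lefschetz_words char_k _ _ words_check_7_3)|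
    exact: (not_lefschetz_words char_k _ _ words_check_9_3)|
    exact: (not_lefschetz_words char_k _ _ words_check_11_3)|].
  by apply: (not_lefschetz_odd char_k (lam := 2)) => //; [lia | apply: heavy_leq heavy_13_3].
- case: n57 => [->|n7]; first exact: (not_lefschetz_odd_le char_k (lam := 1)) (direct_checkP direct_check_4).
  by apply: (not_lefschetz_odd char_k (lam := 1)) => //; [lia | apply: heavy_leq heavy_6_4; lia].
- case: n57 => [->|n7]; first exact: (not_lefschetz_words char_k _ _ words_check_5_5).
  by apply: (not_lefschetz_odd char_k (lam := 2)) => //; [lia | apply: heavy_leq heavy_7_5; lia].
- case: n57 => [->|n7]; first exact: (not_lefschetz_odd_le char_k (lam := 2)) (direct_checkP direct_check_7).
  by apply: (not_lefschetz_odd char_k (lam := 2)) => //; [lia | apply: heavy_leq heavy_6_7; lia].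
- case: n57 => [->|n7]; first exact: (not_lefschetz_odd_le char_k (lam := 3)) (direct_checkP direct_check_8).
  by apply: (not_lefschetz_odd char_k (lam := 1)) => //; [lia | apply: (heavy_leq n_gt3); apply: heavy4; lia].
- case: n57 => [->|n7]; first exact: (not_lefschetz_odd_le char_k (lam := 3)) (direct_checkP direct_check_10).
  by apply: (not_lefschetz_odd char_k (lam := 3)) => //; [lia | apply: heavy_leq heavy_6_10; lia].
- case: n57 => [->|n7]; first exact: (not_lefschetz_odd_le char_k (lam := 4)) (direct_checkP direct_check_13).
  by apply: (not_lefschetz_odd char_k (lam := 2)) => //; [lia | apply: (heavy_leq n_gt3); apply: heavy4; lia].
Qed.

Local Open Scope ring_scope.

(** * The exceptional cases *)

Section CokerForm.

Variables (k : fieldType) (n d : nat) (c : 'I_n -> k).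

Notation N := #|{ffun 'I_n -> 'I_d}|.

(** A functional that factors through degree [j] of [R / l R]: each relation of the ideal becomes a
    rewriting rule for its values. *)
Record annihilates (j : nat) (Lam : {linear {mpoly k[n]} -> k^o}) : Prop := Annihilates {
  ann_lin : forall p, Lam (linform c * p) = 0;
  ann_sum : forall p, Lam (linform (fun=> 1) ^+ d * p) = 0;
  ann_var : forall i p, Lam ('X_i ^+ d * p) = 0;
  ann_deg : forall m, mdeg m != j -> Lam 'X_[m] = 0 }.

Section OfColumn.

Variable F : 'cV[k]_N.

Definition col_form (p : {mpoly k[n]}) : k^o := (trunc d p *m F) 0 0.

Lemma col_form_is_linear : linear col_form.
Proof. by move=> a p q; rewrite /col_form linearP mulmxDl -scalemxAl !mxE. Qed.
HB.instance Definition _ := GRing.isLinear.Build k _ _ _ col_form col_form_is_linear.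

Lemma col_formX s : col_form 'X_[emon s] = F s 0.
Proof.
rewrite /col_form mxE (bigD1 s) //= !mxE mcoeffX eqxx mul1r big1 ?addr0 // => t ts.
by rewrite mxE mcoeffX (inj_eq (@emon_inj _ _)) eq_sym (negbTE ts) mul0r.
Qed.

Lemma col_form_unbounded m : ~~ bounded d m -> col_form 'X_[m] = 0.
Proof.
move=> mb; rewrite /col_form mxE big1 // => t _; rewrite mxE mcoeffX.
by case: eqP => [E|_]; [rewrite E emon_bounded in mb | rewrite mul0r].
Qed.

Lemma col_form_annihilates j : mulX d c *m F = 0 -> mulL k n d *m F = 0 ->
  degmx k n d j *m F = F -> annihilates j col_form.
Proof.
move=> XF LF PF; split=> [p|p|i p|m mj].
- by rewrite /= /col_form trunc_linform_mul -mulmxA XF mulmx0 mxE.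
- by rewrite /= /col_form trunc_linform_exp_mul -mulmxA LF mulmx0 mxE.
- by rewrite /= /col_form mulrC trunc_mulXn mul0mx mxE.
- rewrite /= /col_form -PF mulmxA mxE big1 // => t _; rewrite degmxE mxE mcoeffX.
  by case: eqP => [<-|_]; rewrite ?(negbTE mj) ?mulr0 !mul0r.
Qed.

End OfColumn.

Lemma coker_le_form j (Ms : seq 'X_{1..n}) :
  (forall Lam, annihilates j Lam -> (forall m, m \in Ms -> Lam 'X_[m] = 0) ->
     forall m, Lam 'X_[m] = 0) ->
  (coker d c j <= size Ms)%N.
Proof.
move=> inj; pose S := pmap (fun m => [pick s : 'I_N | emon s == m]) Ms.
have le : (size S <= size Ms)%N by rewrite size_pmap; apply: count_size.
apply: leq_trans le; apply: coker_le => F XF LF PF FS.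
have ann := col_form_annihilates XF LF PF.
apply/colP => s; rewrite mxE -col_formX; apply: (inj (col_form F)) => // m mM.
have [/emon_surj[t tm]|mb] := boolP (bounded d m); last exact: col_form_unbounded.
rewrite -tm /= col_formX FS // mem_pmap; apply/mapP; exists m => //.
case: pickP => [t' /eqP t'm|/(_ t)]; last by rewrite tm eqxx.
by congr Some; apply: (@emon_inj n d); rewrite t'm.
Qed.

Lemma coker0_le1 : (coker d c 0 <= 1)%N.
Proof.
apply: (@coker_le_form 0 [:: 0%MM]) => Lam ann L0 m.
have [/eqP|m0] := boolP (mdeg m == 0%N); last exact: (ann_deg ann).
by move/eqP; rewrite mdeg_eq0 => /eqP ->; apply: L0; rewrite mem_head.
Qed.

End CokerForm.

Section SmallCases.

Variables (k : fieldType).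
Hypothesis char_k : [pchar k] =i pred0.

Notation lefschetz n d := (exists c : 'I_n -> k, forall i, inj_at d c i \/ sur_at d c i).

Lemma lefschetz_d1 n : lefschetz n 1.
Proof.
exists (fun=> 0); apply: (@lefschetz_of_coker _ _ _ _ 0) => [[|//] _|].
  rewrite hilb0 //; have := coker0_le1 1 (fun=> 0 : k) (n := n); lia.
apply/eqP; rewrite -leqn0; apply: (@coker_le_form _ _ _ _ 1 [::]) => Lam ann _ m.
have [/mdeg1P[i /eqP ->]|m1] := boolP (mdeg m == 1%N); last exact: (ann_deg ann).
by rewrite -[X in Lam X]mulr1 -['X_i]expr1; apply: (ann_var ann).
Qed.

Lemma lefschetz_n1 d : (0 < d)%N -> lefschetz 1 d.
Proof.
move=> d_gt0; exists (fun=> 1); apply: (@lefschetz_of_coker _ _ _ _ 0) => [[|//] _|].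
  rewrite hilb0 //; have := coker0_le1 d (fun=> 1 : k) (n := 1); lia.
apply/eqP; rewrite -leqn0; apply: (@coker_le_form _ _ _ _ 1 [::]) => Lam ann _ m.
have [/mdeg1P[i /eqP ->]|m1] := boolP (mdeg m == 1%N); last exact: (ann_deg ann).
have := ann_lin ann 1; rewrite /linform big_ord1 scale1r mulr1 => E.
by rewrite (ord1 i).
Qed.

(** With [l = x_1 + x_2] the last power lies in the ideal of [l], and [R / l R] is [k[x] / (x ^
    d)]. *)
Lemma lefschetz_n2 d : (0 < d)%N -> lefschetz 2 d.
Proof.
move=> d_gt0; exists (fun=> 1).
have red j Lam : annihilates d (fun=> 1 : k) j Lam -> Lam 'X_[U_(ord0) *+ j] = 0 ->
    forall m : 'X_{1..2}, Lam 'X_[m] = 0.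
  move=> ann L0 m; have [/eqP mj|mj] := boolP (mdeg m == j); last exact: (ann_deg ann).
  have mE : m = (U_(ord0) *+ (j - m ord_max) + U_(ord_max) *+ m ord_max)%MM.
    apply/mnmP => i; rewrite mnmDE !mulmnE !mnm1E.
    move: mj; rewrite mdegE big_ord_recl big_ord1.
    have -> : lift ord0 ord0 = ord_max :> 'I_2 by apply/val_inj.
    case: (unliftP ord0 i) => [i' ->|->] mj.
      have -> : lift ord0 i' = ord_max :> 'I_2 by rewrite (ord1 i'); apply/val_inj.
      by rewrite mul0n mul1n.
    by rewrite mul0n mul1n addn0; lia.
  have : (m ord_max <= j)%N by rewrite -mj mdegE (bigD1 ord_max) //= leq_addr.
  rewrite [in Lam _]mE; move: (m ord_max) => b {m mj mE}; elim: b => [|b IH] le_b.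
    by rewrite subn0 mulm0n addm0.
  have := ann_lin ann 'X_[U_(ord0) *+ (j - b.+1) + U_(ord_max) *+ b].
  rewrite /linform big_ord_recl big_ord1 !scale1r mulrDl -!mpolyXD linearD.
  have -> : lift ord0 ord0 = ord_max :> 'I_2 by apply/val_inj.
  rewrite addmA -mulmS -subSn // subSS IH ?add0r; last exact: ltnW.
  by rewrite addmC -addmA [(_ + U_(ord_max))%MM]addmC -mulmS.
apply: (@lefschetz_of_coker _ _ _ _ d.-1) => [j le_j|].
  rewrite hilb2; try lia.
  have : (coker d (fun _ : 'I_2 => 1%R : k) j <= 1)%N; last by lia.
  apply: (@coker_le_form _ _ _ _ j [:: (U_(ord0) *+ j)%MM]) => Lam ann L0.
  by apply: (red _ _ ann); apply: L0; rewrite mem_head.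
rewrite prednK //; apply/eqP; rewrite -leqn0.
apply: (@coker_le_form _ _ _ _ d [::]) => Lam ann _; apply: (red _ _ ann).
by rewrite -mpolyXn -[X in Lam X]mulr1; apply: (ann_var ann).
Qed.

End SmallCases.

(** * Three variables and binary forms *)

Section ThreeVariables.

Variables (k : fieldType).
Hypothesis char_k : [pchar k] =i pred0.

Lemma eq_poly_char0 (p q : {poly k}) : (forall a, p.[a] = q.[a]) -> p = q.
Proof.
move=> pq; apply/eqP; rewrite -subr_eq0; apply/negPn/negP => nz.
pose s := [seq (i%:R : k) | i <- iota 0 (size (p - q))].
have allroot : all (root (p - q)) s.
  by apply/allP => _ /mapP[i _ ->]; rewrite rootE hornerD hornerN pq subrr.
suff /(max_poly_roots nz allroot) : uniq s by rewrite size_map size_iota ltnn.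
rewrite map_inj_in_uniq ?iota_uniq // => i l _ _ /eqP.
wlog le_il : i l / (i <= l)%N => [H|].
  by case/orP: (leq_total i l) => [/H|/H h]; [|rewrite eq_sym => /h].
by rewrite eq_sym -subr_eq0 -natrB // (natr_char0_eq0 char_k) subn_eq0 => le; apply/eqP; rewrite eqn_leq le_il.
Qed.

Variable d : nat.
Hypothesis d_gt0 : (0 < d)%N.

Let i0 : 'I_3 := @Ordinal 3 0 isT.
Let i1 : 'I_3 := @Ordinal 3 1 isT.
Let i2 : 'I_3 := @Ordinal 3 2 isT.
(* Modulo the form with these coefficients, [z = y - 3 x] and
   [x + y + z = 2 (y - x)]. *)
Let c3 (i : 'I_3) : k := nth 0 [:: 3; -1; 1] i.

Notation x := ('X_i0 : {mpoly k[3]}).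
Notation y := ('X_i1 : {mpoly k[3]}).
Notation z := ('X_i2 : {mpoly k[3]}).

Lemma linform3 (c : 'I_3 -> k) : linform c = c i0 *: x + c i1 *: y + c i2 *: z.
Proof.
rewrite /linform big_ord_recl big_ord_recl big_ord1 addrA.
by congr (_ *: 'X_ _ + _ *: 'X_ _ + _ *: 'X_ _); rewrite ?/c; try congr c; apply/val_inj.
Qed.

Section Form.

Variables (j : nat) (Lam : {linear {mpoly k[3]} -> k^o}).
Hypothesis ann : annihilates d c3 j Lam.

Lemma Lam_z p : Lam (z * p) = Lam ((- 3%:R *: x + y) * p).
Proof.
apply/eqP; rewrite -subr_eq0 -linearB -mulrBl; apply/eqP.
rewrite -[RHS](ann_lin ann p) linform3; congr (Lam (_ * p)).
by rewrite /c3 /= scaleN1r scale1r scaleNr opprD opprK addrC.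
Qed.

Lemma Lam_exp u v : (forall p, Lam (u * p) = Lam (v * p)) ->
  forall e p, Lam (u ^+ e * p) = Lam (v ^+ e * p).
Proof.
move=> uv; elim=> [|e IH] p; first by rewrite !expr0.
by rewrite [u ^+ _]exprS [v ^+ _]exprS -[in LHS]mulrA uv mulrCA IH mulrCA mulrA.
Qed.

Lemma Lam_y e r : (d <= e)%N -> Lam (x ^+ r * (0 *: x + y) ^+ e) = 0.
Proof. by move=> /subnK <-; rewrite scale0r add0r exprD mulrA mulrC (ann_var ann). Qed.

Lemma Lam_3 e r : (d <= e)%N -> Lam (x ^+ r * ((- 3%:R) *: x + y) ^+ e) = 0.
Proof.
move=> /subnK <-; rewrite exprD mulrA mulrC -(Lam_exp Lam_z).
exact: (ann_var ann).
Qed.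

Lemma Lam_1 e r : (d <= e)%N -> Lam (x ^+ r * ((- 1) *: x + y) ^+ e) = 0.
Proof.
move=> /subnK <-; rewrite exprD mulrA mulrC; set p := x ^+ r * _.
have sum_z q : Lam (linform (fun=> 1) * q) = Lam ((2%:R *: (-1 *: x + y)) * q).
  rewrite linform3 !scale1r mulrDl linearD Lam_z -linearD -mulrDl; congr (Lam (_ * q)).
  by rewrite -!mul_mpolyC !mpolyCN !mpolyC_nat; ring.
have := ann_sum ann p; rewrite (Lam_exp sum_z) exprZn -scalerAl linearZ => /eqP.
rewrite mulf_eq0 expf_eq0 (natr_char0_eq0 char_k 2) andbF /=; exact/eqP.
Qed.

(** The binary form dual to [Lam], dehomogenised and recentred at [t]: its value at [a] is [Lam] of
    the j-th power of [(a + t) x + y]. *)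
Definition binform (t : k) : {poly k} :=
  \poly_(r < j.+1) (Lam (x ^+ r * (t *: x + y) ^+ (j - r)) *+ 'C(j, r)).

Lemma binform_horner t a : (binform t).[a] = Lam ((a *: x + (t *: x + y)) ^+ j).
Proof.
rewrite horner_poly [a *: x + _]addrC exprDn linear_sum; apply: eq_bigr => r _ /=.
rewrite exprZn -scalerAr linearMn linearZ /= [_ * x ^+ r]mulrC.
by rewrite mulrnAl [_ * a ^+ r]mulrC.
Qed.

Lemma binform_shift t : binform 0 = binform t \Po ('X - t%:P).
Proof.
apply: eq_poly_char0 => a; rewrite horner_comp hornerXsubC !binform_horner.
by rewrite [_ + (t *: x + y)]addrA -scalerDl subrK scale0r [0 + y]add0r.
Qed.

(** Up to the shift by [t], the coefficients of [binform t] are the Taylor coefficients of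
    [binform 0] at [t]. *)
Lemma binform_dvd t m : (forall r, (r < m)%N -> (r <= j)%N -> Lam (x ^+ r * (t *: x + y) ^+ (j - r)) = 0) ->
  ('X - t%:P) ^+ m %| binform 0.
Proof.
move=> z0; have : 'X^m %| binform t.
  apply/dvdpP; exists (drop_poly m (binform t)); rewrite -[LHS](poly_take_drop m).
  rewrite (_ : take_poly m _ = 0) ?add0r //; apply/polyP => r; rewrite coef_take_poly coef0 coef_poly.
  by case: ifP => // lt_r; case: ifP => // lt_j; rewrite z0 ?mul0rn.
case/dvdpP => q qE; apply/dvdpP; exists (q \Po ('X - t%:P)).
by rewrite (binform_shift t) qE comp_polyM rmorphXn /= comp_polyX.
Qed.

(** The relation [x ^ d = 0] is a zero at infinity: it lowers the degree instead of giving a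
    factor. *)
Lemma binform_size : (size (binform 0) <= j.+1 - (j.+1 - d))%N.
Proof.
apply/leq_sizeP => r le_r; rewrite coef_poly; case: ifP => // lt_r.
have : (d <= r)%N by lia.
by move=> /subnK <-; rewrite addnC exprD -mulrA (ann_var ann) mul0rn.
Qed.

(** The points [0], [-3], [-1] are zeros of order [m], and the degree is at most [j - m]. The
    [j + 1 - 4 m] coefficients imposed on top raise the order at [0] until the zeros outnumber the
    degree. *)
Lemma binform_eq0 (m := (j.+1 - d)%N) :
  (forall r, (m <= r)%N -> (r < m + (j.+1 - 4 * m))%N -> Lam (x ^+ r * y ^+ (j - r)) = 0) ->
  binform 0 = 0.
Proof.
move=> zM; apply/eqP/negPn/negP => nz.
have cop (a b : k) e e' : a != b -> coprimep (('X - a%:P) ^+ e) (('X - b%:P) ^+ e').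
  by move=> ab; apply/coprimep_expl/coprimep_expr; rewrite coprimep_XsubC root_XsubC eq_sym.
have dy : ('X - 0%:P) ^+ (m + (j.+1 - 4 * m)) %| binform 0.
  apply: binform_dvd => r lt_r le_r; have [lt_m|le_m] := ltnP r m.
    by apply: Lam_y; rewrite /m in lt_m; lia.
  by rewrite scale0r add0r; apply: zM.
have d3 : ('X - (- 3%:R)%:P) ^+ m %| binform 0.
  by apply: binform_dvd => r lt_r le_r; apply: Lam_3; rewrite /m in lt_r; lia.
have d1 : ('X - (- 1)%:P) ^+ m %| binform 0.
  by apply: binform_dvd => r lt_r le_r; apply: Lam_1; rewrite /m in lt_r; lia.
have ne30 : (0 : k) != - 3%:R by rewrite eq_sym oppr_eq0 (natr_char0_eq0 char_k 3).
have ne10 : (0 : k) != - 1 by rewrite eq_sym oppr_eq0 oner_eq0.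
have ne31 : (- 3%:R : k) != - 1.
  by rewrite eqr_opp -subr_eq0 (_ : 3%:R - 1 = 2%:R) ?(natr_char0_eq0 char_k 2) //; ring.
have : ('X - 0%:P) ^+ (m + (j.+1 - 4 * m)) * (('X - (- 3%:R)%:P) ^+ m * ('X - (- 1)%:P) ^+ m) %| binform 0.
  rewrite Gauss_dvdp ?coprimepMr ?cop // dy /= Gauss_dvdp ?cop // d3 //.
move/dvdp_leq => /(_ nz); have := binform_size.
rewrite size_mul ?mulf_neq0 ?expf_neq0 ?polyXsubC_eq0 //.
rewrite size_mul ?expf_neq0 ?polyXsubC_eq0 // !size_exp_XsubC -/m => le_sz lt_sz; have := leq_trans lt_sz le_sz.
clearbody m; lia.
Qed.

Lemma form_eq0 : binform 0 = 0 -> forall m, Lam 'X_[m] = 0.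
Proof.
move=> b0; have base r : (r <= j)%N -> Lam (x ^+ r * y ^+ (j - r)) = 0.
  move=> le_r; move/polyP/(_ r): b0; rewrite coef_poly coef0 ltnS le_r scale0r add0r => /eqP.
  rewrite -mulr_natr mulf_eq0 (natr_char0_eq0 char_k) => /orP[/eqP //|].
  by rewrite -leqn0 leqNgt bin_gt0 le_r.
have H e : forall a b, (a + b + e = j)%N -> Lam (z ^+ e * (x ^+ a * y ^+ b)) = 0.
  elim: e => [|e IH] a b abe.
    by rewrite expr0 mul1r (_ : b = j - a)%N ?base //; lia.
  rewrite exprS -mulrA Lam_z mulrDl linearD -scalerAl linearZ /=.
  have -> : x * (z ^+ e * (x ^+ a * y ^+ b)) = z ^+ e * (x ^+ a.+1 * y ^+ b).
    by rewrite mulrCA [x * (_ * _)]mulrA -exprS.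
  have -> : y * (z ^+ e * (x ^+ a * y ^+ b)) = z ^+ e * (x ^+ a * y ^+ b.+1).
    by rewrite mulrCA [y * _]mulrCA -exprS.
  by rewrite !IH ?scaler0 ?addr0 //; lia.
move=> m; have [/eqP mj|mj] := boolP (mdeg m == j); last exact: (ann_deg ann).
have -> : 'X_[m] = z ^+ m i2 * (x ^+ m i0 * y ^+ m i1).
  rewrite mpolyXE_id big_ord_recl big_ord_recl big_ord1 mulrA mulrC.
  by congr ('X_ _ ^+ m _ * ('X_ _ ^+ m _ * 'X_ _ ^+ m _)); apply/val_inj.
apply: H; rewrite -mj mdegE big_ord_recl big_ord_recl big_ord1 addnA.
by congr (m _ + m _ + m _)%N; apply/val_inj.
Qed.

End Form.

Lemma coker3_le j : (coker d c3 j <= j.+1 - 4 * (j.+1 - d))%N.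
Proof.
set m := (j.+1 - d)%N; set e := (j.+1 - 4 * m)%N.
pose Ms := [seq (U_(i0) *+ r + U_(i1) *+ (j - r))%MM | r <- iota m e].
have <- : size Ms = e by rewrite size_map size_iota.
apply: coker_le_form => Lam ann LM; apply: (form_eq0 ann); apply: (binform_eq0 ann) => r le_r lt_r.
rewrite !mpolyXn -mpolyXD; apply: LM; apply/mapP; exists r => //.
by rewrite mem_iota le_r.
Qed.

Lemma lefschetz_n3 : exists c : 'I_3 -> k, forall i, inj_at d c i \/ sur_at d c i.
Proof.
(* [p] is the last degree with [3 * (p + 1) < 4 * d], that is, with a positive expected cokernel. *)
exists c3; pose p := ((4 * d).-1 %/ 3).-1.
have pd : (p < d.*2)%N by rewrite /p; lia.
apply: (@lefschetz_of_coker _ _ _ _ p) => [j le_j|].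
  have := coker3_le j; rewrite hilb3; rewrite /p in le_j; lia.
apply/eqP; rewrite -leqn0; apply: leq_trans (coker3_le _) _; rewrite /p; lia.
Qed.

End ThreeVariables.

(** * Gaussian elimination over the integers as a certificate *)

Fixpoint lin_comb (a b : Z) (r s : seq Z) : seq Z :=
  match r, s with
  | x :: r', y :: s' => Z.add (Z.mul a x) (Z.mul b y) :: lin_comb a b r' s'
  | [::], _ => map (Z.mul b) s
  | _, [::] => map (Z.mul a) r
  end.

(* The quotient is used only after checking that the division is exact, so that
   nothing needs to be proved about [content]. *)
Definition primitive_part (r : seq Z) : seq Z :=
  let g := foldr Z.gcd Z0 r in
  let r' := map (fun x => Z.div x g) r in
  if (g != Z0) && (map (Z.mul g) r' == r) then r' else r.

Definition eliminate (p r : seq Z) : seq Z :=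
  primitive_part
    (behead (lin_comb (head Z0 p) (Z.opp (head Z0 r)) r p)).

(** Marks the columns without a pivot. The pivot row stays in the list, where it reduces itself to
    zero. *)
Fixpoint free_columns (m : nat) (rows : seq (seq Z)) : seq bool :=
  if m is m'.+1 then
    if [seq r <- rows | head Z0 r != Z0] is p :: _ then
      false :: free_columns m' [seq eliminate p r | r <- rows]
    else true :: free_columns m' (map behead rows)
  else [::].

Fixpoint exponents (n d : nat) : seq (seq nat) :=
  if n is n'.+1 then [seq a :: w | a <- iota 0 d, w <- exponents n' d] else [:: [::]].

Definition terms : Type := seq (Z * seq nat).

Definition mul_terms (n : nat) (c : nat -> Z) (ts : terms) : terms :=
  flatten [seq [seq (Z.mul (c i) t.1, incr_nth t.2 i) | i <- iota 0 n] | t <- ts].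

Definition coef_row (cols : seq (seq nat)) (ts : terms) : seq Z :=
  [seq foldr (fun t z => if t.2 == s then Z.add t.1 z else z) Z0 ts | s <- cols].

Definition columns (n d j : nat) : seq (seq nat) := [seq s <- exponents n d | sumn s == j].

(** Multiples of [l] and of the last power by bounded monomials; the relations [x_i ^ d] are
    accounted for by admitting only bounded exponents as columns. *)
Definition relations (n d j : nat) : seq terms :=
  [seq mul_terms n (fun i => Z.of_nat i.+1) [:: (Zpos xH, u)] | u <- exponents n d & (sumn u).+1 == j] ++
  [seq iter d (mul_terms n (fun=> Zpos xH)) [:: (Zpos xH, u)] | u <- exponents n d & sumn u + d == j]%N.

Definition free_exponents (n d j : nat) : seq (seq nat) :=
  let cols := columns n d j in
  mask (free_columns (size cols) (map (coef_row cols) (relations n d j))) cols.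

Definition free_exponents_ok (n d p : nat) : bool :=
  all (fun j => Z.leb (Z.of_nat (size (free_exponents n d j)))
         (Z.sub (dcomps n d (Z.of_nat j)) (dcomps n d (Z.sub (Z.of_nat j) (Z.of_nat d)))))
      (iota 0 p.+1) && (size (free_exponents n d p.+1) == 0)%N.

(** The last argument is in each case the last degree in which [e_j] is positive. *)
Lemma free_exponents_ok_4_2 : free_exponents_ok 4 2 2. Proof. by vm_compute. Qed.
Lemma free_exponents_ok_5_2 : free_exponents_ok 5 2 2. Proof. by vm_compute. Qed.
Lemma free_exponents_ok_7_2 : free_exponents_ok 7 2 3. Proof. by vm_compute. Qed.
Lemma free_exponents_ok_5_3 : free_exponents_ok 5 3 4. Proof. by vm_compute. Qed.

Lemma mem_exponents n d s : (s \in exponents n d) = (size s == n) && all (fun a => a < d)%N s.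
Proof.
elim: n s => [|n IH] [|a s] //=.
  by apply/negP => /allpairsP[[b w] []].
rewrite eqSS andbCA -IH; apply/allpairsP/andP => [[[b w] [/= b_d ws [-> ->]]]|[a_d ws]].
  by move: b_d; rewrite mem_iota.
by exists (a, s); rewrite mem_iota.
Qed.

Lemma exponents_uniq n d : uniq (exponents n d).
Proof.
elim: n => //= n IH; rewrite allpairs_uniq ?iota_uniq //.
by move=> [a s] [b t] _ _ /= [-> ->].
Qed.

Section Certificate.

Variable k : fieldType.
Hypothesis char_k : [pchar k] =i pred0.

Definition of_Z (z : Z) : k := (int_of_Z z)%:~R.

Lemma of_ZD a b : of_Z (Z.add a b) = of_Z a + of_Z b.
Proof. by rewrite /of_Z (rmorphD int_of_Z) rmorphD. Qed.

Lemma of_ZM a b : of_Z (Z.mul a b) = of_Z a * of_Z b.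
Proof. by rewrite /of_Z (rmorphM int_of_Z) rmorphM. Qed.

Lemma of_Z_nat m : of_Z (Z.of_nat m) = m%:R.
Proof. by rewrite -natrZE /of_Z !rmorph_nat. Qed.

Lemma of_Z_eq0 z : (of_Z z == 0) = (z == Z0).
Proof.
rewrite -[z == _](inj_eq (can_inj int_of_ZK)) /of_Z.
have nat0 m : (m%:Z%:~R == 0 :> k) = (m == 0)%N by rewrite (natr_char0_eq0 char_k).
case: (int_of_Z z) => m; first by rewrite nat0.
by rewrite NegzE rmorphN oppr_eq0 nat0 oppr_eq0.
Qed.

Fixpoint dot (r : seq Z) (v : seq k) : k :=
  if r is a :: r' then if v is x :: v' then of_Z a * x + dot r' v' else 0 else 0.

Lemma dot_nil r : dot r [::] = 0.
Proof. by case: r. Qed.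

Lemma dot_cons r x v : dot r (x :: v) = of_Z (head Z0 r) * x + dot (behead r) v.
Proof. by case: r => //=; rewrite /of_Z mul0r add0r. Qed.

Lemma dot_eq0 r v : (forall x, x \in v -> x = 0) -> dot r v = 0.
Proof.
elim: v r => [|x v IH] r v0; first exact: dot_nil.
rewrite dot_cons (v0 x) ?mem_head // mulr0 add0r; apply: IH => y yv.
by apply: v0; rewrite inE yv orbT.
Qed.

Lemma dot_scale a r v : dot (map (Z.mul a) r) v = of_Z a * dot r v.
Proof.
elim: r v => [|x r IH] [|y v] /=; rewrite ?mulr0 //.
by rewrite IH of_ZM mulrDr mulrA.
Qed.

Lemma dot_lin_comb a b r s v : dot (lin_comb a b r s) v = of_Z a * dot r v + of_Z b * dot s v.
Proof.
elim: r s v => [|x r IH] [|y s] [|z v]; rewrite /= ?mulr0 ?addr0 ?add0r //.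
- by rewrite dot_scale of_ZM mulrDr mulrA.
- by rewrite dot_scale of_ZM mulrDr mulrA.
- by rewrite IH of_ZD !of_ZM; ring.
Qed.

Lemma primitive_part_dot r v : dot r v = 0 -> dot (primitive_part r) v = 0.
Proof.
rewrite /primitive_part; case: ifP => // /andP[g0 /eqP gr] rv.
by move: rv; rewrite -{1}gr dot_scale => /eqP; rewrite mulf_eq0 of_Z_eq0 (negbTE g0) /= => /eqP.
Qed.

Lemma eliminate_dot p r x v : dot p (x :: v) = 0 -> dot r (x :: v) = 0 ->
  dot (eliminate p r) v = 0.
Proof.
move=> pv rv; apply: primitive_part_dot.
set s := lin_comb _ _ _ _; have : dot s (x :: v) = 0 by rewrite dot_lin_comb pv rv !mulr0 addr0.
rewrite dot_cons (_ : head Z0 s = Z0); first by rewrite /of_Z mul0r add0r.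
by rewrite /s; case: (p) (r) => [|a p'] [|b r'] //=; lia.
Qed.

(** Back substitution: once the later coordinates vanish, the pivot row leaves a nonzero multiple of
    the first one. *)
Lemma free_columns_sound v rows : (forall r, r \in rows -> dot r v = 0) ->
  (forall x, x \in mask (free_columns (size v) rows) v -> x = 0) ->
  forall x, x \in v -> x = 0.
Proof.
elim: v rows => //= x v IH rows rows0.
case pE: [seq r <- rows | _] => [|p ps] mask0.
  have heads r : r \in rows -> head Z0 r = Z0.
    move=> rr; apply/eqP/negPn/negP => h0.
    have : r \in [seq r <- rows | head Z0 r != Z0] by rewrite mem_filter h0.
    by rewrite pE.
  have x0 : x = 0 by apply: mask0; rewrite mem_head.
  move=> y; rewrite inE => /orP[/eqP -> //|]; apply: (IH (map behead rows)).
    move=> _ /mapP[r rr ->]; have := rows0 r rr.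
    by rewrite dot_cons (heads _ rr) /of_Z mul0r add0r.
  by move=> z zm; apply: mask0; rewrite /= inE zm orbT.
have : p \in [seq r <- rows | head Z0 r != Z0] by rewrite pE mem_head.
rewrite mem_filter => /andP[hp p_rows].
have v0 : forall y, y \in v -> y = 0.
  apply: (IH [seq eliminate p r | r <- rows]) => [_ /mapP[r rr ->]|//].
  by apply: (@eliminate_dot _ _ x); apply: rows0.
move=> y; rewrite inE => /orP[/eqP ->|]; last exact: v0.
move: (rows0 p p_rows); rewrite dot_cons dot_eq0 // addr0 => /eqP.
by rewrite mulf_eq0 of_Z_eq0 (negbTE hp) /= => /eqP.
Qed.

Section Terms.

Variables n d : nat.

Definition mono (s : seq nat) : 'X_{1..n} := [multinom nth 0%N s i | i < n].

Definition of_terms (ts : terms) : {mpoly k[n]} :=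
  \sum_(t <- ts) of_Z t.1 *: 'X_[mono t.2].

Lemma mono_incr (i : 'I_n) s : mono (incr_nth s i) = (U_(i) + mono s)%MM.
Proof. by apply/mnmP => l; rewrite mnmDE !mnmE nth_incr_nth. Qed.

Lemma of_terms_mul (c : nat -> Z) ts :
  of_terms (mul_terms n c ts) = linform (fun i : 'I_n => of_Z (c i)) * of_terms ts.
Proof.
rewrite /of_terms /mul_terms big_flatten big_map mulr_sumr; apply: eq_bigr => -[a s] _ /=.
rewrite big_map -[n in iota 0 n]subn0 -/(index_iota 0 n) big_mkord /linform mulr_suml.
apply: eq_bigr => i _ /=; rewrite mono_incr mpolyXD of_ZM.
by rewrite -scalerAl -scalerAr scalerA.
Qed.

Lemma size_mul_terms c ts : all (fun t => size t.2 == n) ts ->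
  all (fun t => size t.2 == n) (mul_terms n c ts).
Proof.
move/allP => sz; apply/allP => t /flatten_mapP[[a s] ts_t /mapP[i]].
rewrite mem_iota => /= i_n ->; have /eqP /= sn := sz _ ts_t.
by rewrite size_incr_nth sn i_n.
Qed.

Section OfForm.

Variables (c : 'I_n -> k) (j : nat) (Lam : {linear {mpoly k[n]} -> k^o}).
Hypothesis ann : annihilates d c j Lam.

Let value s : k := Lam 'X_[mono s].

Lemma value_notin s : size s = n -> s \notin columns n d j -> value s = 0.
Proof.
move=> sn; rewrite mem_filter mem_exponents sn eqxx /= negb_and => /orP[sj|].
  apply: (ann_deg ann); apply: contraNneq sj => <-.
  rewrite mdegE sumnE (big_nth 0%N) sn big_mkord; apply/eqP/eq_bigr => i _.
  by rewrite mnmE.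
rewrite -has_predC => /hasP[a /(nthP 0%N)[i i_s <-]] /=; rewrite -leqNgt sn in i_s *.
move=> /subnK e; pose l := Ordinal i_s.
have : (U_(l) *+ d <= mono s)%MM.
  apply/mnm_lepP => u; rewrite mulmnE mnm1E mnmE; case: eqP => // <-.
  by rewrite mul1n -e leq_addl.
by move=> le; rewrite /value -(submK le) addmC mpolyXD -mpolyXn; apply: (ann_var ann).
Qed.

(** Terms outside [columns] are lost in the row, and [Lam] vanishes on them. *)
Lemma dot_coef_row ts : all (fun t => size t.2 == n) ts ->
  dot (coef_row (columns n d j) ts) (map value (columns n d j)) = Lam (of_terms ts).
Proof.
have dotE cols (f : seq nat -> Z) :
    dot (map f cols) (map value cols) = \sum_(s <- cols) of_Z (f s) * value s.
  by elim: cols => [|s cols IH]; rewrite ?big_nil ?big_cons //= IH.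
rewrite dotE /of_terms linear_sum /=; elim: ts => [|[a u] ts IH] /=.
  by move=> _; rewrite big_nil big1 // => s _; rewrite /of_Z mul0r.
case/andP => /eqP un /IH; rewrite big_cons linearZ /= => <-.
have [u_in|u_in] := boolP (u \in columns n d j).
  rewrite !(bigD1_seq u) ?filter_uniq ?exponents_uniq //= eqxx of_ZD mulrDl -addrA.
  by congr (_ + (_ + _)); apply: eq_bigr => s su; rewrite eq_sym (negbTE su).
rewrite -/(value u) value_notin // scaler0 add0r; apply: eq_big_seq => s s_in.
by case: eqP => // us; rewrite us s_in in u_in.
Qed.

End OfForm.

(** A sample form with the distinct integer coefficients [1, .., n], so that the elimination can be
    run over [Z] for all fields at once. *)
Definition shifted (i : 'I_n) : k := i.+1%:R.

Lemma relations0 j (Lam : {linear {mpoly k[n]} -> k^o}) : annihilates d shifted j Lam ->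
  forall ts, ts \in relations n d j ->
  all (fun t => size t.2 == n) ts /\ Lam (of_terms ts) = 0.
Proof.
move=> ann ts; rewrite mem_cat => /orP[] /mapP[u]; rewrite mem_filter mem_exponents.
all: case/andP => _ /andP[un _] ->.
  split; first by apply: size_mul_terms; rewrite /= un.
  rewrite of_terms_mul -[RHS](ann_lin ann (of_terms [:: (Zpos xH, u)])); congr (Lam (_ * _)).
  by apply: eq_bigr => i _; rewrite of_Z_nat.
set t := [:: _]; have [sz E] : all (fun t => size t.2 == n) (iter d (mul_terms n (fun=> Zpos xH)) t) /\
    of_terms (iter d (mul_terms n (fun=> Zpos xH)) t) = linform (fun=> 1) ^+ d * of_terms t.
  elim: (d) => [|e [sz IH]] /=; first by rewrite un expr0 mul1r.
  by split; [apply: size_mul_terms | rewrite of_terms_mul IH mulrA exprS].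
by split=> //; rewrite E; apply: (ann_sum ann).
Qed.

Lemma coker_le_free_exponents j : (coker d shifted j <= size (free_exponents n d j))%N.
Proof.
rewrite -(size_map mono); apply: coker_le_form => Lam ann free0.
set cols := columns n d j; pose v := [seq (Lam 'X_[mono s] : k) | s <- cols].
have v0 : forall x, x \in v -> x = 0.
  apply: (@free_columns_sound v (map (coef_row cols) (relations n d j))).
    move=> _ /mapP[ts ts_in ->]; have [sz ts0] := relations0 ann ts_in.
    by rewrite (dot_coef_row ann).
  rewrite size_map -map_mask => _ /mapP[s s_in ->].
  by apply: free0; apply/mapP; exists s.
move=> m; pose s := [seq m i | i <- enum 'I_n].
have ms : mono s = m.
  by apply/mnmP => i; rewrite mnmE (nth_map i) ?size_enum_ord // nth_ord_enum.
rewrite -ms; have [s_in|s_in] := boolP (s \in cols); last first.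
  by apply: (value_notin ann) => //; rewrite size_map size_enum_ord.
by apply: v0; apply/mapP; exists s.
Qed.

Lemma free_exponents_ok_lefschetz p : free_exponents_ok n d p ->
  exists c : 'I_n -> k, forall i, inj_at d c i \/ sur_at d c i.
Proof.
case/andP => /allP ok /eqP full; exists shifted; apply: (@lefschetz_of_coker _ _ _ _ p).
  move=> j le_j; have := coker_le_free_exponents j; have : j \in iota 0 p.+1 by rewrite mem_iota.
  by move/ok/Z.leb_le => ok_j le; apply: Z.le_trans ok_j; lia.
by apply/eqP; rewrite -leqn0 -full; apply: coker_le_free_exponents.
Qed.

End Terms.

End Certificate.

Lemma lefschetz_exceptional (k : fieldType) (char_k : [pchar k] =i pred0) (n d : nat) :
  (0 < n)%N -> (0 < d)%N -> exceptional n d ->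
  exists c : 'I_n -> k, forall i, inj_at d c i \/ sur_at d c i.
Proof.
move=> n_gt0 d_gt0 /or3P[|/eqP ->|].
- case: n n_gt0 => [|[|[|[|//]]]] // _ _.
  + exact: lefschetz_n1.
  + exact: lefschetz_n2.
  + exact: lefschetz_n3.
- exact: lefschetz_d1.
rewrite !inE => /or4P[] /eqP[-> ->].
- exact: free_exponents_ok_lefschetz free_exponents_ok_4_2.
- exact: free_exponents_ok_lefschetz free_exponents_ok_5_2.
- exact: free_exponents_ok_lefschetz free_exponents_ok_5_3.
- exact: free_exponents_ok_lefschetz free_exponents_ok_7_2.
Qed.

Theorem theorem1p1 (k : fieldType) (char_k : [pchar k] =i pred0)
    (n d : nat) (n_gt0 : (0 < n)%N) (d_gt0 : (0 < d)%N) :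
  for_general_linear_forms (fun a : 'M[k]_(n.+1, n) =>
    (~~ exceptional n d ->
       ~ weak_lefschetz (pow_quot a d_gt0) (pow_quot_gr a d_gt0)) /\
    (exceptional n d ->
       weak_lefschetz (pow_quot a d_gt0) (pow_quot_gr a d_gt0))).
Proof.
exists (fun a => genericity a != 0); split.
- exact: genericity_open.
- exact: genericity_nonempty.
move=> a gen_a; have wlpE := iff_trans (weak_lefschetzE a d_gt0)
  (iff_trans (generic_wlp d_gt0 gen_a) (nideal_wlpP k n d)).
split=> [nex /wlpE|ex]; first exact: not_lefschetz_exceptional.
by apply/wlpE; apply: lefschetz_exceptional.
Qed.
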